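(* Let $G$ be a $P$-periodic strip-like domain and let $a\in\boldsymbol{\mathcal A}\cap C^{3,\tilde\varrho}$ (some $\tilde\varrho\in(0,1]$) be a positive $P$-periodic (in $x$) function with $\Delta\ln a\ge0$ in $G$. Let $\hat{\mathbf\Gamma}\in\mathbf X(G)\cap C^{3,\tilde\varrho}$ be a classical solution at $\hat{\boldsymbol\lambda}\in\mathbb{R}_+^2$ such that $\hat{\mathbf\Gamma}\in\boldsymbol{\mathcal R}(\hat{\boldsymbol\lambda};\rho_0)\cap\boldsymbol{\mathcal S}(\hat{\boldsymbol\lambda};r_0)$ for some $\rho_0\in(0,\pi)$, $r_0>0$. Let $t_0\in\mathbb{R}$, and let $\boldsymbol\lambda(t)=(\lambda_1(t),\lambda_2(t)):\mathbb{R}\to\mathbb{R}_+^2$ be smooth with $\boldsymbol\lambda(t_0)=\hat{\boldsymbol\lambda}$, $\lambda_1$ strictly increasing from $0$ to $+\infty$ and $\lambda_2$ strictly decreasing from $+\infty$ to $0$. Let $I\ni t_0$ be an open interval and $\mathbf\Gamma(t):I\to\mathbf X(G)\cap C^{3,\tilde\varrho}$ a locally Lipschitz-continuously varying, positively ordered parametrized solution family with $\mathbf\Gamma(t_0)=\hat{\mathbf\Gamma}$ such that $\mathbf\Gamma(t)$ is a classical solution at $\boldsymbol\lambda(t)$ for each $t\in I$. Then $\hat{\mathbf\Gamma}$ is the unique classical solution at $\hat{\boldsymbol\lambda}$ among all curve-pairs $\tilde{\mathbf\Gamma}\in\mathbf X(G)$ such that $\mathbf\Gamma(t^-)<\tilde{\mathbf\Gamma}<\mathbf\Gamma(t^+)$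 for some values $t^\pm\in I$ with $t^-<t_0<t^+$.
   Context: Periodic setting. Points of $\mathbb{R}^2$ are $p=(x,y)$; $P>0$ is fixed; a set or function is $P$-periodic (in $x$) if it is invariant under $(x,y)\mapsto(x+P,y)$. $\mathrm X$ is the family of all infinite, $P$-periodic directed arcs $\Gamma$, directed from $x=-\infty$ to $x=\infty$, such that the winding number $W(\Gamma;p)$ about any point $p\notin\Gamma$ is $\pm1/2$; $D_1(\Gamma)=\{W(\Gamma;\cdot)=-1/2\}$ (lower complement), $D_2(\Gamma)=\{W(\Gamma;\cdot)=1/2\}$ (upper complement). Write $\Gamma\le\Gamma'$ if $D_1(\Gamma)\subset D_1(\Gamma')$ or $D_2(\Gamma')\subset D_2(\Gamma)$, and $\Gamma<\Gamma'$ if $\mathrm{Cl}(D_1(\Gamma))\subset D_1(\Gamma')$ or $\mathrm{Cl}(D_2(\Gamma'))\subset D_2(\Gamma)$. $\mathbf X$ is the set of pairs $\mathbf\Gamma=(\Gamma_1,\Gamma_2)\in\mathrm X\times\mathrm X$ with $\Gamma_1<\Gamma_2$; inequalities between pairs are component-wise. $\Omega(\mathbf\Gamma):=D_1(\Gamma_2)\cap D_2(\Gamma_1)$; the capacitary potential $U(\mathbf\Gamma;\cdot)$ is the continuous $P$-periodic function on $\mathrm{Cl}(\Omega(\mathbf\Gamma))$, harmonic in $\Omega(\mathbf\Gamma)$, equal to $0$ on $\Gamma_1$ and $1$ on $\Gamma_2$. $G$ is a simply-connected, $P$-periodic (in $x$), strip-like domain having interior and exterior tangent balls of uniform radius at all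 boundary points, with lower and upper boundary components $\partial^-G,\partial^+G\in\mathrm X$. $\mathbf X(G)$ (resp. $\mathbf X(\overline G)$) is the set of $\mathbf\Gamma=(\Gamma_1,\Gamma_2)\in\mathbf X$ with $\partial^-G<\Gamma_1<\Gamma_2<\partial^+G$ (resp. $\partial^-G\le\Gamma_1<\Gamma_2\le\partial^+G$). Given constants $0<\underline A\le\overline A$ and $A_1,A_2>0$, $\boldsymbol{\mathcal A}$ is the class of $C^2$-functions $a:\mathbb{R}^2\to(0,\infty)$ with $\underline A\le a\le\overline A$ whose first (resp. second) order partial derivatives are bounded in absolute value by $A_1$ (resp. $A_2$). For $\boldsymbol\lambda=(\lambda_1,\lambda_2)\in\mathbb{R}_+^2$ ($\mathbb{R}_+=(0,\infty)$), a classical solution at $\boldsymbol\lambda$ is a pair $\mathbf\Gamma=(\Gamma_1,\Gamma_2)$ with $|\nabla U(\mathbf\Gamma;p)|=\lambda_i a(p)$ on $\Gamma_i$, $i=1,2$. Put $\mu:=\ln(\lambda_2/\lambda_1)$. $\boldsymbol{\mathcal R}(\boldsymbol\lambda;\rho_0)$ is the set of all solutions $\mathbf\Gamma\in\mathbf X(\overline G)$ at $\boldsymbol\lambda$ with $\mathrm{capacity}(\Omega)\,|\mu|\le\pi-\rho_0$, where $\mathrm{capacity}(\Omega):=\lambda_1\int_{\Gamma_1}a\,ds=\lambda_2\int_{\Gamma_2}a\,ds$ (integrals over one $P$-period). $\boldsymbol{\mathcal S}(\boldsymbol\lambda;r)$ is the set of all classical solutions $\mathbf\Gamma\in\mathbf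 X(\overline G)$ at $\boldsymbol\lambda$ such that $a\in C^{2,1}$ is weakly logarithmically subharmonic in $\Omega=\Omega(\mathbf\Gamma)$ and $E(\mathbf\Gamma)>r+\sqrt{\mu^2+1}-1$, where $E(\mathbf\Gamma):=\inf\{|\nabla W(p)|/|\nabla U(p)|:p\in\partial\Omega\}$, $U=U(\mathbf\Gamma;\cdot)$, and $W$ solves $\Delta W=\Delta\ln a$ in $\Omega$, $W=0$ on $\partial\Omega$. A family $t\mapsto\mathbf\Gamma(t)$ is positively ordered if $\mathbf\Gamma(\alpha)<\mathbf\Gamma(\beta)$ whenever $\alpha<\beta$ in $I$; (Lipschitz) continuity in $t$ is with respect to the Hausdorff distance of the component arcs. *)

(* Defs.v *)
From HB Require Import structures.
From mathcomp Require Import all_boot all_order all_algebra.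
From mathcomp Require Import all_classical all_reals all_analysis.
Import Order.TTheory GRing.Theory Num.Theory.
Import numFieldNormedType.Exports.

Set Implicit Arguments.
Unset Strict Implicit.
Unset Printing Implicit Defensive.

Local Open Scope ring_scope.
Local Open Scope classical_set_scope.

Section Plane.
Context {R : realType}.
Implicit Types (p q : R * R) (f a : R * R -> R) (D : set (R * R)).

(* The library norm on [R * R] is the max norm, with the same topology; metric
   notions (gradient length, balls, Hausdorff distance) use the Euclidean one. *)
Definition enorm p : R := Num.sqrt (p.1 ^+ 2 + p.2 ^+ 2).
Definition edist2 p q : R := enorm (p - q).
Definition eball p (r : R) : set (R * R) := [set q | edist2 p q < r].

Definition frontier D : set (R * R) := closure D `\` interior D.

Definition periodic_set (P : R) D : Prop := forall p, D (p + (P, 0)) <-> D p.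
Definition periodic_fun (P : R) f : Prop := forall p, f (p + (P, 0)) = f p.

Definition dx f : R * R -> R := fun p => 'D_((1, 0) : R * R) f p.
Definition dy f : R * R -> R := fun p => 'D_((0, 1) : R * R) f p.
Definition laplacian f p : R := dx (dx f) p + dy (dy f) p.

Fixpoint Ck (k : nat) D f : Prop :=
  (forall p, D p -> {for p, continuous f}) /\
  match k with
  | 0%N => True
  | k'.+1 =>
      (forall p, D p -> derivable f p ((1, 0) : R * R)
                        /\ derivable f p ((0, 1) : R * R))
      /\ Ck k' D (dx f) /\ Ck k' D (dy f)
  end.

Definition locally_holder (T : Type) (d : T -> T -> R) (alpha : R)
    (g : T -> R) : Prop :=
  forall z, exists r C : R, 0 < r /\
    forall x y, d z x < r -> d z y < r -> `|g x - g y| <= C * (d x y) `^ alpha.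

(* [C^{k,alpha}] on the whole plane, the Hoelder bounds being local. *)
Definition Ck_alpha (k : nat) (alpha : R) f : Prop :=
  Ck k setT f /\
  forall i j : nat, (i + j = k)%N ->
    locally_holder edist2 alpha (iter i dx (iter j dy f)).

(* The value at a boundary point of the continuous extension of the gradient
   from inside; meaningful under [C1_up_to_boundary]. *)
Definition bgrad D f p : R * R :=
  (lim (dx f q @[q --> within D (nbhs p)]),
   lim (dy f q @[q --> within D (nbhs p)])).
Definition C1_up_to_boundary D f : Prop :=
  forall p, frontier D p -> cvg (dx f q @[q --> within D (nbhs p)])
                            /\ cvg (dy f q @[q --> within D (nbhs p)]).

Definition directed_arc (g : R -> R * R) : Prop :=
  [/\ continuous g, injective g,
      (g s).1 @[s --> -oo] --> -oo & (g s).1 @[s --> +oo] --> +oo].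

(* [th] is a continuous determination of the argument of [g s - p] along the
   arc; [w] is its net change in turns, counterclockwise positive. *)
Definition has_winding (G : set (R * R)) p (w : R) : Prop :=
  exists (g : R -> R * R) (th : R -> R) (lm lp : R),
    [/\ directed_arc g /\ range g = G,
        continuous th,
        forall s, g s - p = (edist2 (g s) p * cos (th s),
                             edist2 (g s) p * sin (th s)),
        (th @ -oo --> lm) /\ (th @ +oo --> lp)
      & w = (lp - lm) / (2 * pi)].

Definition winding (G : set (R * R)) p : R := xget 0 [set w | has_winding G p w].

Definition arcX (P : R) : set (set (R * R)) := [set G |
  [/\ exists g, directed_arc g /\ range g = G,
      periodic_set P G &
      forall p, ~ G p -> winding G p = 2^-1 \/ winding G p = - 2^-1]].

Definition D1 (G : set (R * R)) : set (R * R) :=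
  [set p | ~ G p /\ winding G p = - 2^-1].
Definition D2 (G : set (R * R)) : set (R * R) :=
  [set p | ~ G p /\ winding G p = 2^-1].

Definition arc_le (G H : set (R * R)) : Prop :=
  D1 G `<=` D1 H \/ D2 H `<=` D2 G.
Definition arc_lt (G H : set (R * R)) : Prop :=
  closure (D1 G) `<=` D1 H \/ closure (D2 H) `<=` D2 G.

Definition curve_pair := (set (R * R) * set (R * R))%type.
Implicit Types Gam : curve_pair.

Definition pair_lt Gam Gam' : Prop :=
  arc_lt Gam.1 Gam'.1 /\ arc_lt Gam.2 Gam'.2.

Definition pairX (P : R) : set curve_pair := [set Gam |
  [/\ arcX P Gam.1, arcX P Gam.2 & arc_lt Gam.1 Gam.2]].

Definition Omega Gam : set (R * R) := D1 Gam.2 `&` D2 Gam.1.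

Definition velocity (g : R -> R * R) (s : R) : R * R :=
  ((fst \o g)^`() s, (snd \o g)^`() s).

Definition regular_curve (k : nat) (alpha : R) (G : set (R * R)) : Prop :=
  exists g : R -> R * R,
    [/\ directed_arc g /\ range g = G,
        forall (j : nat) s, (j < k)%N ->
          derivable ((fst \o g)^`(j)) s 1 /\ derivable ((snd \o g)^`(j)) s 1,
        locally_holder (fun s t => `|s - t|) alpha ((fst \o g)^`(k)),
        locally_holder (fun s t => `|s - t|) alpha ((snd \o g)^`(k)) &
        forall s, velocity g s <> (0, 0)].

Definition pair_regular (k : nat) (alpha : R) : set curve_pair := [set Gam |
  regular_curve k alpha Gam.1 /\ regular_curve k alpha Gam.2].

(* [v] is the arc-length integral of [a] over one [P]-period of [G]. *)
Definition period_integral (P : R) a (G : set (R * R)) (v : R) : Prop :=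
  exists (g : R -> R * R) (s0 s1 : R),
    [/\ directed_arc g /\ range g = G,
        forall s, derivable (fst \o g) s 1 /\ derivable (snd \o g) s 1,
        continuous (fst \o g)^`() /\ continuous (snd \o g)^`(),
        g s1 = g s0 + (P, 0) &
        v = \int[lebesgue_measure]_(s in `[s0, s1])
              (a (g s) * enorm (velocity g s))].

Definition hausdorff_dist (A B : set (R * R)) : \bar R :=
  let e A B := ereal_sup [set ereal_inf [set (edist2 p q)%:E | q in B]
                         | p in A] in
  maxe (e A B) (e B A).

Definition simply_connected D : Prop :=
  connected D /\
  forall g : R -> R * R,
    {within `[0, 1], continuous g} -> g 0 = g 1 -> g @` `[0, 1] `<=` D ->
    exists (H : R * R -> R * R) (c : R * R),
      [/\ {within `[0, 1] `*` `[0, 1], continuous H},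
          H @` (`[0, 1] `*` `[0, 1]) `<=` D,
          forall s, `[0, 1] s -> H (0, s) = g s,
          forall s, `[0, 1] s -> H (1, s) = c &
          forall u, `[0, 1] u -> H (u, 0) = H (u, 1)].

Definition uniform_tangent_balls D : Prop :=
  exists2 r : R, 0 < r & forall p, frontier D p ->
    (exists2 c, edist2 c p = r & eball c r `<=` D) /\
    (exists2 c, edist2 c p = r & eball c r `<=` ~` closure D).

(* [Gm], [Gp]: lower and upper boundary components of [G]. *)
Definition strip_like_domain (P : R) (G Gm Gp : set (R * R)) : Prop :=
  [/\ open G /\ simply_connected G,
      periodic_set P G,
      pairX P (Gm, Gp),
      G = Omega (Gm, Gp) /\ frontier G = Gm `|` Gp &
      uniform_tangent_balls G].

Definition pairX_in (P : R) (Gm Gp : set (R * R)) : set curve_pair := [set Gam |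
  [/\ pairX P Gam, arc_lt Gm Gam.1, arc_lt Gam.1 Gam.2 & arc_lt Gam.2 Gp]].
Definition pairX_in_closure (P : R) (Gm Gp : set (R * R)) : set curve_pair :=
  [set Gam |
  [/\ pairX P Gam, arc_le Gm Gam.1, arc_lt Gam.1 Gam.2 & arc_le Gam.2 Gp]].

Definition classA (Alo Ahi A1 A2 : R) : set (R * R -> R) := [set a |
  [/\ Ck 2 setT a,
      forall p, 0 < a p,
      forall p, Alo <= a p /\ a p <= Ahi,
      forall p, `|dx a p| <= A1 /\ `|dy a p| <= A1 &
      forall p, [/\ `|dx (dx a) p| <= A2, `|dx (dy a) p| <= A2,
                    `|dy (dx a) p| <= A2 & `|dy (dy a) p| <= A2]]].

Definition harmonic D f : Prop :=
  Ck 2 D f /\ forall p, D p -> laplacian f p = 0.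

Definition log_subharmonic D a : Prop :=
  forall p, D p -> 0 <= laplacian (fun q => ln (a q)) p.

(* [U] represents the capacitary potential; only its restriction to
   [closure (Omega Gam)] is constrained. *)
Definition capacitary_potential (P : R) Gam (U : R * R -> R) : Prop :=
  [/\ {within closure (Omega Gam), continuous U},
      forall p, closure (Omega Gam) p -> U (p + (P, 0)) = U p,
      harmonic (Omega Gam) U,
      forall p, Gam.1 p -> U p = 0 &
      forall p, Gam.2 p -> U p = 1].

Definition classical_solution (P : R) a (lam : R * R) : set curve_pair :=
  [set Gam | pairX P Gam /\ exists U,
  [/\ capacitary_potential P Gam U,
      C1_up_to_boundary (Omega Gam) U,
      forall p, Gam.1 p -> enorm (bgrad (Omega Gam) U p) = lam.1 * a p &
      forall p, Gam.2 p -> enorm (bgrad (Omega Gam) U p) = lam.2 * a p]].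

Definition mu (lam : R * R) : R := ln (lam.2 / lam.1).

Definition has_capacity (P : R) a (lam : R * R) Gam (c : R) : Prop :=
  exists v1 v2, [/\ period_integral P a Gam.1 v1, period_integral P a Gam.2 v2,
                    c = lam.1 * v1 & c = lam.2 * v2].

Definition classR (P : R) (Gm Gp : set (R * R)) a (lam : R * R) (rho0 : R) :
    set curve_pair := [set Gam |
  [/\ pairX_in_closure P Gm Gp Gam,
      classical_solution P a lam Gam &
      exists2 c, has_capacity P a lam Gam c & c * `|mu lam| <= pi - rho0]].

(* [Delta W = Delta (ln a)] in [Omega Gam], [W = 0] on its boundary; as for the
   potential, periodicity is what makes the solution unique. *)
Definition W_solution (P : R) a Gam (W : R * R -> R) : Prop :=
  [/\ {within closure (Omega Gam), continuous W},
      forall p, closure (Omega Gam) p -> W (p + (P, 0)) = W p,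
      Ck 2 (Omega Gam) W,
      forall p, Omega Gam p ->
        laplacian W p = laplacian (fun q => ln (a q)) p &
      forall p, frontier (Omega Gam) p -> W p = 0].

Definition E_value Gam (U W : R * R -> R) : R :=
  inf [set enorm (bgrad (Omega Gam) W p) / enorm (bgrad (Omega Gam) U p)
      | p in frontier (Omega Gam)].

Definition classS (P : R) (Gm Gp : set (R * R)) a (lam : R * R) (r : R) :
    set curve_pair := [set Gam |
  [/\ pairX_in_closure P Gm Gp Gam,
      classical_solution P a lam Gam,
      Ck_alpha 2 1 a,
      log_subharmonic (Omega Gam) a &
      exists U W,
        [/\ capacitary_potential P Gam U,
            W_solution P a Gam W,
            C1_up_to_boundary (Omega Gam) W &
            E_value Gam U W > r + Num.sqrt (mu lam ^+ 2 + 1) - 1]]].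

Definition smooth (f : R -> R) : Prop := forall n t, derivable (f^`(n)) t 1.

Definition locally_lipschitz_family (I : set R) (F : R -> curve_pair) : Prop :=
  forall t, I t -> exists L d : R, 0 < d /\
    forall s s', I s -> I s' -> `|s - t| < d -> `|s' - t| < d ->
      (hausdorff_dist (F s).1 (F s').1 <= (L * `|s - s'|)%:E)%E /\
      (hausdorff_dist (F s).2 (F s').2 <= (L * `|s - s'|)%:E)%E.

Definition positively_ordered (I : set R) (F : R -> curve_pair) : Prop :=
  forall s t, I s -> I t -> s < t -> pair_lt (F s) (F t).

End Plane.

(* Main.v *)
(* Let [Gam t*] be the last member of the family, with [t* < t0], that is still below a
   solution [Y] at [lamhat].  At a contact of the lower curves, the potential of [Gam t*]
   dominates the one of [Y] near the contact point by the maximum principle, so its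
   gradient there is at least as long; but the two lengths are [lam1 t* a < lam1 t0 a].
   A contact of the upper curves is excluded in the same way since [lam2] decreases.
   Hence [Gam t0] lies below [Y], and by symmetry above it, so that they coincide.

   The inequalities on [lam] being strict, this takes the place of Hopf's lemma.  The
   gradients are continuous up to the boundary and do not vanish there, so the rays
   along them give [Omega] a collar along each arc.  That every point of an arc is
   adherent to both sides, and that strict and weak orders behave as expected, follows
   from the continuity of winding numbers and the connectedness of the plane. *)
Require Import Defs.
From HB Require Import structures.
From mathcomp Require Import all_boot all_order all_algebra.
From mathcomp Require Import all_classical all_reals all_analysis.
From mathcomp Require Import ring lra.
Import Order.TTheory GRing.Theory Num.Theory.
Import numFieldNormedType.Exports.

Set Implicit Arguments.
Unset Strict Implicit.
Unset Printing Implicit Defensive.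

Local Open Scope ring_scope.
Local Open Scope classical_set_scope.

(** * Euclidean plane *)

Section Plane.
Context {R : realType}.
Implicit Types (p q z : R * R) (r s t u : R) (A B D : set (R * R)).

(** What shapes the argument is the passage from strict orders to their limit. The sides [D1] and
    [D2] are level sets of a winding number, and no definition makes them connected. Their
    connectedness is extracted from the collars, and a potential gives a collar only on the side of
    an arc that faces [Omega]. So the limit of the lower arcs is taken with the upper side of [Y],
    that of the upper arcs with the lower side of the limit arc itself. The second one uses the
    monotonicity of the family, and the two limit lemmas are not mirror images of each other.

    At time [t0] the prescribed boundary slopes of the two solutions agree and a contact can no
    longer be excluded. Each comparison therefore ends with the weak order, and equality comes from
    having it in both directions.

    Arcs are replaced by abstract barriers with an orientation [sg], because exchanging the names of
    the two sides also exchanges the two arcs, the two slopes and, through [1 - U], the boundary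
    values. The collar and the comparison of slopes are then proved on the lower arc only. *)

Definition dotp p q : R := p.1 * q.1 + p.2 * q.2.
Definition crsp p q : R := p.1 * q.2 - p.2 * q.1.

Lemma enorm_ge0 p : 0 <= enorm p.
Proof. exact: sqrtr_ge0. Qed.

Lemma enorm2 p : enorm p ^+ 2 = p.1 ^+ 2 + p.2 ^+ 2.
Proof. by rewrite sqr_sqrtr // addr_ge0 // sqr_ge0. Qed.

Lemma enorm_le p (c : R) : 0 <= c -> p.1 ^+ 2 + p.2 ^+ 2 <= c ^+ 2 -> enorm p <= c.
Proof. by move=> c0 h; rewrite -(@ler_pXn2r _ 2%N) ?nnegrE ?enorm_ge0 // enorm2. Qed.

Lemma enorm_eq0 p : enorm p = 0 -> p = 0.
Proof.
move=> h; have := enorm2 p; rewrite h expr0n /= => /esym /eqP.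
rewrite paddr_eq0 ?sqr_ge0 // !sqrf_eq0 => /andP[/eqP h1 /eqP h2].
by rewrite (surjective_pairing p) h1 h2.
Qed.

Lemma enorm_gt0 p : p <> 0 -> 0 < enorm p.
Proof.
move=> p0; rewrite lt_neqAle enorm_ge0 andbT.
by apply/negP => /eqP h; apply: p0; apply: enorm_eq0.
Qed.

Lemma enormN p : enorm (- p) = enorm p.
Proof. by rewrite /enorm /= !sqrrN. Qed.

Lemma enorm_cst c p : enorm (c * p.1, c * p.2) = `|c| * enorm p.
Proof. by rewrite /enorm /= !exprMn -mulrDr sqrtrM ?sqr_ge0 // sqrtr_sqr. Qed.

Lemma dotp_le p q : `|dotp p q| <= enorm p * enorm q.
Proof.
rewrite -(@ler_pXn2r _ 2%N) ?nnegrE ?mulr_ge0 ?enorm_ge0 //.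
rewrite exprMn !enorm2 real_normK ?num_real // /dotp.
have := sqr_ge0 (p.1 * q.2 - p.2 * q.1); nra.
Qed.

Lemma crsp_le p q : `|crsp p q| <= enorm p * enorm q.
Proof.
rewrite -(@ler_pXn2r _ 2%N) ?nnegrE ?mulr_ge0 ?enorm_ge0 //.
rewrite exprMn !enorm2 real_normK ?num_real // /crsp.
have := sqr_ge0 (p.1 * q.1 + p.2 * q.2); nra.
Qed.

Lemma enormD p q : enorm (p + q) <= enorm p + enorm q.
Proof.
apply: enorm_le; first by rewrite addr_ge0 ?enorm_ge0.
have := dotp_le p q; rewrite ler_norml => /andP[_].
rewrite [X in _ -> _ <= X]sqrrD !enorm2 /dotp /= => h; lra.
Qed.
Lemma edist2_tri p z q : edist2 p q <= edist2 p z + edist2 z q.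
Proof. by rewrite /edist2; apply: le_trans (enormD _ _); rewrite addrA subrK. Qed.
Lemma edist2C p q : edist2 p q = edist2 q p.
Proof. by rewrite /edist2 -enormN opprB. Qed.

Lemma edist2xx p : edist2 p p = 0.
Proof. by rewrite /edist2 subrr /enorm /= expr0n /= addr0 sqrtr0. Qed.

Lemma edist2_ge0 p q : 0 <= edist2 p q.
Proof. exact: enorm_ge0. Qed.

Lemma edist2_gt0 p q : p <> q -> 0 < edist2 p q.
Proof.
by move=> pq; apply: enorm_gt0 => h; apply: pq; apply/eqP; rewrite -subr_eq0 h.
Qed.

Lemma enorm_coord p : `|p.1| <= enorm p /\ `|p.2| <= enorm p.
Proof.
split; rewrite -(@ler_pXn2r _ 2%N) ?nnegrE ?enorm_ge0 // enorm2 real_normK ?num_real //.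
  by rewrite lerDl sqr_ge0.
by rewrite lerDr sqr_ge0.
Qed.

Lemma enorm_le_sum p : enorm p <= `|p.1| + `|p.2|.
Proof.
apply: enorm_le; first by rewrite addr_ge0.
rewrite sqrrD !real_normK ?num_real //.
have : 0 <= `|p.1| * `|p.2| by rewrite mulr_ge0.
by lra.
Qed.

(** The max norm is at most the Euclidean one, which is at most the sum of the absolute values of
    the coordinates; hence the radius [r / 2] in the converse. *)
Lemma nbhs_edist p A : nbhs p A <-> exists2 r : R, 0 < r & forall q, edist2 p q < r -> A q.
Proof.
split.
- move=> /nbhs_ballP[e /= e0 he]; exists e => // q pq; apply: he.
  have [h1 h2] := enorm_coord (p - q).
  by split => /=; apply: le_lt_trans pq.
- move=> [r r0 h]; apply/nbhs_ballP; exists (r / 2) => /=; first by rewrite divr_gt0.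
  move=> q [/= h1 h2]; apply: h; apply: le_lt_trans (enorm_le_sum _) _.
  rewrite /ball /= in h1 h2; rewrite /=; lra.
Qed.

Lemma open_edist A : open A <-> forall p, A p -> exists2 r : R, 0 < r & forall q, edist2 p q < r -> A q.
Proof.
split; first by move=> oA p Ap; apply/nbhs_edist; apply: open_nbhs_nbhs.
by move=> h; rewrite openE => p Ap; apply/nbhs_edist; apply: h.
Qed.

Lemma closure_edist A p : closure A p <-> forall r, 0 < r -> exists2 q, A q & edist2 p q < r.
Proof.
split.
- move=> cA r r0.
  have /cA[q [Aq /= hq]] : nbhs p [set q | edist2 p q < r] by apply/nbhs_edist; exists r.
  by exists q.
- move=> h B /nbhs_edist[r r0 hB]; have [q Aq pq] := h r r0.
  by exists q; split => //; apply: hB.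
Qed.

Lemma nbhsR s (A : set R) : nbhs s A <-> exists2 r : R, 0 < r & forall t, `|t - s| < r -> A t.
Proof.
split.
- move=> /nbhs_ballP[e /= e0 he]; exists e => // t st; apply: he.
  by rewrite /ball /= distrC.
- move=> [r r0 h]; apply/nbhs_ballP; exists r => //= t; rewrite /ball /= distrC; exact: h.
Qed.

Lemma cont_curve (c : R -> R * R) : continuous c <->
  forall s e, 0 < e -> exists2 d : R, 0 < d & forall t, `|t - s| < d -> edist2 (c s) (c t) < e.
Proof.
split.
- move=> cc s e e0; have /cc : nbhs (c s) [set q | edist2 (c s) q < e].
    by apply/nbhs_edist; exists e.
  by move=> /nbhsR.
- move=> h s A /nbhs_edist[r r0 hA]; apply/nbhsR.
  by have [d d0 hd] := h s r r0; exists d => // t st; apply: hA; apply: hd.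
Qed.

(** Connectedness of the line. Predicates and radii are the form in which connectedness is used for
    arcs, segments and sides alike. *)
Lemma locally_constant_line (Q : R -> Prop) :
  (forall s, exists2 d : R, 0 < d & forall t, `|t - s| < d -> (Q s <-> Q t)) ->
  forall s t, Q s -> Q t.
Proof.
move=> hQ s t Qs.
have cT : connected [set: R] by apply/connected_intervalP => x y _ _ z _.
have QT : [set x | Q x] = setT.
  apply: cT; first by exists s.
  - exists [set x | Q x]; rewrite ?setTI // openE => x /= Qx; apply/nbhsR.
    by have [d d0 hd] := hQ x; exists d => // y /hd[/(_ Qx)].
  - exists [set x | Q x]; rewrite ?setTI // -openC openE => x /= Qx; apply/nbhsR.
    by have [d d0 hd] := hQ x; exists d => // y /hd[_ h] /h.
by have : [set x | Q x] t by rewrite QT.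
Qed.
Definition seg p q t : R * R := p + (t * (q - p).1, t * (q - p).2).

Lemma seg0 p q : seg p q 0 = p.
Proof. by rewrite /seg !mul0r addr0. Qed.

Lemma seg1 p q : seg p q 1 = q.
Proof. by rewrite /seg !mul1r -surjective_pairing addrC subrK. Qed.

Lemma edist2_seg p q s t : edist2 (seg p q s) (seg p q t) = `|s - t| * edist2 p q.
Proof.
rewrite /edist2 /seg -[in RHS]enormN -enorm_cst; congr enorm.
by case: p q => [p1 p2] [q1 q2]; congr pair => /=; ring.
Qed.
Lemma edist2_seg_l p q t : edist2 p (seg p q t) = `|t| * edist2 p q.
Proof. by rewrite -{1}(seg0 p q) edist2_seg sub0r normrN. Qed.

End Plane.

(** * Winding numbers and the two sides of an arc *)

Section Winding.
Context {R : realType}.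
Implicit Types (p q z h k : R * R) (r s t u : R) (A B D G : set (R * R)) (c g : R -> R * R).

Definition polar (h : R * R) (th : R) : Prop := h = (enorm h * cos th, enorm h * sin th).

(* The signed angle from [h] to [k], when it is less than a right angle. *)
Definition turn h k : R := atan (crsp h k / dotp h k).

(** By Lagrange's identity, [dotp h k ^+ 2 + crsp h k ^+ 2 = (enorm h * enorm k) ^+ 2], so
    [turn h k] has cosine [dotp h k / (enorm h * enorm k)] and sine
    [crsp h k / (enorm h * enorm k)]. A positive [dotp h k] puts the arctangent on the right
    branch. *)
Lemma polar_turn h k th : 0 < dotp h k -> polar h th -> polar k (th + turn h k).
Proof.
move=> d0 hp; rewrite /polar /turn; set x := crsp h k / dotp h k.
have h0 : 0 < enorm h.
  rewrite lt_neqAle enorm_ge0 andbT eq_sym; apply/eqP => /enorm_eq0 hh.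
  by move: d0; rewrite hh /dotp /= !mul0r addr0 ltxx.
have k0 : 0 < enorm k.
  rewrite lt_neqAle enorm_ge0 andbT eq_sym; apply/eqP => /enorm_eq0 hh.
  by move: d0; rewrite hh /dotp /= !mulr0 addr0 ltxx.
have cs : cos (atan x) = dotp h k / (enorm h * enorm k).
  rewrite cos_atan; have -> : 1 + x ^+ 2 = ((enorm h * enorm k) / dotp h k) ^+ 2.
    rewrite /x !expr_div_n exprMn !enorm2.
    rewrite -[X in X + _](@divff _ (dotp h k ^+ 2)) ?expf_neq0 ?gt_eqF // -mulrDl.
    by congr (_ / _); rewrite /dotp /crsp; ring.
  rewrite sqrtr_sqr ger0_norm ?invf_div // divr_ge0 ?ltW //.
  by rewrite mulr_gt0.
have sn : sin (atan x) = crsp h k / (enorm h * enorm k).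
  have c0 : cos (atan x) != 0 by rewrite gt_eqF // cs divr_gt0 // mulr_gt0.
  have := atanK x; rewrite /tan => /(canRL (divfK c0)) ->.
  by rewrite cs /x; field; rewrite !gt_eqF.
rewrite cosD sinD cs sn.
have [e1 e2] : h.1 = enorm h * cos th /\ h.2 = enorm h * sin th by rewrite {1 3}hp.
have cth : cos th = h.1 / enorm h by rewrite e1 mulrAC divff ?mul1r ?gt_eqF.
have sth : sin th = h.2 / enorm h by rewrite e2 mulrAC divff ?mul1r ?gt_eqF.
rewrite cth sth.
have hk : enorm h != 0 by rewrite gt_eqF.
have kk : enorm k != 0 by rewrite gt_eqF.
have E := enorm2 h.
rewrite [LHS]surjective_pairing; congr pair.
- transitivity (((h.1 ^+ 2 + h.2 ^+ 2) * k.1) / enorm h ^+ 2); last by rewrite /dotp /crsp; field; rewrite hk kk.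
  by rewrite -E mulrAC divff ?mul1r // expf_neq0.
- transitivity (((h.1 ^+ 2 + h.2 ^+ 2) * k.2) / enorm h ^+ 2); last by rewrite /dotp /crsp; field; rewrite hk kk.
  by rewrite -E mulrAC divff ?mul1r // expf_neq0.
Qed.

Lemma sin_eq0 (u : R) : cos u = 1 -> sin u = 0.
Proof.
move=> cu; apply/eqP; rewrite -sqrf_eq0; have := cos2Dsin2 u.
by rewrite cu expr1n => /eqP; rewrite -subr_eq0 addrAC subrr add0r.
Qed.

(** Two determinations of the same argument differ by such a [d]. Numbers of cosine 1 are isolated,
    so the intermediate value theorem leaves no room for a change. *)
Lemma cos_eq1_cst (d : R -> R) : continuous d -> (forall s, cos (d s) = 1) -> forall s t, d s = d t.
Proof.
move=> cd d1.
have key s t : d s < d t -> False.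
  (* The cap [pi / 2] keeps [v - d s] where the cosine decreases strictly from 1. *)
  move=> st; pose v := Num.min (d t) (d s + pi / 2).
  have vs : d s < v by rewrite lt_min st ltrDl divr_gt0 ?pi_gt0.
  have vt : v <= d t by rewrite ge_min lexx.
  have [x xv] : exists x, d x = v.
    have [ab|/ltW ab] := leP s t.
      have [|x _ xv] := @IVT R d s t v ab (continuous_subspaceT cd); last by exists x.
      by rewrite (min_idPl (ltW st)) (max_idPr (ltW st)) (ltW vs).
    have [|x _ xv] := @IVT R d t s v ab (continuous_subspaceT cd); last by exists x.
    by rewrite (min_idPr (ltW st)) (max_idPl (ltW st)) (ltW vs).
  have := d1 x; rewrite xv -(subrK (d s) v) cosD d1.
  rewrite (sin_eq0 (d1 s)).
  rewrite mulr1 mulr0 subr0 => h.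
  have : cos (v - d s) < cos 0.
    rewrite ltr_cos ?subr_gt0 // in_itv /=; first by rewrite lexx pi_ge0.
    have : v <= d s + pi / 2 by rewrite ge_min lexx orbT.
    by have := @pi_gt0 R; move=> ? ?; apply/andP; split; lra.
  by rewrite h cos0 ltxx.
by move=> s t; have [/key|/key|] := ltgtP (d s) (d t).
Qed.

Lemma polar_eq h t u : h <> 0 -> polar h t -> polar h u -> cos (t - u) = 1.
Proof.
move=> h0; have hp := enorm_gt0 h0; rewrite /polar.
case: h h0 hp => h1 h2 h0; set e := enorm _ => hp [t1 t2] [u1 u2].
have cc : cos t = cos u by apply: (mulfI (lt0r_neq0 hp)); rewrite -t1.
have ss : sin t = sin u by apply: (mulfI (lt0r_neq0 hp)); rewrite -t2.
by rewrite cosB cc ss -!expr2 cos2Dsin2.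
Qed.

Lemma cont_fst c : continuous c -> continuous (fun s : R => (c s).1).
Proof. move=> cc s. apply: (@continuous_comp _ _ _ c fst); first exact: cc. exact: cvg_fst. Qed.

Lemma cont_snd c : continuous c -> continuous (fun s : R => (c s).2).
Proof. move=> cc s. apply: (@continuous_comp _ _ _ c snd); first exact: cc. exact: cvg_snd. Qed.

Lemma cont_subc c z : continuous c -> continuous (fun s : R => c s - z).
Proof.
move=> /cont_curve cc; apply/cont_curve => s e e0.
have [d d0 hd] := cc s e e0; exists d => // t /hd.
by rewrite /edist2 opprB addrA subrK.
Qed.

Lemma cont_turn (h k : R -> R * R) : continuous h -> continuous k ->
  (forall s, 0 < dotp (h s) (k s)) -> continuous (fun s => turn (h s) (k s)).
Proof.
move=> ch ck d0 s.
apply: (@continuous_comp _ _ _ (fun s => crsp (h s) (k s) / dotp (h s) (k s)) atan); last exact: continuous_atan.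
have h1 := cont_fst ch; have h2 := cont_snd ch; have k1 := cont_fst ck; have k2 := cont_snd ck.
apply: (@cvgM _ _ (nbhs s)).
  by apply: (@cvgB _ _ _ (nbhs s)); apply: (@cvgM _ _ (nbhs s)); [exact: h1|exact: k2|exact: h2|exact: k1].
apply: (@cvgV _ _ (nbhs s)); first by rewrite gt_eqF.
by apply: (@cvgD _ _ _ (nbhs s)); apply: (@cvgM _ _ (nbhs s)); [exact: h1|exact: k1|exact: h2|exact: k2].
Qed.

Definition lifts c z (th : R -> R) := continuous th /\ forall s, polar (c s - z) (th s).

Lemma dotp_sub_gt0 h v : enorm v < enorm h -> 0 < dotp h (h - v).
Proof.
move=> vh; have h0 := le_lt_trans (enorm_ge0 v) vh.
have -> : dotp h (h - v) = enorm h ^+ 2 - dotp h v by rewrite enorm2 /dotp /=; ring.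
rewrite subr_gt0; apply: le_lt_trans (ler_norm _) _; apply: le_lt_trans (dotp_le _ _) _.
by rewrite expr2 ltr_pM2l.
Qed.

(** While the viewpoint moves by less than its distance to the curve, every direction turns by less
    than a right angle, and [turn] corrects the argument without a choice of branch. *)
Lemma lifts_perturb c z z' th : continuous c -> lifts c z th ->
  (forall s, edist2 z z' < edist2 (c s) z) ->
  lifts c z' (fun s => th s + turn (c s - z) (c s - z')).
Proof.
move=> cc [cth hth] hz.
have d0 s : 0 < dotp (c s - z) (c s - z').
  have -> : c s - z' = (c s - z) - (z' - z) by rewrite opprB addrA subrK.
  by apply: dotp_sub_gt0; rewrite -/(edist2 z' z) edist2C; exact: hz.
split; last by move=> s; apply: polar_turn.
move=> s; apply: (@cvgD _ _ _ (nbhs s)); first exact: cth.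
by apply: (cont_turn (h := fun s => c s - z)); [exact: cont_subc|exact: cont_subc|exact: d0].
Qed.

Lemma turn_small (v : R * R) (e : R) : 0 < e ->
  exists M : R, forall h, M < enorm h -> `|turn h (h - v)| < e.
Proof.
move=> e0; have /cvgrPdist_lt/(_ e e0) := @continuous_atan R 0.
rewrite atan0 => /nbhsR[d d0 hd].
(* The quotient in [turn] is at most [enorm v / (enorm h - enorm v)] in absolute value; this
   threshold makes it smaller than [d]. *)
exists (enorm v + enorm v / d) => h vh.
have vd : 0 <= enorm v / d by rewrite divr_ge0 ?enorm_ge0 // ltW.
have hv : enorm v < enorm h by apply: le_lt_trans vh; rewrite lerDl.
have := hd (crsp h (h - v) / dotp h (h - v)); rewrite sub0r normrN subr0; apply.
have dg := dotp_sub_gt0 hv.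
rewrite normrM normfV (gtr0_norm dg) ltr_pdivrMr //.
have -> : crsp h (h - v) = - crsp h v by rewrite /crsp /=; ring.
rewrite normrN; apply: le_lt_trans (crsp_le _ _) _.
have -> : dotp h (h - v) = enorm h ^+ 2 - dotp h v by rewrite enorm2 /dotp /=; ring.
have hdv : dotp h v <= enorm h * enorm v by apply: le_trans (ler_norm _) (dotp_le _ _).
apply: (@lt_le_trans _ _ (d * (enorm h ^+ 2 - enorm h * enorm v))); last first.
  by rewrite ler_pM2l // lerB.
have h0 := le_lt_trans (enorm_ge0 v) hv.
have -> : d * (enorm h ^+ 2 - enorm h * enorm v) = enorm h * (d * (enorm h - enorm v)) by ring.
rewrite ltr_pM2l //.
by rewrite mulrC -ltr_pdivrMr // ltrBrDl.
Qed.

(** A bounded move of the viewpoint is seen from infinity under a vanishing angle. Applied at both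
    ends, this shows that the move preserves the winding number. *)
Lemma lifts_perturb_lim c z z' th (F : set_system R) (l : R) : ProperFilter F ->
  enorm (c s) @[s --> F] --> +oo -> th @ F --> l ->
  (fun s => th s + turn (c s - z) (c s - z')) @ F --> l.
Proof.
move=> PF cF tF; rewrite -[l]addr0; apply: cvgD => //.
apply/cvgrPdist_lt => e e0; have [M hM] := turn_small (z' - z) e0.
have /cvgryPgt/(_ (M + enorm z)) := cF; apply: filterS => s hs.
rewrite sub0r normrN.
have -> : c s - z' = (c s - z) - (z' - z) by rewrite opprB addrA subrK.
apply: hM; have := enormD (c s - z) z; rewrite subrK => h.
by rewrite -(ltrD2r (enorm z)); apply: lt_le_trans hs h.
Qed.

(** * Properness of arcs and changes of parameter *)

Lemma arc_ninfty g (M : R) : directed_arc g -> exists N : R, forall s, s < N -> (g s).1 < M.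
Proof. by case=> _ _ /cvgrNyPlt/(_ M)[N [_ hN]] _; exists N. Qed.

Lemma arc_pinfty g (M : R) : directed_arc g -> exists N : R, forall s, N < s -> M < (g s).1.
Proof. by case=> _ _ _ /cvgryPgt/(_ M)[N [_ hN]]; exists N. Qed.

Lemma arc_enorm_ninfty g : directed_arc g -> enorm (g s) @[s --> -oo] --> +oo.
Proof.
case=> _ _ h _; apply/cvgryPgt => M; have /cvgrNyPlt/(_ (- M)) := h.
by apply: filterS => s hs; have [] := enorm_coord (g s); rewrite ler_norml; lra.
Qed.

Lemma arc_enorm_pinfty g : directed_arc g -> enorm (g s) @[s --> +oo] --> +oo.
Proof.
case=> _ _ _ h; apply/cvgryPgt => M; have /cvgryPgt/(_ M) := h.
by apply: filterS => s hs; have [] := enorm_coord (g s); rewrite ler_norml; lra.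
Qed.

Lemma arc_bounded_params g (M : R) : directed_arc g ->
  exists N : R, forall s, `|(g s).1| <= M -> `|s| <= N.
Proof.
move=> dg; have [N1 h1] := arc_ninfty (- M) dg; have [N2 h2] := arc_pinfty M dg.
exists (Num.max (- N1) N2) => s; rewrite !ler_norml => /andP[s1 s2].
have a1 : N1 <= s by rewrite leNgt; apply/negP => /h1; lra.
have a2 : s <= N2 by rewrite leNgt; apply/negP => /h2; lra.
by rewrite lerNl !le_max; apply/andP; split; apply/orP; [left; lra|right].
Qed.

(** Points near [z] have bounded abscissas, hence parameters in a compact interval. *)
Lemma arc_closed_image g (K : set R) : directed_arc g -> closed K -> closed (g @` K).
Proof.
move=> dg cK; have cg : continuous g by case: dg.
move=> z cz; have [N hN] := arc_bounded_params (`|z.1| + 1) dg.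
have cpt : compact (g @` (`[- N, N] `&` K)).
  apply: continuous_compact; first exact: continuous_subspaceT.
  by apply: compact_closedI => //; exact: segment_compact.
have hT : hausdorff_space (R * R)%type by exact: norm_hausdorff.
have : closure (g @` (`[- N, N] `&` K)) z.
  apply/closure_edist => r r0; have m0 : 0 < Num.min r 1 by rewrite lt_min r0 ltr01.
  have /closure_edist/(_ _ m0)[q [s Ks <-] hq] := cz.
  exists (g s); last by apply: lt_le_trans hq _; rewrite ge_min lexx.
  exists s => //; split => //=; rewrite in_itv /= -ler_norml; apply: hN.
  have [h1 _] := enorm_coord (z - g s).
  have {}h1 : `|z.1 - (g s).1| < 1 by apply: le_lt_trans h1 _; apply: lt_le_trans hq _; rewrite ge_min lexx orbT.
  have := ler_normB z.1 (z.1 - (g s).1); rewrite subKr; lra.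
have -> : closure (g @` (`[- N, N] `&` K)) = g @` (`[- N, N] `&` K).
  by apply/esym/closure_id; apply: compact_closed.
by case=> s [_ Ks] <-; exists s.
Qed.

Lemma arc_dist_gt0 g (K : set R) z : directed_arc g -> closed K -> ~ (g @` K) z ->
  exists2 d : R, 0 < d & forall s, K s -> d <= edist2 (g s) z.
Proof.
move=> dg cK nz.
have /open_edist/(_ z nz)[d d0 hd] : open (~` (g @` K)) by rewrite openC; exact: arc_closed_image.
by exists d => // s Ks; rewrite edist2C leNgt; apply/negP => /hd; apply; exists s.
Qed.

(** The parameters at distance at least [e] from [phi s] have a closed image that misses [c s]; by
    continuity [c t] stays off that image for [t] near [s]. *)
Lemma arc_param_cont g (c : R -> R * R) (phi : R -> R) : directed_arc g -> continuous c ->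
  (forall s, g (phi s) = c s) -> continuous phi.
Proof.
move=> dg cc gphi s; have ig : injective g by case: dg.
apply/cvgrPdist_lt => e e0.
have cK : closed [set t : R | e <= `|phi s - t|].
  rewrite -openC openE => t /= /negP; rewrite -ltNge => ht; apply/nbhsR.
  exists (e - `|phi s - t|); first by rewrite subr_gt0.
  move=> u ut /=; apply/negP; rewrite -ltNge.
  by have := ler_normD (phi s - t) (t - u); rewrite addrA subrK distrC in ut *; lra.
have nz : ~ (g @` [set t : R | e <= `|phi s - t|]) (c s).
  by case=> t /= ht; rewrite -gphi => /ig tt; move: ht; rewrite tt subrr normr0 leNgt e0.
have [d d0 hd] := arc_dist_gt0 dg cK nz.
have /cont_curve/(_ s d d0)[r r0 hr] := cc.
apply/nbhsR; exists r => // t /hr; rewrite -gphi => ht.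
rewrite ltNge; apply/negP => /hd; rewrite gphi edist2C gphi in ht *; lra.
Qed.

(** On parameters up to [M] the abscissa of [g] is bounded above, far to the left by its limit and
    on the rest by compactness. Once [c] is further to the right, [phi] exceeds [M]. *)
Lemma arc_param_pinfty g (c : R -> R * R) (phi : R -> R) : directed_arc g -> directed_arc c ->
  (forall s, g (phi s) = c s) -> phi @ +oo --> +oo.
Proof.
move=> dg dc gphi; apply/cvgryPgt => M.
have cg : continuous g by case: dg.
have [N hN] := arc_ninfty 0 dg.
have [B hB] : exists B : R, forall s, s <= M -> (g s).1 <= B.
  have [NM|MN] := leP N M; last by exists 0 => s sM; apply/ltW/hN/(le_lt_trans sM).
  have [b _ hb] := @EVT_max R (fun s => (g s).1) _ _ NM (continuous_subspaceT (cont_fst cg)).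
  exists (Num.max 0 (g b).1) => s sM; rewrite le_max.
  have [sN|Ns] := ltP s N; first by rewrite ltW // hN.
  by rewrite hb ?orbT // in_itv /= Ns.
have [K hK] := arc_pinfty B dc.
exists K; split; first exact: num_real.
by move=> s /hK; rewrite -gphi => h; rewrite ltNge; apply/negP => /hB; lra.
Qed.

Lemma arc_param_ninfty g (c : R -> R * R) (phi : R -> R) : directed_arc g -> directed_arc c ->
  (forall s, g (phi s) = c s) -> phi @ -oo --> -oo.
Proof.
move=> dg dc gphi; apply/cvgrNyPlt => M.
have cg : continuous g by case: dg.
have [N hN] := arc_pinfty 0 dg.
have [B hB] : exists B : R, forall s, M <= s -> B <= (g s).1.
  have [NM|MN] := leP M N; last by exists 0 => s sM; apply/ltW/hN/(lt_le_trans MN).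
  have [b _ hb] := @EVT_min R (fun s => (g s).1) _ _ NM (continuous_subspaceT (cont_fst cg)).
  exists (Num.min 0 (g b).1) => s sM; rewrite ge_min.
  have [sN|Ns] := ltP N s; first by rewrite ltW // hN.
  by rewrite hb ?orbT // in_itv /= sM.
have [K hK] := arc_ninfty B dc.
exists K; split; first exact: num_real.
by move=> s /hK; rewrite -gphi => h; rewrite ltNge; apply/negP => /hB; lra.
Qed.

Lemma lifts_eq_shift c p th th' : ~ (range c) p -> lifts c p th -> lifts c p th' ->
  forall s t, th s - th' s = th t - th' t.
Proof.
move=> np [c1 h1] [c2 h2]; move=> s t.
pose d := fun x => th x - th' x.
have cd : continuous d.
  by move=> x; apply: (@cvgB _ _ _ (nbhs x)); [exact: c1|exact: c2].
have d1 x : cos (d x) = 1.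
  apply: (@polar_eq (c x - p)) => //.
  by move=> /eqP; rewrite subr_eq0 => /eqP e; apply: np; exists x.
exact: (@cos_eq1_cst d cd d1).
Qed.

(** The definition of the winding number leaves the parametrization free. The change of parameter
    between two of them is continuous and respects both ends, so a fixed one can serve
    throughout. *)
Lemma has_winding_lifts g G p w : directed_arc g -> range g = G -> has_winding G p w ->
  exists (th : R -> R) (lm lp : R), [/\ lifts g p th, th @ -oo --> lm, th @ +oo --> lp & w = (lp - lm) / (2 * pi)].
Proof.
move=> dg gG [g' [th [lm [lp [[dg' g'G] cth hth [hlm hlp] ->]]]]].
have /choice[phi hphi] : forall s, exists t, g' t = g s.
  move=> s.
  have : G (g s) by rewrite -gG; exists s.
  by rewrite -g'G => -[t _ h]; exists t.
have cg : continuous g by case: dg.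
have cphi := arc_param_cont dg' cg hphi.
exists (th \o phi), lm, lp; split => //.
- split; first by move=> s; apply: continuous_comp; [exact: cphi|exact: cth].
  by move=> s /=; rewrite -hphi /polar -/(edist2 (g' (phi s)) p); exact: hth.
- by apply: (cvg_comp _ _ _ hlm); exact: arc_param_ninfty dg' dg hphi.
- by apply: (cvg_comp _ _ _ hlp); exact: arc_param_pinfty dg' dg hphi.
Qed.

Lemma lifts_has_winding g p th lm lp : directed_arc g -> lifts g p th ->
  th @ -oo --> lm -> th @ +oo --> lp -> has_winding (range g) p ((lp - lm) / (2 * pi)).
Proof. by move=> dg [cth hth] hlm hlp; exists g, th, lm, lp; split. Qed.

Lemma has_winding_open G p w : ~ G p -> has_winding G p w ->
  exists2 d : R, 0 < d & forall q, edist2 p q < d -> ~ G q /\ has_winding G q w.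
Proof.
move=> Gp hw; case: (hw) => g [_ [_ [_ [[dg gG] _ _ _ _]]]].
have [th [lm [lp [hl h1 h2 ->]]]] := has_winding_lifts dg gG hw.
have cg : continuous g by case: dg.
rewrite -gG in Gp *; have [d d0 hd] := arc_dist_gt0 dg closedT Gp.
exists d => // q pq.
have hq s : edist2 p q < edist2 (g s) p by apply: lt_le_trans pq _; exact: hd.
split; first by move=> [s _ gs]; have := hq s; rewrite gs edist2C ltxx.
apply: (@lifts_has_winding g q (fun s => th s + turn (g s - p) (g s - q))) => //.
- exact: lifts_perturb.
- by apply: lifts_perturb_lim => //; exact: arc_enorm_ninfty.
- by apply: lifts_perturb_lim => //; exact: arc_enorm_pinfty.
Qed.

Lemma shift_lim (F : set_system R) (f f' : R -> R) (l l' : R) : ProperFilter F ->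
  (forall s t, f s - f' s = f t - f' t) -> f @ F --> l -> f' @ F --> l' -> f 0 - f' 0 = l - l'.
Proof.
move=> PF h hf hf'; have FF : Filter F by apply: PF.
have := @cvgB _ _ _ F FF f f' l l' hf hf'.
have -> : f - f' = cst (f 0 - f' 0) by apply/funext => s; exact: h.
by move=> /(cvg_lim (@Rhausdorff R)) <-; rewrite lim_cst.
Qed.

Lemma has_winding_uniq G p w w' : ~ G p -> has_winding G p w -> has_winding G p w' -> w = w'.
Proof.
move=> Gp hw hw'; case: (hw) => g [_ [_ [_ [[dg gG] _ _ _ _]]]].
have [th [lm [lp [hl h1 h2 ->]]]] := has_winding_lifts dg gG hw.
have [th' [lm' [lp' [hl' h1' h2' ->]]]] := has_winding_lifts dg gG hw'.
rewrite -gG in Gp; have E := lifts_eq_shift Gp hl hl'.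
have e1 : th 0 - th' 0 = lm - lm' by apply: shift_lim _ E h1 h1'.
have e2 : th 0 - th' 0 = lp - lp' by apply: shift_lim _ E h2 h2'.
by congr (_ / _); lra.
Qed.

Lemma polar_shift h t u : cos u = 1 -> polar h t -> polar h (t + u).
Proof.
move=> cu.
by rewrite /polar cosD sinD cu (sin_eq0 cu) !mulr0 !mulr1 subr0 addr0.
Qed.

Lemma arc_shift g s0 : directed_arc g -> directed_arc (fun s => g (s + s0)).
Proof.
move=> [cg ig gm gp]; split.
- move=> s; apply: (@continuous_comp _ _ _ (fun s => s + s0) g); last exact: cg.
  by apply: (@cvgD _ _ _ (nbhs s)); [exact: cvg_id|exact: cvg_cst].
- by move=> s t /ig /addIr.
- apply/cvgrNyPlt => M; have /cvgrNyPlt/(_ M)[N [_ hN]] := gm.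
  by exists (N - s0); split; [exact: num_real|move=> s hs; apply: hN; rewrite -ltrBrDr].
- apply/cvgryPgt => M; have /cvgryPgt/(_ M)[N [_ hN]] := gp.
  by exists (N - s0); split; [exact: num_real|move=> s hs; apply: hN; rewrite -ltrBlDr].
Qed.

(* A homeomorphism from an arc onto a disc would map the vertices of a triangle to
   three reals; by the intermediate value theorem the side opposite to the vertex with
   the middle parameter would pass through that vertex. *)
Lemma arc_no_ball g p r : directed_arc g -> 0 < r ->
  exists2 q, edist2 p q < r & ~ range g q.
Proof.
move=> dg r0; apply: contrapT => H.
have {}H q : edist2 p q < r -> range g q.
  by move=> pq; apply: contrapT => nq; apply: H; exists q.
have ball_seg a b t : edist2 p a < r -> edist2 p b < r -> 0 <= t <= 1 -> edist2 p (seg a b t) < r.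
  move=> pa pb /andP[t0 t1].
  have -> : edist2 p (seg a b t) =
      enorm (((1 - t) * (p - a).1, (1 - t) * (p - a).2) + (t * (p - b).1, t * (p - b).2)).
    by rewrite /edist2 /seg; congr enorm; case: p a b {pa pb H} => [? ?] [? ?] [? ?]; congr pair => /=; ring.
  apply: le_lt_trans (enormD _ _) _; rewrite !enorm_cst !ger0_norm ?subr_ge0 //.
  rewrite -/(edist2 p a) -/(edist2 p b).
  have := edist2_ge0 p a; have := edist2_ge0 p b; have [t00|t00] := eqVneq t 0; first by rewrite t00; lra.
  have : 0 < t by rewrite lt_neqAle eq_sym t00.
  nra.
have key a b m al be ga : edist2 p a < r -> edist2 p b < r -> g al = a -> g be = b -> g ga = m ->
    al < ga -> ga < be -> exists t, m = seg a b t.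
  move=> pa pb ga_ gb_ gm_ h1 h2.
  (* Clamping extends the path along the side of the triangle to the whole line, as [arc_param_cont]
     expects. *)
  pose cl t := Num.max 0 (Num.min t 1).
  have clP t : 0 <= cl t <= 1 by rewrite /cl le_max lexx /= ge_max ler01 ge_min lexx orbT.
  have ccl : continuous cl.
    move=> t; apply: (@continuous_max _ _ (cst 0) (fun t => Num.min t 1)); first exact: cvg_cst.
    by apply: (@continuous_min _ _ id (cst 1)); [exact: cvg_id|exact: cvg_cst].
  have /choice[psi hpsi] : forall t, exists s, g s = seg a b (cl t).
    by move=> t; have [s _ hs] := H _ (ball_seg a b _ pa pb (clP t)); exists s.
  have cseg : continuous (fun t => seg a b (cl t)).
    apply/cont_curve => s e e0.
    have d0 : 0 < e / (edist2 a b + 1) by rewrite divr_gt0 // ltr_wpDl ?edist2_ge0.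
    have /cvgrPdist_lt/(_ _ d0)/nbhsR[d dd hd] := ccl s.
    exists d => // t /hd; rewrite edist2_seg ltr_pdivlMr ?ltr_wpDl ?edist2_ge0 // => h.
    by apply: le_lt_trans h; rewrite ler_wpM2l // lerDl.
  have cpsi := arc_param_cont dg cseg hpsi.
  have ig : injective g by case: dg.
  have p0 : psi 0 = al by apply: ig; rewrite hpsi ga_ /cl minEle ler01 maxxx seg0.
  have p1 : psi 1 = be by apply: ig; rewrite hpsi gb_ /cl minxx (max_idPr ler01) seg1.
  have [|t _ pt] := @IVT R psi 0 1 ga ler01 (continuous_subspaceT cpsi).
    by rewrite p0 p1 ge_min le_max (ltW h1) (ltW h2) orbT.
  by exists (cl t); rewrite -hpsi pt gm_.
pose a := p; pose b := p + (r / 2, 0); pose c := p + (0, r / 2).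
have r2 : 0 < r / 2 by rewrite divr_gt0.
have pa : edist2 p a < r by rewrite edist2xx.
have e1 : enorm ((r / 2, 0) : R * R) = r / 2 by rewrite /enorm /= [0 ^+ 2]expr0n addr0 sqrtr_sqr ger0_norm // ltW.
have e2 : enorm ((0, r / 2) : R * R) = r / 2 by rewrite /enorm /= [0 ^+ 2]expr0n add0r sqrtr_sqr ger0_norm // ltW.
have pb : edist2 p b < r by rewrite edist2C /edist2 /b addrAC subrr add0r e1; lra.
have pc : edist2 p c < r by rewrite edist2C /edist2 /c addrAC subrr add0r e2; lra.
have [al _ ha] := H _ pa; have [be _ hb] := H _ pb; have [ga _ hc] := H _ pc.
have nab t : c <> seg a b t by rewrite /c /seg /b /a; case: (p) => x y [] /=; nra.
have nba t : c <> seg b a t by rewrite /c /seg /b /a; case: (p) => x y [] /=; nra.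
have nac t : b <> seg a c t by rewrite /c /seg /b /a; case: (p) => x y [] /=; nra.
have nca t : b <> seg c a t by rewrite /c /seg /b /a; case: (p) => x y [] /=; nra.
have nbc t : a <> seg b c t by rewrite /c /seg /b /a; case: (p) => x y [] /=; nra.
have ncb t : a <> seg c b t by rewrite /c /seg /b /a; case: (p) => x y [] /=; nra.
have [ab|ba|ab] := ltgtP al be; last by move: hb; rewrite -ab ha /a /b; case: (p) => x y [] /=; lra.
- have [ac|ca|ac] := ltgtP al ga; last by move: hc; rewrite -ac ha /a /c; case: (p) => x y [] /=; lra.
  + have [bc|cb|bc] := ltgtP be ga; last by move: hc; rewrite -bc hb /b /c; case: (p) => x y [] /=; lra.
    by have [t /nac] := key _ _ _ _ _ _ pa pc ha hc hb ab bc.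
    by have [t /nab] := key _ _ _ _ _ _ pa pb ha hb hc ac cb.
  by have [t /ncb] := key _ _ _ _ _ _ pc pb hc hb ha ca ab.
- have [ac|ca|ac] := ltgtP al ga; last by move: hc; rewrite -ac ha /a /c; case: (p) => x y [] /=; lra.
  + by have [t /nbc] := key _ _ _ _ _ _ pb pc hb hc ha ba ac.
  + have [bc|cb|bc] := ltgtP be ga; last by move: hc; rewrite -bc hb /b /c; case: (p) => x y [] /=; lra.
    by have [t /nba] := key _ _ _ _ _ _ pb pa hb ha hc bc ca.
  by have [t /nca] := key _ _ _ _ _ _ pc pa hc ha hb cb ba.
Qed.

(* [phi] is the direction of [c 0] seen from [z], in the determination of the argument
   that tends to [l] at the other end of the half arc. *)
Definition half_lift c (F : set_system R) (l : R) z (phi : R) : Prop :=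
  ~ range c z /\ exists th, [/\ lifts c z th, th @ F --> l & th 0 = phi].

Lemma half_lift_uniq c F l z phi phi' : ProperFilter F ->
  half_lift c F l z phi -> half_lift c F l z phi' -> phi = phi'.
Proof.
move=> PF [nz [th [h1 h2 <-]]] [_ [th' [h1' h2' <-]]].
have e : th 0 - th' 0 = l - l by apply: shift_lim PF (lifts_eq_shift nz h1 h1') h2 h2'.
by apply/eqP; rewrite -subr_eq0 e subrr.
Qed.

Lemma half_lift_perturb c F l z z' phi : ProperFilter F -> continuous c ->
  enorm (c s) @[s --> F] --> +oo ->
  (forall s, edist2 z z' < edist2 (c s) z) ->
  half_lift c F l z phi -> half_lift c F l z' (phi + turn (c 0 - z) (c 0 - z')).
Proof.
move=> PF cc cF hz [nz [th [h1 h2 <-]]]; split.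
  by move=> [s _ cs]; have := hz s; rewrite cs edist2C ltxx.
exists (fun s => th s + turn (c s - z) (c s - z')); split => //.
- exact: lifts_perturb.
- exact: lifts_perturb_lim.
Qed.

(** Because of the minus sign, [theta] is the argument of the center seen from the point of the
    circle, the angle that [half_lift] records. *)
Definition circ (p : R * R) (rho theta : R) : R * R := p - (rho * cos theta, rho * sin theta).

Lemma edist2_circ p rho theta : 0 <= rho -> edist2 p (circ p rho theta) = rho.
Proof.
move=> r0; rewrite /edist2 /circ subKr /enorm /= !exprMn -mulrDr cos2Dsin2 mulr1.
by rewrite sqrtr_sqr ger0_norm.
Qed.

Lemma circ_turn p rho t u : 0 < rho -> `|u - t| < pi / 2 ->
  turn (p - circ p rho t) (p - circ p rho u) = u - t.
Proof.
move=> r0 ut; rewrite /turn /circ !subKr /crsp /dotp /=.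
have -> : rho * cos t * (rho * sin u) - rho * sin t * (rho * cos u) = rho ^+ 2 * sin (u - t).
  by rewrite sinB; ring.
have -> : rho * cos t * (rho * cos u) + rho * sin t * (rho * sin u) = rho ^+ 2 * cos (u - t).
  by rewrite cosB; ring.
rewrite -mulf_div divff ?expf_neq0 ?gt_eqF // mul1r -/(tan (u - t)) tanK //.
by rewrite in_itv /= -ltr_norml.
Qed.

Lemma cont_pair (f1 f2 : R -> R) : continuous f1 -> continuous f2 -> continuous (fun s => (f1 s, f2 s)).
Proof.
by move=> c1 c2 t; apply: (@cvg_pair _ _ _ (nbhs t) (nbhs (f1 t)) (nbhs (f2 t))); [exact: c1|exact: c2].
Qed.

Lemma circ_near p rho t e : 0 < e ->
  exists2 d : R, 0 < d & forall u, `|u - t| < d -> edist2 (circ p rho t) (circ p rho u) < e.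
Proof.
have /cont_curve h : continuous (circ p rho); last by move=> e0; exact: h.
have -> : circ p rho = fun th => (p.1 - rho * cos th, p.2 - rho * sin th).
  by apply/funext => th.
apply: cont_pair => s.
- apply: (@cvgB _ _ _ (nbhs s)); first exact: cvg_cst.
  by apply: (@cvgM _ _ (nbhs s)); [exact: cvg_cst|exact: continuous_cos].
- apply: (@cvgB _ _ _ (nbhs s)); first exact: cvg_cst.
  by apply: (@cvgM _ _ (nbhs s)); [exact: cvg_cst|exact: continuous_sin].
Qed.

(** Along the circle the direction of the center turns by exactly [u - theta], and so does the
    lifted angle; their agreement persists as long as the half arc is avoided. *)
Lemma half_lift_circ c F l rho theta : ProperFilter F -> continuous c -> 0 < rho ->
  enorm (c s) @[s --> F] --> +oo -> closed (range c) -> ~ range c (circ (c 0) rho theta) ->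
  exists2 d : R, 0 < d & forall u, `|u - theta| < d -> ~ range c (circ (c 0) rho u) /\
    (half_lift c F l (circ (c 0) rho theta) theta <-> half_lift c F l (circ (c 0) rho u) u).
Proof.
move=> PF cc r0 cF clc nz; set z := circ _ _ theta in nz *.
have /open_edist/(_ z nz)[d d0 hd] : open (~` range c) by rewrite openC.
have {}hd s : d <= edist2 (c s) z.
  by rewrite edist2C leNgt; apply/negP => /hd; apply; exists s.
(* With half the distance to the half arc, the new viewpoint is still far enough from it for the
   move to be undone, which gives both implications. *)
have d2 : 0 < d / 2 by rewrite divr_gt0.
have [e e0 he] := circ_near (c 0) rho theta d2.
exists (Num.min e (pi / 2)); first by rewrite lt_min e0 divr_gt0 // pi_gt0.
move=> u; rewrite lt_min => /andP[/he zu up].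
have h1 s : edist2 z (circ (c 0) rho u) < edist2 (c s) z by have := hd s; lra.
have h2 s : edist2 (circ (c 0) rho u) z < edist2 (c s) (circ (c 0) rho u).
  rewrite edist2C; have := hd s; have := edist2_tri (c s) (circ (c 0) rho u) z.
  by rewrite [edist2 (circ _ _ _) z]edist2C /z in zu *; lra.
split.
  by move=> [s _ cs]; have := h1 s; rewrite cs edist2C ltxx.
split => H.
- have := half_lift_perturb PF cc cF h1 H; rewrite circ_turn //.
  by rewrite addrC subrK.
- have := half_lift_perturb PF cc cF h2 H; rewrite circ_turn // 1?distrC //.
  by rewrite addrC subrK.
Qed.

Lemma tail_min_lim (f : R -> R) (l : R) : f @ -oo --> l -> (fun s => f (Num.min s 0)) @ -oo --> l.
Proof.
move=> fl; apply: cvg_trans fl; apply: near_eq_cvg; exists 0; split; first exact: num_real.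
by move=> s s0; rewrite (min_idPl (ltW s0)).
Qed.

Lemma tail_max_lim (f : R -> R) (l : R) : f @ +oo --> l -> (fun s => f (Num.max s 0)) @ +oo --> l.
Proof.
move=> fl; apply: cvg_trans fl; apply: near_eq_cvg; exists 0; split; first exact: num_real.
by move=> s s0; rewrite (max_idPl (ltW s0)).
Qed.

Lemma cont_min0 : continuous (fun s : R => Num.min s 0).
Proof. by move=> s; apply: (@continuous_min _ _ id (cst 0)); [exact: cvg_id|exact: cvg_cst]. Qed.

Lemma cont_max0 : continuous (fun s : R => Num.max s 0).
Proof. by move=> s; apply: (@continuous_max _ _ id (cst 0)); [exact: cvg_id|exact: cvg_cst]. Qed.

Lemma lifts_comp c z th (f : R -> R) : continuous f -> lifts c z th ->
  lifts (fun s => c (f s)) z (fun s => th (f s)).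
Proof.
move=> cf [cth hth]; split; last by move=> s; exact: hth.
by move=> s; apply: (@continuous_comp _ _ _ f th); [exact: cf|exact: cth].
Qed.

Lemma lifts_shift c z th (k : R) : cos k = 1 -> lifts c z th -> lifts c z (fun s => th s + k).
Proof.
move=> ck [cth hth]; split; last by move=> s; apply: polar_shift.
by move=> s; apply: (@cvgD _ _ _ (nbhs s)); [exact: cth|exact: cvg_cst].
Qed.

(** The parameter is clamped instead of restricted, so that half arcs remain functions on the whole
    line, constant past 0, to which [lifts] applies. *)
Definition arc_head g : R -> R * R := fun s => g (Num.min s 0).

Definition arc_tail g : R -> R * R := fun s => g (Num.max s 0).

Lemma range_arc_head g : range (arc_head g) = g @` [set s | s <= 0].
Proof.
apply/seteqP; split => z [s hs <-]; last by exists s => //=; rewrite /arc_head (min_idPl hs).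
by exists (Num.min s 0) => //=; rewrite ge_min lexx orbT.
Qed.

Lemma range_arc_tail g : range (arc_tail g) = g @` [set s | 0 <= s].
Proof.
apply/seteqP; split => z [s hs <-]; last by exists s => //=; rewrite /arc_tail (max_idPl hs).
by exists (Num.max s 0) => //=; rewrite le_max lexx orbT.
Qed.

(** Along the whole arc the argument changes by [w * (2 * pi)], so normalizing it by [lm] at the
    left end or by [lm + w * (2 * pi)] at the right end singles out the same determination at
    [g 0]. *)
Lemma half_lift_swap g z w lm phi : directed_arc g -> ~ range g z -> has_winding (range g) z w ->
  half_lift (arc_head g) -oo lm z phi <-> half_lift (arc_tail g) +oo (lm + w * (2 * pi)) z phi.
Proof.
move=> dg nz hw; have pi2 : 2 * pi != 0 :> R by rewrite mulf_neq0 // gt_eqF // pi_gt0.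
have nh : ~ range (arc_head g) z by move=> [s _ es]; apply: nz; exists (Num.min s 0).
have nt : ~ range (arc_tail g) z by move=> [s _ es]; apply: nz; exists (Num.max s 0).
have [th [l1 [l2 [hl h1 h2 ew]]]] := has_winding_lifts dg erefl hw.
have {}ew : w * (2 * pi) = l2 - l1 by rewrite ew divfK.
have nz0 : g 0 - z <> 0 by move=> /eqP; rewrite subr_eq0 => /eqP e; apply: nz; exists 0.
have hlh := lifts_comp cont_min0 hl; have hlt := lifts_comp cont_max0 hl.
split; rewrite ew.
- move=> [_ [th' [h1' h2' e0]]]; split => //.
  have E := shift_lim _ (lifts_eq_shift nh h1' hlh) h2' (tail_min_lim h1).
  rewrite minxx e0 in E.
  have ck : cos (phi - th 0) = 1.
    apply: (polar_eq nz0); last by case: hl => _; exact.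
    by rewrite -e0; case: h1' => _ /(_ 0); rewrite /arc_head minxx.
  exists (fun s => th (Num.max s 0) + (phi - th 0)); split; first exact: lifts_shift.
  + have -> : lm + (l2 - l1) = l2 + (phi - th 0) by rewrite E; lra.
    by apply: cvgD; [exact: tail_max_lim|exact: cvg_cst].
  + by rewrite maxxx addrC subrK.
- move=> [_ [th' [h1' h2' e0]]]; split => //.
  have E := shift_lim _ (lifts_eq_shift nt h1' hlt) h2' (tail_max_lim h2).
  rewrite maxxx e0 in E.
  have ck : cos (phi - th 0) = 1.
    apply: (polar_eq nz0); last by case: hl => _; exact.
    by rewrite -e0; case: h1' => _ /(_ 0); rewrite /arc_tail maxxx.
  exists (fun s => th (Num.min s 0) + (phi - th 0)); split; first exact: lifts_shift.
  + have -> : lm = l1 + (phi - th 0) by rewrite E; lra.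
    by apply: cvgD; [exact: tail_min_lim|exact: cvg_cst].
  + by rewrite minxx addrC subrK.
Qed.

(* If all windings near [g 0] agreed, the angle swept by the half arc ending at [g 0],
   seen from a point of a small circle around [g 0] and continued across that half arc
   by means of the angle swept by the other half, would be a continuous determination
   of the argument on the circle. *)
Lemma arc_winding_jump g r w : directed_arc g -> 0 < r ->
  exists q, [/\ edist2 (g 0) q < r, ~ range g q & ~ has_winding (range g) q w].
Proof.
move=> dg r0; apply: contrapT => H.
have {}H q : edist2 (g 0) q < r -> ~ range g q -> has_winding (range g) q w.
  by move=> q1 q2; apply: contrapT => q3; apply: H; exists q.
have cg : continuous g by case: dg.
have ig : injective g by case: dg.
have [z1 z1r z1n] := arc_no_ball (g 0) dg r0.
have [th [lm [lp [hl h1 h2 ew]]]] := has_winding_lifts dg erefl (H _ z1r z1n).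
set rho := edist2 (g 0) z1 in z1r.
have rho0 : 0 < rho by apply: edist2_gt0 => e; apply: z1n; exists 0.
pose z t := circ (g 0) rho t.
have zr t : edist2 (g 0) (z t) < r by rewrite edist2_circ // ltW.
have ez1 : z (th 0) = z1.
  have [_ /(_ 0)] := hl; rewrite /polar -/(edist2 (g 0) z1) -/rho => e.
  by rewrite /z /circ -e subKr.
have cch : continuous (arc_head g).
  by move=> s; apply: (@continuous_comp _ _ _ (fun s => Num.min s 0) g); [exact: cont_min0|exact: cg].
have cct : continuous (arc_tail g).
  by move=> s; apply: (@continuous_comp _ _ _ (fun s => Num.max s 0) g); [exact: cont_max0|exact: cg].
have clh : closed (range (arc_head g)) by rewrite range_arc_head; apply: arc_closed_image => //; exact: closed_le.
have clt : closed (range (arc_tail g)) by rewrite range_arc_tail; apply: arc_closed_image => //; exact: closed_ge.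
have Fh : enorm (arc_head g s) @[s --> -oo] --> +oo.
  apply: cvg_trans (arc_enorm_ninfty dg); apply: near_eq_cvg; exists 0; split; first exact: num_real.
  by move=> s s0; rewrite /arc_head (min_idPl (ltW s0)).
have Ft : enorm (arc_tail g s) @[s --> +oo] --> +oo.
  apply: cvg_trans (arc_enorm_pinfty dg); apply: near_eq_cvg; exists 0; split; first exact: num_real.
  by move=> s s0; rewrite /arc_tail (max_idPl (ltW s0)).
have g0h : arc_head g 0 = g 0 by rewrite /arc_head minxx.
have g0t : arc_tail g 0 = g 0 by rewrite /arc_tail maxxx.
have disj t : ~ range (arc_head g) (z t) \/ ~ range (arc_tail g) (z t).
  apply: contrapT => /not_orP[/contrapT hh /contrapT ht].
  move: hh ht; rewrite range_arc_head range_arc_tail => -[s /= s0 es] [u /= u0 eu].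
  have su : s = u by apply: ig; rewrite es eu.
  have s00 : s = 0 by apply/le_anti; rewrite s0 su u0.
  have := edist2_circ (g 0) t (ltW rho0); rewrite -/(z t) -es s00 edist2xx => e.
  by move: rho0; rewrite -e ltxx.
pose A t := half_lift (arc_head g) -oo lm (z t) t.
pose B t := half_lift (arc_tail g) +oo (lm + w * (2 * pi)) (z t) t.
(* Here the assumption that the winding is [w] at every nearby point off the arc comes in. *)
have AB t : ~ range (arc_head g) (z t) -> ~ range (arc_tail g) (z t) -> A t <-> B t.
  rewrite range_arc_head range_arc_tail => n1 n2.
  have nz : ~ range g (z t).
    move=> [s _ es]; have [s0|s0] := leP s 0; first by apply: n1; exists s.
    by apply: n2; exists s => //=; exact: ltW.
  by apply: half_lift_swap dg nz (H _ (zr t) nz).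
have nA t : A t -> ~ range (arc_head g) (z t) by case.
have nB t : B t -> ~ range (arc_tail g) (z t) by case.
(* Where only one half arc is missed, only its condition can hold and it is locally constant; where
   both are missed, the two conditions agree. Hence the disjunction never changes around the
   circle. *)
have loc t : exists2 d : R, 0 < d & forall u, `|u - t| < d -> (A t \/ B t <-> A u \/ B u).
  have [nh|nt] := disj t.
  - rewrite /z -g0h in nh.
    have [d d0 hd] := half_lift_circ lm _ cch rho0 Fh clh nh.
    exists d => // u /hd; rewrite g0h -/(z t) -/(z u) -/(A t) -/(A u) => -[nu AA].
    rewrite g0h -/(z t) in nh.
    have := AB t nh; have := AB u nu; have := nB t; have := nB u; clear -AA; tauto.
  - rewrite /z -g0t in nt.
    have [d d0 hd] := half_lift_circ (lm + w * (2 * pi)) _ cct rho0 Ft clt nt.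
    exists d => // u /hd; rewrite g0t -/(z t) -/(z u) -/(B t) -/(B u) => -[nu BB].
    rewrite g0t -/(z t) in nt.
    have ABt := fun x : ~ range (arc_head g) (z t) => AB t x nt.
    have ABu := fun x : ~ range (arc_head g) (z u) => AB u x nu.
    have := nA t; have := nA u; clear -ABt ABu BB; tauto.
have hA : A (th 0).
  rewrite /A ez1; split; first by rewrite range_arc_head => -[s _ es]; apply: z1n; exists s.
  exists (fun s => th (Num.min s 0)); split; last by rewrite minxx.
  - exact: lifts_comp cont_min0 hl.
  - exact: tail_min_lim.
(* One full turn leads back to the same point with an angle larger by [2 * pi], against the
   uniqueness of the lifted angle. *)
have ez2 : z (th 0 + 2 * pi) = z1.
  by rewrite -ez1 /z /circ mulr_natl cosD2pi sinD2pi.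
have n1 : ~ range (arc_head g) (z (th 0 + 2 * pi)).
  by rewrite ez2 range_arc_head => -[s _ es]; apply: z1n; exists s.
have n2 : ~ range (arc_tail g) (z (th 0 + 2 * pi)).
  by rewrite ez2 range_arc_tail => -[s _ es]; apply: z1n; exists s.
have hA' : A (th 0 + 2 * pi).
  have [//|] := locally_constant_line loc (th 0 + 2 * pi) (or_introl hA).
  by move/(AB _ n1 n2).
move: hA hA'; rewrite /A ez1 ez2 => a1 a2.
have e : th 0 = th 0 + 2 * pi by apply: half_lift_uniq _ a1 a2.
by have := pi_gt0 R; lra.
Qed.

(** * Periodicity, heights and the two sides of an arc *)

Lemma periodic_int (P : R) D (n : int) : periodic_set P D -> forall p, D (p + (n%:~R * P, 0)) <-> D p.
Proof.
move=> pD.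
have nat_case (m : nat) p : D (p + (m%:R * P, 0)) <-> D p.
  elim: m p => [|m IH] p; first by rewrite mul0r addr0.
  rewrite -natr1 mulrDl mul1r.
  have -> : p + (m%:R * P + P, 0) = (p + (m%:R * P, 0)) + (P, 0).
    by rewrite -addrA; congr (_ + _); congr pair; rewrite addr0.
  by rewrite pD.
case: n => m p; first exact: nat_case.
rewrite NegzE -(nat_case m.+1 (p + _)) -addrA.
have -> : ((- m.+1%:Z)%:~R * P, 0) + (m.+1%:R * P, 0) = 0 :> R * R.
  by congr pair => /=; rewrite ?addr0 // rmorphN /= mulNr addrC subrr.
by rewrite addr0.
Qed.

Lemma period_reduce (P x : R) : 0 < P -> exists n : int, 0 <= x + n%:~R * P <= P.
Proof.
move=> P0; exists (- Num.floor (x / P)).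
have /andP[h1 h2] := floor_itv (x / P).
rewrite rmorphN /= mulNr; apply/andP; split.
  by rewrite subr_ge0 -ler_pdivlMr.
have := h2; rewrite intrD mulr1z ltr_pdivrMr // mulrDl mul1r => h; lra.
Qed.

(** Translations by periods preserve heights and bring every point to an abscissa in [[0, P]], that
    is, to a compact range of parameters. *)
Lemma arc_bounded_height (P : R) G : 0 < P -> (exists2 g, directed_arc g & range g = G) ->
  periodic_set P G -> exists2 M : R, 0 < M & forall p, G p -> `|p.2| <= M.
Proof.
move=> P0 [g dg gG] pG; have cg : continuous g by case: dg.
have [N hN] := arc_bounded_params P dg.
have N0 : 0 <= `|N| by [].
have cn : continuous (fun s => `|(g s).2|).
  by move=> s; apply: (@cvg_norm _ _ _ (nbhs s)); apply: cont_snd.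
have NN : - `|N| <= `|N| by lra.
have [b _ hb] := EVT_max NN (continuous_subspaceT cn).
exists (`|(g b).2| + 1); first by rewrite ltr_wpDl.
move=> p Gp; have [n /andP[n0 n1]] := period_reduce p.1 P0.
have : G (p + (n%:~R * P, 0)) by apply/(periodic_int n pG).
rewrite -gG => -[s _ es].
have sb : s \in `[- `|N|, `|N|]%R.
  rewrite in_itv /= -ler_norml; apply: le_trans (ler_norm N); apply: hN.
  by rewrite es ger0_norm.
have := hb s sb; rewrite es /= addr0; lra.
Qed.

Lemma cvgy_atan_comp (F : set_system R) (u : R -> R) : Filter F -> u @ F --> +oo ->
  atan (u s) @[s --> F] --> pi / 2.
Proof. by move=> FF uF; apply: (cvg_comp _ _ uF); exact: cvgy_atan. Qed.

Lemma cvgNy_atan_comp (F : set_system R) (u : R -> R) : Filter F -> u @ F --> -oo ->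
  atan (u s) @[s --> F] --> - (pi / 2).
Proof.
move=> FF uF.
have -> : (fun s => atan (u s)) = (fun s => - atan ((- u) s)) by apply/funext => s; rewrite /= atanN opprK.
by apply: cvgN; apply: cvgy_atan_comp; apply/cvgNry.
Qed.

Lemma cvg_ratio_pinfty (F : set_system R) (u v : R -> R) (C : R) : Filter F -> u @ F --> +oo ->
  (forall s, 0 < v s <= C) -> (u s / v s) @[s --> F] --> +oo.
Proof.
move=> FF uF hv; apply/cvgryPgt => A.
have /cvgryPgt/(_ (`|A| * C)) := uF; apply: filterS => s hs.
have /andP[v0 vC] := hv s; rewrite ltr_pdivlMr //.
apply: le_lt_trans hs; apply: (@le_trans _ _ (`|A| * v s)).
  by rewrite ler_wpM2r ?ler_norm // ltW.
by rewrite ler_wpM2l.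
Qed.

Lemma cvg_ratio_ninfty (F : set_system R) (u v : R -> R) (C : R) : Filter F -> u @ F --> -oo ->
  (forall s, 0 < v s <= C) -> (u s / v s) @[s --> F] --> -oo.
Proof.
move=> FF uF hv; apply/cvgNry.
have -> : - (fun s => u s / v s) = fun s => (- u) s / v s by apply/funext => s; rewrite /= fctE mulNr.
by apply: cvg_ratio_pinfty hv; apply/cvgNry.
Qed.

Lemma cvg_subr_pinfty (F : set_system R) (u : R -> R) (k : R) : Filter F -> u @ F --> +oo ->
  (u s - k) @[s --> F] --> +oo.
Proof.
move=> FF uF; apply/cvgryPgt => A; have /cvgryPgt/(_ (A + k)) := uF.
by apply: filterS => s hs; rewrite ltrBrDr.
Qed.

Lemma cvg_subr_ninfty (F : set_system R) (u : R -> R) (k : R) : Filter F -> u @ F --> -oo ->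
  (u s - k) @[s --> F] --> -oo.
Proof.
move=> FF uF; apply/cvgrNyPlt => A; have /cvgrNyPlt/(_ (A + k)) := uF.
by apply: filterS => s hs; rewrite ltrBlDr.
Qed.

(** Seen from below, all directions point upwards, and the argument is [pi / 2] minus an arctangent.
    Since heights are bounded and abscissas are not, it falls from [pi] to 0. *)
Lemma winding_below g p (M : R) : directed_arc g -> (forall s, `|(g s).2| <= M) -> p.2 < - M ->
  has_winding (range g) p (- 2^-1).
Proof.
move=> dg hM pM; have cg : continuous g by case: dg.
pose h s := g s - p.
have hv s : 0 < (h s).2 <= M - p.2.
  have := hM s; rewrite ler_norml => /andP[h1 h2] /=; apply/andP; split; rewrite /h /=; lra.
have d0 s : 0 < dotp ((0, 1) : R * R) (h s).
  by rewrite /dotp /= mul0r mul1r add0r; case/andP: (hv s).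
have th0 : polar ((0, 1) : R * R) (pi / 2).
  by rewrite /polar cos_pihalf sin_pihalf /enorm /= [0 ^+ 2]expr0n /= add0r expr1n sqrtr1 mulr0 mulr1.
have e s : turn ((0, 1) : R * R) (h s) = - atan ((h s).1 / (h s).2).
  by rewrite /turn /crsp /dotp /= !mul0r !mul1r sub0r add0r mulNr atanN.
have -> : - 2^-1 = ((0 : R) - pi) / (2 * pi).
  by rewrite sub0r mulNr invfM mulrCA divff ?mulr1 // gt_eqF // pi_gt0.
apply: (@lifts_has_winding g p (fun s => pi / 2 + turn ((0, 1) : R * R) (h s))) => //.
- split; last by move=> s; exact: (polar_turn (d0 s) th0).
  move=> s; apply: (@cvgD _ _ _ (nbhs s)); first exact: cvg_cst.
  by apply: (cont_turn (h := fun=> (0, 1))) => //; [move=> ?; exact: cvg_cst|exact: cont_subc].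
- rewrite [X in _ --> X](_ : pi = pi / 2 - - (pi / 2)); last by rewrite opprK -splitr.
  apply: cvgD; first exact: cvg_cst.
  under eq_fun do rewrite e.
  apply: cvgN; apply: cvgNy_atan_comp; apply: (@cvg_ratio_ninfty _ (fun s => (h s).1) (fun s => (h s).2) _ _ _ hv).
  by rewrite /h /=; apply: cvg_subr_ninfty; case: dg.
- rewrite [X in _ --> X](_ : 0 = pi / 2 - pi / 2); last by rewrite subrr.
  apply: cvgD; first exact: cvg_cst.
  under eq_fun do rewrite e.
  apply: cvgN; apply: cvgy_atan_comp; apply: (@cvg_ratio_pinfty _ (fun s => (h s).1) (fun s => (h s).2) _ _ _ hv).
  by rewrite /h /=; apply: cvg_subr_pinfty; case: dg.
Qed.

Lemma winding_above g p (M : R) : directed_arc g -> (forall s, `|(g s).2| <= M) -> M < p.2 ->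
  has_winding (range g) p (2^-1).
Proof.
move=> dg hM pM; have cg : continuous g by case: dg.
pose h s := g s - p.
have hv s : 0 < - (h s).2 <= p.2 + M.
  have := hM s; rewrite ler_norml => /andP[h1 h2] /=; apply/andP; split; rewrite /h /=; lra.
have d0 s : 0 < dotp ((0, -1) : R * R) (h s).
  by rewrite /dotp /= mul0r mulN1r add0r; case/andP: (hv s).
have th0 : polar ((0, -1) : R * R) (- (pi / 2)).
  by rewrite /polar cosN sinN cos_pihalf sin_pihalf /enorm /= [0 ^+ 2]expr0n /= add0r sqrrN expr1n sqrtr1 mulr0 mul1r.
have e s : turn ((0, -1) : R * R) (h s) = atan ((h s).1 / - (h s).2).
  by rewrite /turn /crsp /dotp /= !mul0r !mulN1r sub0r opprK add0r.
have -> : 2^-1 = ((0 : R) - - pi) / (2 * pi).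
  by rewrite sub0r opprK invfM mulrCA divff ?mulr1 // gt_eqF // pi_gt0.
apply: (@lifts_has_winding g p (fun s => - (pi / 2) + turn ((0, -1) : R * R) (h s))) => //.
- split; last by move=> s; exact: (polar_turn (d0 s) th0).
  move=> s; apply: (@cvgD _ _ _ (nbhs s)); first exact: cvg_cst.
  by apply: (cont_turn (h := fun=> (0, -1))) => //; [move=> ?; exact: cvg_cst|exact: cont_subc].
- rewrite [X in _ --> X](_ : - pi = - (pi / 2) + - (pi / 2)); last by rewrite -opprD -splitr.
  apply: cvgD; first exact: cvg_cst.
  under eq_fun do rewrite e.
  apply: cvgNy_atan_comp; apply: (@cvg_ratio_ninfty _ (fun s => (h s).1) (fun s => - (h s).2) _ _ _ hv).
  by rewrite /h /=; apply: cvg_subr_ninfty; case: dg.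
- rewrite [X in _ --> X](_ : 0 = - (pi / 2) + pi / 2); last by rewrite addNr.
  apply: cvgD; first exact: cvg_cst.
  under eq_fun do rewrite e.
  apply: cvgy_atan_comp; apply: (@cvg_ratio_pinfty _ (fun s => (h s).1) (fun s => - (h s).2) _ _ _ hv).
  by rewrite /h /=; apply: cvg_subr_pinfty; case: dg.
Qed.

(** If no winding number existed, [winding] would take the default value 0 of [xget], which differs
    from both admissible values. *)
Lemma arcX_has_winding (P : R) G p : arcX P G -> ~ G p -> has_winding G p (winding G p).
Proof.
move=> [_ _ hw] Gp; have := hw p Gp; rewrite /winding.
case: xgetP => [w -> //|_ [] /eqP]; first by rewrite eq_sym invr_eq0 pnatr_eq0.
by rewrite eq_sym oppr_eq0 invr_eq0 pnatr_eq0.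
Qed.

Lemma winding_eq (P : R) G p w : arcX P G -> ~ G p -> has_winding G p w -> winding G p = w.
Proof. by move=> GX Gp hw; apply: has_winding_uniq Gp (arcX_has_winding GX Gp) hw. Qed.

Lemma winding_open (P : R) G p : arcX P G -> ~ G p ->
  exists2 d : R, 0 < d & forall q, edist2 p q < d -> ~ G q /\ winding G q = winding G p.
Proof.
move=> GX Gp; have [d d0 hd] := has_winding_open Gp (arcX_has_winding GX Gp).
by exists d => // q /hd[Gq hq]; split => //; apply: (winding_eq GX).
Qed.

Lemma arcX_jump (P : R) G p r w : arcX P G -> G p -> 0 < r ->
  exists q, [/\ edist2 p q < r, ~ G q & winding G q <> w].
Proof.
move=> GX Gp r0; case: (GX) => -[g [dg gG]] _ _.
have : range g p by rewrite gG.
move=> [s0 _ gs0].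
have [q [h1 h2 h3]] := arc_winding_jump w (arc_shift s0 dg) r0.
have rg : range (fun s => g (s + s0)) = G.
  rewrite -gG; apply/seteqP; split => z [s _ <-]; first by exists (s + s0).
  by exists (s - s0) => //; rewrite subrK.
rewrite add0r gs0 rg in h1 h2 h3.
exists q; split => // e; apply: h3; rewrite -e; exact: arcX_has_winding GX h2.
Qed.

Lemma winding_periodic (P : R) G p : arcX P G -> ~ G p -> winding G (p + (P, 0)) = winding G p.
Proof.
move=> GX Gp; case: (GX) => _ pG _.
have Gp' : ~ G (p + (P, 0)) by rewrite pG.
apply: (winding_eq GX) => //.
have [g [th [lm [lp [[[cg ig gm gp] gG] cth hth [h1 h2] e]]]]] := arcX_has_winding GX Gp.
exists (fun s => g s + (P, 0)), th, lm, lp; split => //.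
- split; first split.
  + apply/cont_curve => s e' e0; have /cont_curve/(_ s e' e0)[d d0 hd] := cg.
    by exists d => // t /hd; rewrite /edist2 opprD addrACA subrr addr0.
  + by move=> s t /addIr /ig.
  + rewrite (_ : (fun s => (g s + (P, 0)).1) = fun s => (g s).1 - - P); last by apply/funext => s; rewrite opprK.
    by apply: (@cvg_subr_ninfty _ (fun s => (g s).1)).
  + rewrite (_ : (fun s => (g s + (P, 0)).1) = fun s => (g s).1 - - P); last by apply/funext => s; rewrite opprK.
    by apply: (@cvg_subr_pinfty _ (fun s => (g s).1)).
  + rewrite -gG in pG *; apply/seteqP; split => z; first by move=> [s _ <-]; apply/pG; exists s.
    by rewrite -(subrK (P, 0) z) => /pG[s _ es]; exists s => //; rewrite es.
- move=> s; have -> : g s + (P, 0) - (p + (P, 0)) = g s - p by rewrite opprD addrACA subrr addr0.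
  by have -> : edist2 (g s + (P, 0)) (p + (P, 0)) = edist2 (g s) p by rewrite /edist2 opprD addrACA subrr addr0.
Qed.

(* What the rest of the argument uses of an arc [G] with lower side [A] and upper side
   [B].  The orientation [sg] is 1 or -1, so that exchanging [A] and [B] gives an
   instance again and every statement can be used upside down. *)
Record separates (P sg : R) (G A B : set (R * R)) : Prop := Separates {
  sep_sg : `|sg| = 1;
  sep_openA : open A;
  sep_openB : open B;
  sep_cover : forall p, [\/ G p, A p | B p];
  sep_GA : forall p, G p -> ~ A p;
  sep_GB : forall p, G p -> ~ B p;
  sep_AB : forall p, A p -> ~ B p;
  sep_clA : forall p, G p -> closure A p;
  sep_clB : forall p, G p -> closure B p;
  sep_conn : forall Q : set (R * R),
    (forall p, G p -> exists2 d : R, 0 < d & forall q, G q -> edist2 p q < d -> (Q p <-> Q q)) ->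
    forall p q, G p -> G q -> Q p -> Q q;
  sep_perG : periodic_set P G;
  sep_perA : periodic_set P A;
  sep_perB : periodic_set P B;
  sep_ne : exists p, G p;
  sep_far : exists2 M : R, 0 < M & forall p, (M < - (sg * p.2) -> A p) /\ (M < sg * p.2 -> B p)
}.

Lemma arcX_separates (P : R) G : 0 < P -> arcX P G -> separates P 1 G (D1 G) (D2 G).
Proof.
move=> P0 GX; case: (GX) => -[g [dg gG]] pG hw.
have i2 : (0 : R) < 2^-1 by rewrite invr_gt0.
have side_open w : open [set p | ~ G p /\ winding G p = w].
  apply/open_edist => p [Gp ew]; have [d d0 hd] := winding_open GX Gp.
  by exists d => // q /hd[Gq]; rewrite ew.
have side_per w : periodic_set P [set p | ~ G p /\ winding G p = w].
  move=> p /=; rewrite pG; split => -[Gp ew]; split => //; rewrite -ew; last exact: winding_periodic.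
  by rewrite winding_periodic.
have [M M0 hM] : exists2 M : R, 0 < M & forall p, G p -> `|p.2| <= M.
  by apply: (arc_bounded_height P0 _ pG); exists g.
have hg s : `|(g s).2| <= M by apply: hM; rewrite -gG; exists s.
split.
- by rewrite normr1.
- exact: side_open.
- exact: side_open.
- move=> p; have [Gp|Gp] := pselect (G p); first by apply: Or31.
  by have [h|h] := hw p Gp; [apply: Or33|apply: Or32]; split.
- by move=> p Gp [].
- by move=> p Gp [].
- by move=> p [_ e1] [_]; rewrite e1 => e; lra.
(* Only two values occur off the arc, so a nearby point that avoids [2^-1] is on the lower side; the
   next case avoids the other value. *)
- move=> p Gp; apply/closure_edist => r r0; have [q [h1 h2 h3]] := arcX_jump 2^-1 GX Gp r0.
  by exists q => //; split => //; have [|] := hw q h2.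
- move=> p Gp; apply/closure_edist => r r0; have [q [h1 h2 h3]] := arcX_jump (- 2^-1) GX Gp r0.
  by exists q => //; split => //; have [|] := hw q h2.
- move=> Q hQ p q; rewrite -gG => -[s _ <-] [t _ <-].
  apply: (locally_constant_line (Q := fun s => Q (g s))) => {}s.
  have [|d d0 hd] := hQ (g s); first by rewrite -gG; exists s.
  have /cont_curve/(_ s d d0)[e e0 he] : continuous g by case: dg.
  by exists e => // u /he; apply: hd; rewrite -gG; exists u.
- exact: pG.
- exact: side_per.
- exact: side_per.
- by exists (g 0); rewrite -gG; exists 0.
- exists M => // p; rewrite mul1r; split => pM.
  + have Gp : ~ G p by move=> /hM; rewrite ler_norml => /andP[]; lra.
    split => //; apply: (winding_eq GX) => //; rewrite -gG.
    by apply: (winding_below dg hg); lra.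
  + have Gp : ~ G p by move=> /hM; rewrite ler_norml => /andP[]; lra.
    split => //; apply: (winding_eq GX) => //; rewrite -gG.
    by apply: (winding_above dg hg); lra.
Qed.

Lemma separates_sym (P sg : R) G A B : separates P sg G A B -> separates P (- sg) G B A.
Proof.
case=> h1 h2 h3 h4 h5 h6 h7 h8 h9 h10 h11 h12 h13 h14 [M M0 h15]; split => //.
- by rewrite normrN.
- by move=> p; have [] := h4 p; [exact: Or31|exact: Or33|exact: Or32].
- by move=> p Bp Ap; apply: (h7 p Ap).
- by exists M => // p; have [a b] := h15 p; rewrite !mulNr !opprK; split.
Qed.

End Winding.

(** * Ordered arcs *)

Section Barriers.
Context {R : realType}.
Variables (P sg : R).
Hypothesis P0 : 0 < P.
Implicit Types (p q z : R * R) (r s t u : R).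

Record barrier := Barrier { bG : set (R * R); bA : set (R * R); bB : set (R * R) }.

Definition flip (W : barrier) := Barrier (bG W) (bB W) (bA W).

Definition sep (W : barrier) := separates P sg (bG W) (bA W) (bB W).

(** All four inclusions are kept so that transitivity and [flip] are immediate; [Lt_of_lower]
    recovers them from the first. *)
Definition Lt (W W' : barrier) : Prop :=
  [/\ bG W `<=` bA W', bA W `<=` bA W', bG W' `<=` bB W & bB W' `<=` bB W].

Definition Le (W W' : barrier) : Prop := bA W `<=` bA W' /\ bB W' `<=` bB W.

Implicit Types (W Y : barrier) (D : set (R * R)).

Definition locally_constant_on D (Q : set (R * R)) : Prop :=
  forall p, D p -> exists2 d : R, 0 < d & forall q, D q -> edist2 p q < d -> (Q p <-> Q q).

Definition lconnected D : Prop :=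
  forall Q, locally_constant_on D Q -> forall p q, D p -> D q -> Q p -> Q q.

Lemma seg_lconnected D p q : (forall t, 0 <= t <= 1 -> D (seg p q t)) ->
  forall Q, locally_constant_on D Q -> Q p -> Q q.
Proof.
move=> hD Q hQ Qp; pose cl t := Num.max 0 (Num.min t 1).
have clP t : 0 <= cl t <= 1 by rewrite /cl le_max lexx /= ge_max ler01 ge_min lexx orbT.
have cl_lip s t : `|cl s - cl t| <= `|s - t|.
  have n1 (x y : R) : x - y <= `|x - y| /\ y - x <= `|x - y|.
    by rewrite ler_norm distrC ler_norm.
  have h1 (x y : R) : `|Num.min x 1 - Num.min y 1| <= `|x - y|.
    have [a b] := n1 x y; rewrite ler_norml.
    by case: (leP x 1) => h1; case: (leP y 1) => h2; apply/andP; split; lra.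
  have h2 (x y : R) : `|Num.max 0 x - Num.max 0 y| <= `|x - y|.
    have [a b] := n1 x y; rewrite ler_norml.
    by case: (leP 0 x) => h2; case: (leP 0 y) => h3; apply/andP; split; lra.
  exact: le_trans (h2 _ _) (h1 _ _).
have := @locally_constant_line R (fun t => Q (seg p q (cl t))) _ 0 1.
have -> : cl 0 = 0 by rewrite /cl minEle ler01 maxxx.
have -> : cl 1 = 1 by rewrite /cl minxx (max_idPr ler01).
rewrite seg0 seg1; apply => // s; have [d d0 hd] := hQ _ (hD _ (clP s)).
exists (d / (edist2 p q + 1)); first by rewrite divr_gt0 // ltr_wpDl ?edist2_ge0.
move=> t; rewrite distrC ltr_pdivlMr ?ltr_wpDl ?edist2_ge0 // => ht.
apply: hd; first exact: hD; rewrite edist2_seg; apply: le_lt_trans ht.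
apply: ler_pM => //; first exact: edist2_ge0; last by rewrite lerDl.
Qed.

Lemma plane_lconnected : lconnected [set: R * R].
Proof. by move=> Q hQ p q _ _; apply: (seg_lconnected (D := setT)). Qed.

Lemma clopen_empty (V : set (R * R)) : open V -> open (~` V) -> (exists p, ~ V p) -> forall p, ~ V p.
Proof.
move=> /open_edist oV /open_edist oC [p0 n0] p Vp; apply: n0.
apply: (plane_lconnected _ (p := p)) => // z _.
have [Vz|nVz] := pselect (V z).
  by have [d d0 hd] := oV z Vz; exists d => // q _ /hd.
by have [d d0 hd] := oC z nVz; exists d => // q _ /hd /= nq; split.
Qed.

Lemma ball_seg p q r t : edist2 p q < r -> 0 <= t <= 1 -> edist2 p (seg p q t) < r.
Proof.
move=> pq /andP[t0 t1]; rewrite edist2_seg_l ger0_norm //.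
by apply: le_lt_trans pq; rewrite ler_piMl // edist2_ge0.
Qed.

Lemma sep_open_cover W p : sep W -> ~ bG W p -> bA W p \/ bB W p.
Proof. by move=> S n; case: (sep_cover S p); tauto. Qed.

Lemma side_locally_constant W D : sep W -> (forall p, D p -> ~ bG W p) ->
  locally_constant_on D (bA W) /\ locally_constant_on D (bB W).
Proof.
move=> S hD; have /open_edist oA := sep_openA S; have /open_edist oB := sep_openB S.
have AB := sep_AB S.
split=> p /hD /(sep_open_cover S)[Ap|Bp].
- by have [d d0 hd] := oA p Ap; exists d => // q _ /hd.
- by have [d d0 hd] := oB p Bp; exists d => // q _ /hd Bq; split=> h; [case: (AB _ h)|case: (AB _ h)].
- by have [d d0 hd] := oA p Ap; exists d => // q _ /hd Aq; split=> h; [case: (AB _ Ap)|case: (AB _ Aq)].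
- by have [d d0 hd] := oB p Bp; exists d => // q _ /hd.
Qed.

Lemma ball_same_side W p r : sep W -> (forall q, edist2 p q < r -> ~ bG W q) ->
  forall q, edist2 p q < r -> (bA W p <-> bA W q).
Proof.
move=> S hr q pq; have [lA _] := side_locally_constant S hr.
split.
- by apply: (seg_lconnected _ lA) => t t01; exact: ball_seg.
- apply: (seg_lconnected _ lA) => t /andP[t0 t1].
  have -> : seg q p t = seg p q (1 - t).
    by rewrite /seg; case: (p) (q) => [? ?] [? ?]; congr pair => /=; ring.
  by apply: ball_seg => //; apply/andP; split; lra.
Qed.

Lemma one_side W Y : sep W -> sep Y -> (forall p, bG W p -> ~ bG Y p) ->
  (bG Y `<=` bA W) \/ (bG Y `<=` bB W).
Proof.
move=> S T dis.
have [lA lB] := @side_locally_constant W (bG Y) S (fun p Yp Wp => dis p Wp Yp).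
have [p0 Yp0] := sep_ne T.
have [h|h] := sep_open_cover S (fun Wp => dis p0 Wp Yp0).
- by left=> q Yq; exact: (sep_conn T lA Yp0 Yq h).
- by right=> q Yq; exact: (sep_conn T lB Yp0 Yq h).
Qed.

(** The hypotheses make [bB W] and [bA Y] cover the complement of [bA W] and [bB Y] in common. This
    intersection is thus clopen, and it is empty since it misses [bG W]. *)
Lemma Lt_intro W Y : sep W -> sep Y -> bG Y `<=` bB W -> bG W `<=` bA Y -> Lt W Y.
Proof.
move=> S T hY hW.
have E p : ~ (bA W `&` bB Y) p.
  apply: clopen_empty.
  - by apply: openI; [exact: sep_openA S|exact: sep_openB T].
  - have -> : ~` (bA W `&` bB Y) = bB W `|` bA Y.
      apply/seteqP; split => z /=.
        move=> n; have [/hW|Az|Bz] := sep_cover S z; [by right| |by left].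
        by have [/hY|Az'|Bz] := sep_cover T z; [left|right|case: n].
      by case=> [Bz|Az] [Az' Bz']; [exact: (sep_AB S Az')|exact: (sep_AB T Az)].
    by apply: openU; [exact: sep_openB S|exact: sep_openA T].
  - by have [z Wz] := sep_ne S; exists z => -[/(sep_GA S Wz)].
split => // p.
- move=> Ap; have [/hY Bp|//|Bp] := sep_cover T p; first by case: (sep_AB S Ap).
  by case: (E p).
- move=> Bp; have [/hW Ap|Ap|//] := sep_cover S p; first by case: (sep_AB T Ap).
  by case: (E p).
Qed.

Lemma height_point (M : R) : `|sg| = 1 -> exists p, M < sg * p.2.
Proof.
move=> s1; exists (0, (M + 1) * sg) => /=.
by rewrite mulrCA -expr2 -real_normK ?num_real // s1 expr1n mulr1 ltrDl.
Qed.

Lemma depth_point (M : R) : `|sg| = 1 -> exists p, M < - (sg * p.2).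
Proof.
move=> s1; exists (0, - ((M + 1) * sg)) => /=.
by rewrite mulrN opprK mulrCA -expr2 -real_normK ?num_real // s1 expr1n mulr1 ltrDl.
Qed.

Lemma high_point W Y : sep W -> sep Y -> exists p, bB W p /\ bB Y p.
Proof.
move=> S T; have [M1 _ h1] := sep_far S; have [M2 _ h2] := sep_far T.
have [p hp] := height_point (Num.max M1 M2) (sep_sg S); rewrite gt_max in hp.
case/andP: hp => a b; exists p; split; [exact: (h1 p).2|exact: (h2 p).2].
Qed.

Lemma low_point W Y : sep W -> sep Y -> exists p, bA W p /\ bA Y p.
Proof.
move=> S T; have [M1 _ h1] := sep_far S; have [M2 _ h2] := sep_far T.
have [p hp] := depth_point (Num.max M1 M2) (sep_sg S); rewrite gt_max in hp.
case/andP: hp => a b; exists p; split; [exact: (h1 p).1|exact: (h2 p).1].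
Qed.

(* Otherwise the intersection of the two upper sides would be clopen. *)
Lemma not_both_sides W Y : sep W -> sep Y -> bG Y `<=` bA W -> bG W `<=` bA Y -> False.
Proof.
move=> S T hY hW; have [z [z1 z2]] := high_point S T.
apply: (@clopen_empty (bB W `&` bB Y) _ _ _ z) => //.
- by apply: openI; [exact: sep_openB S|exact: sep_openB T].
- have -> : ~` (bB W `&` bB Y) = bA W `|` bA Y.
    apply/seteqP; split => p /=.
      move=> n; have [/hW|Az|Bz] := sep_cover S p; [by right|by left|].
      by have [/hY|Az'|Bz'] := sep_cover T p; [left|right|case: n].
    by case=> [Az|Az] [Bz Bz']; [exact: (sep_AB S Az)|exact: (sep_AB T Az)].
  by apply: openU; [exact: sep_openA S|exact: sep_openA T].
- by have [p Wp] := sep_ne S; exists p => -[/(sep_GB S Wp)].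
Qed.

(** The curve of [Y] is connected and disjoint from that of [W], so it lies on one side; each curve
    below the other is impossible. *)
Lemma Lt_of_lower W Y : sep W -> sep Y -> bG W `<=` bA Y -> Lt W Y.
Proof.
move=> S T hW; have dis p : bG W p -> ~ bG Y p by move=> /hW Ap Yp; exact: (sep_GA T Yp).
have [h|h] := one_side S T dis; last exact: Lt_intro.
by case: (not_both_sides S T h hW).
Qed.

(** A point of [bG W] above [Y] would be above [W] as well, so short of a contact it is below
    [Y]. *)
Lemma Le_disjoint_Lt W Y : sep W -> sep Y -> Le W Y -> (forall p, bG W p -> ~ bG Y p) -> Lt W Y.
Proof.
move=> S T [h1 h2] dis; apply: Lt_of_lower => // p Wp.
have [/(dis p Wp)//|//|Bp] := sep_cover T p.
by case: (sep_GB S Wp); apply: h2.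
Qed.

Lemma Lt_trans W Y Z : Lt W Y -> Lt Y Z -> Lt W Z.
Proof.
move=> [a1 a2 a3 a4] [b1 b2 b3 b4]; split=> p.
- by move=> /a1 /b2.
- by move=> /a2 /b2.
- by move=> /b3 /a4.
- by move=> /b4 /a4.
Qed.

Lemma Le_antisym W Y : sep W -> sep Y -> Le W Y -> Le Y W -> bG W = bG Y.
Proof.
move=> S T [a b] [c d]; apply/seteqP; split => p Wp.
- have [//|/c/(sep_GA S Wp)//|/b/(sep_GB S Wp)//] := sep_cover T p.
- have [//|/a/(sep_GA T Wp)//|/d/(sep_GB T Wp)//] := sep_cover S p.
Qed.

(* Near [p] the set [D] meets only one of its components. *)
Definition collared D p : Prop :=
  exists2 d : R, 0 < d & forall Q, locally_constant_on D Q ->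
    forall q q', D q -> D q' -> edist2 p q < d -> edist2 p q' < d -> Q q -> Q q'.

Lemma locally_constant_onC D Q : locally_constant_on D Q -> locally_constant_on D (~` Q).
Proof.
move=> hQ p /hQ[d d0 hd]; exists d => // q Dq pq; have := hd q Dq pq.
by rewrite /setC /=; tauto.
Qed.

(* All of the curve is adherent to the same component of [bA W], and a component whose
   boundary misses the curve would be clopen. *)
Lemma collared_lconnected W : sep W -> (forall p, bG W p -> collared (bA W) p) -> lconnected (bA W).
Proof.
move=> S hc.
have near_curve Q : locally_constant_on (bA W) Q ->
    (exists2 p, bG W p & exists2 d : R, 0 < d & forall q, bA W q -> edist2 p q < d -> Q q) ->
    forall q, bA W q -> Q q.
  move=> hQ [p0 Wp0 hp0].
  have E : forall p, bG W p -> exists2 d : R, 0 < d & forall q, bA W q -> edist2 p q < d -> Q q.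
    move=> p Wp.
    apply: (sep_conn S (Q := fun p => exists2 d : R, 0 < d & forall q, bA W q -> edist2 p q < d -> Q q) _ Wp0 Wp hp0).
    move=> {Wp}p Wp; have [d d0 hd] := hc p Wp.
    have d2 : 0 < d / 2 by rewrite divr_gt0.
    exists (d / 2) => // p' Wp' pp'; split.
    - move=> [e e0 he]; have m0 : 0 < Num.min d e by rewrite lt_min d0 e0.
      have /closure_edist/(_ _ m0)[q Aq] := sep_clA S Wp.
      rewrite lt_min => /andP[qd qe]; exists (d / 2) => // z Az pz.
      apply: (hd Q hQ q z) => //; last exact: he.
      by have := edist2_tri p p' z; lra.
    - move=> [e e0 he]; have m0 : 0 < Num.min (d / 2) e by rewrite lt_min d2 e0.
      have /closure_edist/(_ _ m0)[q Aq] := sep_clA S Wp'.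
      rewrite lt_min => /andP[qd qe]; exists d => // z Az pz.
      apply: (hd Q hQ q z) => //; last exact: he.
      by have := edist2_tri p p' q; lra.
  move=> q Aq; apply: contrapT => nQ.
  have /open_edist oA := sep_openA S; have /open_edist oB := sep_openB S.
  apply: (@clopen_empty (bA W `&` ~` Q) _ _ _ q) => //.
  - apply/open_edist => z [Az nz]; have [d d0 hd] := oA z Az; have [e e0 he] := hQ z Az.
    exists (Num.min d e); first by rewrite lt_min d0 e0.
    move=> y; rewrite lt_min => /andP[/hd Ay zy]; split => // Qy; apply: nz.
    by apply/(he y Ay zy).
  - apply/open_edist => z nz; have [Wz|Az|Bz] := sep_cover S z.
    + by have [d d0 hd] := E z Wz; exists d => // y zy [Ay]; apply; apply: hd.
    + have Qz : Q z by apply: contrapT => nQz; apply: nz.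
      by have [e e0 he] := hQ z Az; exists e => // y zy [Ay]; apply; apply/(he y Ay zy).
    + by have [d d0 hd] := oB z Bz; exists d => // y /hd By [Ay _]; exact: (sep_AB S Ay By).
  - by exists p0 => -[/(sep_GA S Wp0)].
move=> Q hQ p q Ap Aq Qp; apply: contrapT => nQq.
have [z Wz] := sep_ne S; have [d d0 hd] := hc z Wz.
have /closure_edist/(_ _ d0)[y Ay zy] := sep_clA S Wz.
have [Qy|nQy] := pselect (Q y).
- apply: nQq; apply: near_curve Aq => //; exists z => //; exists d => // x Ax zx.
  exact: (hd Q hQ y x).
- have := near_curve (~` Q) (locally_constant_onC hQ) _ p Ap; apply => //.
  exists z => //; exists d => // x Ax zx.
  exact: (hd (~` Q) (locally_constant_onC hQ) y x).
Qed.

(** Every point of [bG W] is a limit of points below [Y], so the upper side of [Y] misses [bG W].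
    Being connected, it lies on one side of [W], and a point high above both curves tells which. *)
Lemma Le_limit_upper (W Y : barrier) (F : barrier -> Prop) : sep W -> sep Y ->
  lconnected (bB Y) -> (forall V, F V -> Lt V Y) ->
  (forall p r, bG W p -> 0 < r -> exists V q, [/\ F V, bG V q & edist2 p q < r]) -> Le W Y.
Proof.
move=> S T cB FY app.
have dis p : bB Y p -> ~ bG W p.
  move=> Bp Wp; have /open_edist/(_ p Bp)[r r0 hr] := sep_openB T.
  have [V [q [FV Vq /hr Bq]]] := app p r Wp r0.
  by have [h _ _ _] := FY V FV; exact: (sep_AB T (h q Vq) Bq).
have [_ lB] := side_locally_constant S dis.
have [z [Bz Bz']] := high_point S T.
have h : bB Y `<=` bB W by move=> p Bp; exact: (cB _ lB z p).
split => // p Ap; have [Yp|//|/h Bp] := sep_cover T p; last by case: (sep_AB S Ap).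
(* A point of [bG Y] is adherent to [bB Y], hence to [bB W], and cannot be in the open set
   [bA W]. *)
have /open_edist/(_ p Ap)[r r0 hr] := sep_openA S.
have /closure_edist/(_ r r0)[q /h Bq /hr Aq] := sep_clB T Yp.
by case: (sep_AB S Aq).
Qed.

(* The union of the lower sides of the approximating barriers is open and closed in
   [bA W]. *)
Lemma Le_limit_lower (W Y : barrier) (F : barrier -> Prop) : sep W -> sep Y ->
  lconnected (bA W) -> (forall V, F V -> [/\ sep V, Lt V Y & bA V `<=` bA W]) -> (exists V, F V) ->
  (forall V r, F V -> 0 < r -> exists V', [/\ F V', bA V `<=` bA V' &
     forall p, bG V' p -> exists2 q, bG W q & edist2 p q < r]) -> Le W Y.
Proof.
move=> S T cA FY [V0 FV0] app.
pose Q p := exists2 V, F V & bA V p.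
have lQ : locally_constant_on (bA W) Q.
  move=> p Ap; have /open_edist/(_ p Ap)[d d0 hd] := sep_openA S.
  have d2 : 0 < d / 2 by rewrite divr_gt0.
  exists (d / 2) => // q Aq pq.
  (* The curve of [V'] comes within [d / 2] of [bG W], which stays [d] away from [p]; hence the ball
     of radius [d / 2] around [p] is on one side of [V']. *)
  have cl V x : F V -> edist2 p x < d / 2 -> bA V x ->
      exists V', [/\ F V', bA V' x & forall y, edist2 p y < d / 2 -> ~ bG V' y].
    move=> FV px Vx; have [V' [FV' sub hV']] := app V (d / 2) FV d2.
    exists V'; split => //; first exact: sub.
    move=> y py /hV'[z Wz yz]; apply: (sep_GA S Wz); apply: hd.
    by have := edist2_tri p y z; lra.
  split=> -[V FV Vx].
  - have [|V' [FV' A' n']] := cl V p FV _ Vx; first by rewrite edist2xx.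
    have [S' _ _] := FY V' FV'; exists V' => //.
    by apply/(ball_same_side S' n' pq).
  - have [//|V' [FV' A' n']] := cl V q FV _ Vx.
    have [S' _ _] := FY V' FV'; exists V' => //.
    by apply/(ball_same_side S' n' pq).
have [S0 _ _] := FY V0 FV0.
have [z [Az Az']] := low_point S S0.
have h : bA W `<=` bA Y.
  move=> p Ap; have [|V FV Vp] := cA Q lQ z p Az Ap; first by exists V0.
  by have [_ [_ h _ _] _] := FY V FV; exact: h.
split => // p Bp; have [Wp|/h Ap|//] := sep_cover S p; last by case: (sep_AB T Ap).
have /open_edist/(_ p Bp)[r r0 hr] := sep_openB T.
have /closure_edist/(_ r r0)[q /h Aq /hr Bq] := sep_clA S Wp.
by case: (sep_AB T Aq).
Qed.

Lemma strip_compact (a b M : R) : compact [set p : R * R | (a <= p.1 <= b) && (`|p.2| <= M)].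
Proof.
have -> : [set p : R * R | (a <= p.1 <= b) && (`|p.2| <= M)] = `[a, b] `*` `[- M, M].
  apply/seteqP; split => -[x y] /=; rewrite !in_itv /= -ler_norml.
    by move/andP.
  by move=> [-> ->].
by apply: compact_setX; exact: segment_compact.
Qed.

Lemma sep_bounded W : sep W -> exists2 M : R, 0 < M & forall p, bG W p -> `|p.2| <= M.
Proof.
move=> S; have [M M0 hM] := sep_far S; exists M => // p Wp.
have -> : `|p.2| = `|sg * p.2| by rewrite normrM (sep_sg S) mul1r.
rewrite ler_norml lerNl !leNgt; apply/andP; split; apply/negP => h.
- exact: (sep_GA S Wp ((hM p).1 h)).
- exact: (sep_GB S Wp ((hM p).2 h)).
Qed.

Lemma sep_closedG W : sep W -> closed (bG W).
Proof.
move=> S; have -> : bG W = ~` (bA W `|` bB W).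
  apply/seteqP; split => p /=; first by move=> Wp [/(sep_GA S Wp)|/(sep_GB S Wp)].
  by move=> n; have [//|h|h] := sep_cover S p; case: n; [left|right].
by rewrite closedC; apply: openU; [exact: sep_openA S|exact: sep_openB S].
Qed.

(** The curve is compact modulo the period, and [U] is invariant under it. *)
Lemma uniform_neighborhood W (U : set (R * R)) : sep W -> open U -> periodic_set P U -> bG W `<=` U ->
  exists2 e : R, 0 < e & forall p q, bG W p -> edist2 p q < e -> U q.
Proof.
move=> S /open_edist oU pU hU; have [M M0 hM] := sep_bounded S.
pose K := [set p : R * R | (0 <= p.1 <= P) && (`|p.2| <= M)] `&` bG W.
have cK : compact K by apply: compact_closedI; [exact: strip_compact|exact: sep_closedG].
have nc : near_covering K by apply/compact_near_coveringP.
have : \forall e \near (0 : R)^'+, K `<=` (fun p => forall q, edist2 p q < e -> U q).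
  apply: nc => p [_ Wp]; have [d d0 hd] := oU p (hU p Wp).
  have d2 : 0 < d / 2 by rewrite divr_gt0.
  exists ([set q | edist2 p q < d / 2], [set e | e < d / 2]); first split.
  - by apply/nbhs_edist; exists (d / 2).
  - exact: nbhs_right_lt.
  - move=> [x e] /= [px ed] q xq; apply: hd.
    by have := edist2_tri p x q; lra.
move=> near_e; near (0 : R)^'+ => e.
exists e; first by near: e; exact: nbhs_right_gt.
move=> p q Wp pq; have [n nP] := period_reduce p.1 P0.
apply/(periodic_int n pU).
have /(_ e) h : forall e, (K `<=` (fun p => forall q, edist2 p q < e -> U q)) ->
    U (q + (n%:~R * P, 0)) \/ e <= edist2 p q.
  move=> e' he; have [|e'pq] := ltP (edist2 p q) e'; last by right.
  move=> pq'; left; apply: (he (p + (n%:~R * P, 0))).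
    split; last by apply/(periodic_int n (sep_perG S)).
    by rewrite /= nP addr0 hM.
  by rewrite /edist2 opprD addrACA subrr addr0.
have [||] := h; [by near: e| by []|by rewrite leNgt pq].
Unshelve. all: by end_near.
Qed.

Definition close_to (e : R) (W V : barrier) : Prop :=
  (forall p, bG W p -> exists2 q, bG V q & edist2 p q < e) /\
  (forall p, bG V p -> exists2 q, bG W q & edist2 p q < e).

Lemma Lt_open W Y : sep W -> sep Y -> Lt W Y -> exists2 e : R, 0 < e &
  forall V, sep V -> close_to e V W -> Lt V Y.
Proof.
move=> S T [h _ _ _]; have [e e0 he] := uniform_neighborhood S (sep_openA T) (sep_perA T) h.
exists e => // V SV [c _]; apply: Lt_of_lower => // p /c[q Wq pq].
by apply: he Wq _; rewrite edist2C.
Qed.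

(** The strict order passes to earlier times by monotonicity, to limits by excluding contacts, and a
    little further by [Lt_open]. Contacts are excluded only before [b], where the order is therefore
    weak. *)
Lemma monotone_family_stays_below (a b : R) (F : R -> barrier * barrier) (Y : barrier * barrier) :
  a < b ->
  (forall t, a <= t <= b -> sep (F t).1 /\ sep (F t).2) -> sep Y.1 /\ sep Y.2 ->
  (forall s t, a <= s -> s < t -> t <= b -> Lt (F s).1 (F t).1 /\ Lt (F s).2 (F t).2) ->
  (forall t e, a <= t <= b -> 0 < e -> exists2 d : R, 0 < d & forall s, a <= s <= b -> `|s - t| < d ->
     close_to e (F s).1 (F t).1 /\ close_to e (F s).2 (F t).2) ->
  lconnected (bB Y.1) -> (forall t, a <= t <= b -> lconnected (bA (F t).2)) ->
  (forall t, a <= t < b -> Le (F t).1 Y.1 -> Le (F t).2 Y.2 ->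
     (forall p, bG (F t).1 p -> ~ bG Y.1 p) /\ (forall p, bG (F t).2 p -> ~ bG Y.2 p)) ->
  Lt (F a).1 Y.1 /\ Lt (F a).2 Y.2 ->
  Le (F b).1 Y.1 /\ Le (F b).2 Y.2.
Proof.
move=> ab hS [hY1 hY2] mono close cY cF touch start.
pose L t := Lt (F t).1 Y.1 /\ Lt (F t).2 Y.2.
have limit t : a < t <= b -> (forall s, a <= s < t -> L s) -> Le (F t).1 Y.1 /\ Le (F t).2 Y.2.
  move=> /andP[at_ tb] hL; have tab : a <= t <= b by rewrite ltW.
  have [S1 S2] := hS t tab.
  (* Choosing [s] beyond a given [s0] makes the new lower side contain the earlier one, as
     [Le_limit_lower] demands. *)
  have approx e s0 : 0 < e -> a <= s0 < t -> exists s, [/\ a <= s < t, s0 <= s,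
      close_to e (F s).1 (F t).1 & close_to e (F s).2 (F t).2].
    move=> e0 /andP[as0 s0t]; have [d d0 hd] := close t e tab e0.
    pose s := Num.max s0 (t - d / 2).
    have st : s < t by rewrite gt_max s0t ltrBlDr ltrDl divr_gt0.
    have s0s : s0 <= s by rewrite le_max lexx.
    have ts : t - d / 2 <= s by rewrite le_max lexx orbT.
    have as_ := le_trans as0 s0s.
    have [||c1 c2] := hd s.
    - by rewrite as_ (le_trans (ltW st)).
    - by rewrite ltr0_norm ?subr_lt0 //; lra.
    - by exists s; rewrite as_ st.
  have aat : a <= a < t by rewrite lexx.
  split.
  - apply: (@Le_limit_upper _ _ (fun V => exists2 s, a <= s < t & V = (F s).1)) => //.
    + by move=> V [s /hL[h _] ->].
    + move=> p r Wp r0; have [s [s1 _ [_ /(_ p Wp)[q Vq pq]] _]] := approx r a r0 aat.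
      by exists (F s).1, q; split => //; exists s.
  - apply: (@Le_limit_lower _ _ (fun V => exists2 s, a <= s < t & V = (F s).2)) => //.
    + exact: cF.
    + move=> V [s sat ->]; have /andP[as_ st] := sat.
      have [|_ S] := hS s; first by rewrite as_ (le_trans (ltW st)).
      have [_ h] := hL s sat; have [_ [_ m _ _]] := mono s t as_ st tb.
      by split.
    + by exists (F a).2, a.
    + move=> V r [s0 s0t ->] r0; have [s [s1 s0s _ [c _]]] := approx r s0 r0 s0t.
      exists (F s).2; split => //; first by exists s.
      have /andP[as0 _] := s0t; have /andP[_ st] := s1.
      move: s0s; rewrite le_eqVlt => /orP[/eqP->//|s0s].
      by have [_ [_ m _ _]] := mono s0 s as0 s0s (ltW (lt_le_trans st tb)).
have down s t : a <= s -> s <= t -> t <= b -> L t -> L s.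
  move=> as_; rewrite le_eqVlt => /orP[/eqP->//|st] tb [l1 l2].
  by have [m1 m2] := mono s t as_ st tb; split; apply: Lt_trans l1 || apply: Lt_trans l2.
have strict t : a <= t < b -> (forall s, a <= s < t -> L s) -> L t.
  move=> /andP[at_ tb] hL; move: at_; rewrite le_eqVlt => /orP[/eqP<-//|at_].
  have [|l1 l2] := limit t _ hL; first by rewrite at_ ltW.
  have [|S1 S2] := hS t; first by rewrite !ltW.
  have [|d1 d2] := touch t _ l1 l2; first by rewrite ltW.
  by split; apply: Le_disjoint_Lt.
have all_ t : a <= t < b -> L t.
  move=> /andP[at_ tb]; apply: contrapT => nL.
  pose S := [set s | a <= s <= t /\ L s].
  have Sa : S a by split=> //; rewrite lexx.
  have Sub : ubound S t by move=> s [/andP[_ st] _].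
  have hs : has_sup S by split; [exists a|exists t].
  set c := sup S; have ac : a <= c by apply: ub_le_sup Sa; exists t.
  have ct : c <= t by apply: ge_sup; [exists a|].
  have cb := le_lt_trans ct tb.
  have below s : a <= s < c -> L s.
    move=> /andP[as_ sc]; have sc0 : 0 < c - s by rewrite subr_gt0.
    have [u [/andP[au ut] Lu] us] := sup_adherent sc0 hs.
    apply: down Lu => //; first by rewrite subKr in us; exact: ltW.
    by apply: le_trans ut _; exact: ltW.
  have Lc : L c by apply: strict => //; rewrite ac.
  have cab : a <= c <= b by rewrite ac ltW.
  have [S1 S2] := hS c cab; case: (Lc) => l1 l2.
  have [e1 e10 h1] := Lt_open S1 hY1 l1; have [e2 e20 h2] := Lt_open S2 hY2 l2.
  have e0 : 0 < Num.min e1 e2 by rewrite lt_min e10 e20.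
  have [d d0 hd] := close c _ cab e0.
  have weak e e' W V : e <= e' -> close_to e W V -> close_to e' W V.
    by move=> ee' [x y]; split=> p => [/x|/y][q Vq pq]; exists q => //; exact: lt_le_trans pq ee'.
  (* A time past the supremum [c], capped by [t]. As [L s] holds, [s <= c], so the cap is attained
     and [L t] follows. *)
  pose s := Num.min t (c + d / 2).
  have sc : c <= s by rewrite le_min ct lerDl ltW // divr_gt0.
  have st : s <= t by rewrite ge_min lexx.
  have sd : s <= c + d / 2 by rewrite ge_min lexx orbT.
  have sab : a <= s <= b by rewrite (le_trans ac sc) (le_trans st (ltW tb)).
  have Ls : L s.
    have [|c1 c2] := hd s sab; first by rewrite ger0_norm ?subr_ge0 //; lra.
    have [T1 T2] := hS s sab.
    split; [apply: h1 => //; apply: weak c1|apply: h2 => //; apply: weak c2].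
      by rewrite ge_min lexx.
    by rewrite ge_min lexx orbT.
  have sc' : s <= c.
    by apply: ub_le_sup; [exists t|split => //; case/andP: sab => -> _].
  have est : s = t by move: sc'; rewrite /s ge_min => /orP[tc|]; [apply: le_anti; rewrite st (le_trans tc sc)|lra].
  by apply: nL; rewrite -est.
by apply: limit => //; rewrite ab lexx.
Qed.

End Barriers.

(** * Derivatives and the maximum principle *)

Section Calculus.
Context {R : realType}.
Implicit Types (p q z v : R * R) (r s t u l : R).

(** Multiplying out the difference quotient removes the division and makes [h = 0] harmless. *)
Lemma is_deriveP (f : R -> R) (a l : R) : is_derive a (1 : R) f l <->
  forall e : R, 0 < e -> exists2 d : R, 0 < d & forall h : R, `|h| < d -> `|f (a + h) - f a - h * l| <= e * `|h|.
Proof.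
have eqn h : h != 0 -> `|l - h^-1 *: ((f \o shift a) (h *: 1) - f a)| * `|h| = `|f (a + h) - f a - h * l|.
  move=> h0; rewrite -normrM mulrBl distrC; congr `|_|.
  by rewrite /= /GRing.scale /= mulr1 mulrAC mulVf // mul1r (addrC a) (mulrC l).
have near_iff (Q : R -> Prop) : (\forall h \near (0 : R)^', Q h) <->
    exists2 d : R, 0 < d & forall h, `|h| < d -> h != 0 -> Q h.
  split.
    move=> /nbhs_ballP[d /= d0 hd]; exists d => // h hh h0; apply: hd => //.
    by rewrite /ball /= sub0r normrN.
  move=> [d d0 hd]; apply/nbhs_ballP; exists d => //= h; rewrite /ball /= sub0r normrN => h1 h2.
  by apply: hd.
split.
- move=> [cf df] e e0.
  have : h^-1 *: ((f \o shift a) (h *: 1) - f a) @[h --> 0^'] --> l by rewrite -df.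
  move=> /cvgrPdist_le/(_ e e0)/near_iff[d d0 hd]; exists d => // h hh.
  have [->|h0] := eqVneq h 0; first by rewrite addr0 subrr mul0r subrr normr0 mulr0.
  by rewrite -eqn // ler_wpM2r // hd.
- move=> H; have L : h^-1 *: ((f \o shift a) (h *: 1) - f a) @[h --> 0^'] --> l.
    apply/cvgrPdist_le => e e0; have [d d0 hd] := H e e0.
    apply/near_iff; exists d => // h hh h0.
    by rewrite -(@ler_pM2r _ `|h|) ?normr_gt0 // eqn // hd.
  by split; [apply/cvg_ex; exists l|apply: cvg_lim].
Qed.

Lemma is_derive_continuous (f : R -> R) (a l : R) : is_derive a (1 : R) f l -> {for a, continuous f}.
Proof. by case=> h _; apply: differentiable_continuous; apply/derivable1_diffP. Qed.

Lemma is_derive_affine (f : R -> R) (a b c l : R) : is_derive (a + b * c) (1 : R) f l ->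
  is_derive b (1 : R) (fun t : R => f (a + t * c)) (c * l).
Proof.
move=> H; rewrite mulrC; apply: (@is_derive1_comp _ f (fun t : R => a + t * c)) => //.
apply/is_deriveP => e e0; exists 1 => // h _.
have -> : a + (b + h) * c - (a + b * c) - h * c = 0 by ring.
by rewrite normr0 mulr_ge0 // ltW.
Qed.

(** If [l < 0], then [f'] is negative just after [a] in case [f' a <= 0], and positive just before
    [a] otherwise. By the mean value theorem either sign contradicts minimality, without first
    showing [f' a = 0]. *)
Lemma second_derivative_test (f f' : R -> R) (a l d : R) : 0 < d ->
  (forall x : R, `|x - a| < d -> is_derive x (1 : R) f (f' x)) -> is_derive a (1 : R) f' l ->
  (forall x : R, `|x - a| < d -> f a <= f x) -> 0 <= l.
Proof.
move=> d0 hf /is_deriveP hl hmin; rewrite leNgt; apply/negP => l0.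
have l2 : 0 < - l / 2 by rewrite divr_gt0 // oppr_gt0.
have [e e0 he] := hl _ l2.
pose h : R := Num.min e d / 2.
have m0 : 0 < Num.min e d by rewrite lt_min e0 d0.
have h0 : 0 < h by rewrite divr_gt0.
have hed : h < Num.min e d by rewrite /h; lra.
have he' : h < e by apply: lt_le_trans hed _; rewrite ge_min lexx.
have hd' : h < d by apply: lt_le_trans hed _; rewrite ge_min lexx orbT.
have cont (x y : R) : (forall z : R, x <= z <= y -> `|z - a| < d) -> {within `[x, y], continuous f}.
  move=> xy; apply: continuous_in_subspaceT => z; rewrite inE /= in_itv /= => zxy.
  exact: is_derive_continuous (hf z (xy z zxy)).
have [fa|fa] := leP (f' a) 0.
- have hh (x : R) : a <= x <= a + h -> `|x - a| < d by move=> ?; rewrite ltr_norml; lra.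
  have [||x] := @MVT R f f' a (a + h) _ _ (cont _ _ hh); first by rewrite ltrDl.
    by move=> c; rewrite in_itv /= => /andP[c1 c2]; apply: hf; apply: hh; rewrite !ltW.
  rewrite in_itv /= => /andP[x1 x2] E.
  have := hmin (a + h); rewrite addrAC subrr add0r gtr0_norm // => /(_ hd').
  rewrite -subr_ge0 E addrAC subrr add0r pmulr_lge0 // => f'x.
  have xa : 0 < x - a by rewrite subr_gt0.
  have xe : `|x - a| < e by rewrite gtr0_norm //; lra.
  have := he (x - a) xe; rewrite (gtr0_norm xa) (addrC a) subrK ler_norml => /andP[_].
  have : (x - a) * l < 0 by rewrite pmulr_rlt0.
  lra.
- have hh (x : R) : a - h <= x <= a -> `|x - a| < d by move=> ?; rewrite ltr_norml; lra.
  have [||x] := @MVT R f f' (a - h) a _ _ (cont _ _ hh); first by rewrite ltrBlDr ltrDl.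
    by move=> c; rewrite in_itv /= => /andP[c1 c2]; apply: hf; apply: hh; rewrite !ltW.
  rewrite in_itv /= => /andP[x1 x2] E.
  have := hmin (a - h); rewrite addrAC subrr add0r normrN gtr0_norm // => /(_ hd').
  rewrite -subr_le0 E subKr pmulr_lle0 // => f'x.
  have xa : x - a < 0 by rewrite subr_lt0.
  have xe : `|x - a| < e by rewrite ltr0_norm //; lra.
  have := he (x - a) xe; rewrite (ltr0_norm xa) (addrC a) subrK ler_norml => /andP[h1 _].
  have : 0 < (x - a) * l by rewrite nmulr_rgt0.
  lra.
Qed.

(** The base case is contained in the first hypothesis, whose premise on earlier times is void at
    0. *)
Lemma real_induction (Q : R -> Prop) :
  (forall t, 0 <= t <= 1 -> (forall s, 0 <= s < t -> Q s) -> Q t) ->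
  (forall t, 0 <= t < 1 -> (forall s, 0 <= s <= t -> Q s) ->
     exists2 d : R, 0 < d & forall s, t < s < t + d -> Q s) ->
  forall t, 0 <= t <= 1 -> Q t.
Proof.
move=> hcl hop t /andP[t0 t1]; apply: contrapT => nQ.
pose S := [set u | 0 <= u <= t /\ forall s, 0 <= s <= u -> Q s].
have S0 : S 0.
  split; first by rewrite lexx.
  move=> s s0; have -> : s = 0 by apply/le_anti; rewrite andbC.
  by apply: hcl; [rewrite lexx ler01|move=> x /andP[x0 x1]; move: (le_lt_trans x0 x1); rewrite ltxx].
have hs : has_sup S by split; [exists 0|exists t => u [/andP[]]].
set c := sup S; have c0 : 0 <= c by apply: ub_le_sup S0; exists t => u [/andP[]].
have ct : c <= t by apply: ge_sup; [exists 0|move=> u [/andP[]]].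
have below s : 0 <= s < c -> Q s.
  move=> /andP[s0 sc]; have sc0 : 0 < c - s by rewrite subr_gt0.
  have [u [_ hu]] := sup_adherent sc0 hs; rewrite subKr => su.
  by apply: hu; rewrite s0 ltW.
have Qc : Q c by apply: hcl => //; rewrite c0 (le_trans ct).
have Qle s : 0 <= s <= c -> Q s.
  by move=> /andP[s0]; rewrite le_eqVlt => /orP[/eqP->//|sc]; apply: below; rewrite s0.
have cne : c < t by rewrite lt_neqAle ct andbT; apply/eqP => e; apply: nQ; rewrite -e.
have [|d d0 hd] := hop c _ Qle; first by rewrite c0 (lt_le_trans cne).
pose u := Num.min t (c + d / 2).
have cu : c < u by rewrite lt_min cne ltrDl divr_gt0.
have ut : u <= t by rewrite ge_min lexx.
have ud : u < c + d by apply: (@le_lt_trans _ _ (c + d / 2)); [rewrite ge_min lexx orbT|lra].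
have : u <= c.
  apply: ub_le_sup; first by exists t => x [/andP[]].
  split; first by rewrite ut (le_trans c0 (ltW cu)).
  move=> s /andP[s0 su]; have [sc|cs] := leP s c; first by apply: Qle; rewrite s0.
  by apply: hd; rewrite cs (le_lt_trans su).
by rewrite leNgt cu.
Qed.

(** Partial derivatives as derivatives of slices, to which the one-variable theorems apply
    directly. *)
Definition partial1 (f : R * R -> R) (p : R * R) (l : R) : Prop := is_derive p.1 (1 : R) (fun x : R => f (x, p.2)) l.

Definition partial2 (f : R * R -> R) (p : R * R) (l : R) : Prop := is_derive p.2 (1 : R) (fun y : R => f (p.1, y)) l.

Lemma derivable_partial1 f p : derivable f p ((1, 0) : R * R) -> partial1 f p (dx f p).
Proof.
move=> df; have e : (fun h : R => h^-1 *: (((fun x : R => f (x, p.2)) \o shift p.1) (h *: 1) - f (p.1, p.2))) =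
   (fun h : R => h^-1 *: ((f \o shift p) (h *: ((1, 0) : R * R)) - f p)).
  apply/funext => h; rewrite -surjective_pairing; congr (_ *: (_ - _)).
  by rewrite /=; congr f; rewrite [RHS]surjective_pairing /= scaler0 add0r.
by split; [rewrite /derivable /= e|rewrite /dx /derive /= e].
Qed.

Lemma derivable_partial2 f p : derivable f p ((0, 1) : R * R) -> partial2 f p (dy f p).
Proof.
move=> df; have e : (fun h : R => h^-1 *: (((fun y : R => f (p.1, y)) \o shift p.2) (h *: 1) - f (p.1, p.2))) =
   (fun h : R => h^-1 *: ((f \o shift p) (h *: ((0, 1) : R * R)) - f p)).
  apply/funext => h; rewrite -surjective_pairing; congr (_ *: (_ - _)).
  by rewrite /=; congr f; rewrite [RHS]surjective_pairing /= scaler0 add0r.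
by split; [rewrite /derivable /= e|rewrite /dy /derive /= e].
Qed.

Definition cont_at (f : R * R -> R) p : Prop :=
  forall e : R, 0 < e -> exists2 d : R, 0 < d & forall q, edist2 p q < d -> `|f q - f p| < e.

(** The increment is a vertical one starting at [p], estimated by the derivative there, plus a
    horizontal one at a displaced height, estimated by the mean value theorem. Only the latter
    evaluates a derivative away from [p], which is why continuity is asked of [fx]. *)
Lemma directional_derivative (f fx fy : R * R -> R) p v r : 0 < r ->
  (forall q, edist2 p q < r -> partial1 f q (fx q) /\ partial2 f q (fy q)) ->
  cont_at fx p ->
  is_derive (0 : R) (1 : R) (fun t : R => f (p.1 + t * v.1, p.2 + t * v.2)) (v.1 * fx p + v.2 * fy p).
Proof.
move=> r0 hf cfx; apply/is_deriveP => e e0.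
(* Adding 1 keeps the divisor positive when [v] vanishes. *)
pose c := enorm v + 1; have c0 : 0 < c by rewrite ltr_wpDl ?enorm_ge0.
have e2 : 0 < e / 2 by rewrite divr_gt0.
have ec : 0 < e / 2 / c by rewrite divr_gt0.
have [d1 d10 hd1] := cfx _ ec.
have [_ py] := hf p (eq_ind_r (fun x => x < r) r0 (edist2xx p)).
have hy : is_derive (0 : R) (1 : R) (fun t : R => f (p.1, p.2 + t * v.2)) (v.2 * fy p).
  by apply: (is_derive_affine (f := fun y => f (p.1, y))); rewrite mul0r addr0.
have [d2 d20 hd2] := (is_deriveP _ _ _).1 hy _ e2.
pose d := Num.min d2 (Num.min r d1 / c).
have m0 : 0 < Num.min r d1 by rewrite lt_min r0 d10.
exists d; first by rewrite lt_min d20 divr_gt0.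
move=> h; rewrite lt_min => /andP[hh2]; rewrite ltr_pdivlMr // => hhc.
rewrite add0r !mul0r !addr0 -surjective_pairing.
have := hd2 h hh2; rewrite add0r mul0r addr0 -surjective_pairing => Hy.
have near_p (s : R) : `|s| <= `|h| -> edist2 p (p.1 + s * v.1, p.2 + h * v.2) < Num.min r d1.
  move=> sh; apply: le_lt_trans hhc; rewrite /edist2.
  have -> : p - (p.1 + s * v.1, p.2 + h * v.2) = - (s * v.1, h * v.2).
    by case: (p) => a b; congr pair => /=; ring.
  rewrite enormN; apply: enorm_le; first by rewrite mulr_ge0 // ltW.
  rewrite /= !exprMn; apply: (@le_trans _ _ (`|h| ^+ 2 * enorm v ^+ 2)).
    rewrite enorm2 mulrDr; apply: lerD; last by rewrite real_normK ?num_real.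
    by rewrite ler_wpM2r ?sqr_ge0 // -real_normK ?num_real // lerXn2r ?nnegrE.
  by rewrite ler_wpM2l ?sqr_ge0 // lerXn2r ?nnegrE ?enorm_ge0 // ?ltW // /c; lra.
have hxd (t : R) : `|t| <= 1 -> is_derive t (1 : R) (fun t : R => f (p.1 + t * (h * v.1), p.2 + h * v.2))
     (h * v.1 * fx (p.1 + t * (h * v.1), p.2 + h * v.2)).
  move=> t1; have th : `|t * h| <= `|h| by rewrite normrM ler_piMl.
  have := near_p _ th; rewrite lt_min -mulrA => /andP[nr _].
  by have [px _] := hf _ nr; exact: (is_derive_affine (f := fun x => f (x, p.2 + h * v.2))).
have [||t] := @MVT R (fun t : R => f (p.1 + t * (h * v.1), p.2 + h * v.2))
  (fun t => h * v.1 * fx (p.1 + t * (h * v.1), p.2 + h * v.2)) 0 1 ltr01.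
- by move=> t; rewrite in_itv /= => /andP[t0 t1]; apply: hxd; rewrite gtr0_norm // ltW.
- apply: continuous_in_subspaceT => t; rewrite inE /= in_itv /= => /andP[t0 t1].
  by apply: is_derive_continuous (hxd t _); rewrite ger0_norm.
rewrite in_itv /= => /andP[t0 t1]; rewrite mul0r addr0 mul1r subr0 mulr1 => Hx.
have th : `|t * h| <= `|h| by rewrite normrM ler_piMl // gtr0_norm // ltW.
have := near_p _ th; rewrite lt_min -mulrA => /andP[_ /hd1 Hc].
have -> : f (p.1 + h * v.1, p.2 + h * v.2) - f p - h * (v.1 * fx p + v.2 * fy p) =
   h * v.1 * (fx (p.1 + t * (h * v.1), p.2 + h * v.2) - fx p) + (f (p.1, p.2 + h * v.2) - f p - h * (v.2 * fy p)).
  by move: Hx => /eqP; rewrite subr_eq => /eqP ->; ring.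
apply: le_trans (ler_normD _ _) _.
have -> : e * `|h| = e / 2 * `|h| + e / 2 * `|h| by field.
apply: lerD => //; rewrite !normrM -mulrA mulrC ler_wpM2r //.
have [v1 _] := enorm_coord v.
apply: (@le_trans _ _ (c * (e / 2 / c))); last by rewrite mulrC divfK ?gt_eqF.
by apply: ler_pM => //; [rewrite /c; lra|exact: ltW].
Qed.

Definition ray q v t : R * R := (q.1 + t * v.1, q.2 + t * v.2).

Lemma edist2_ray q v s t : edist2 (ray q v s) (ray q v t) = `|s - t| * enorm v.
Proof.
rewrite /edist2 -enorm_cst; congr enorm.
by case: q v => [? ?] [? ?]; congr pair => /=; ring.
Qed.

Lemma ray0 q v : ray q v 0 = q.
Proof. by rewrite /ray !mul0r !addr0 -surjective_pairing. Qed.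

Definition C1_on (D : set (R * R)) (f fx fy : R * R -> R) : Prop :=
  forall p, D p -> [/\ partial1 f p (fx p), partial2 f p (fy p) & cont_at fx p].

Lemma ray_derivative (D : set (R * R)) f fx fy q v t : open D -> C1_on D f fx fy -> D (ray q v t) ->
  is_derive t (1 : R) (fun t : R => f (ray q v t)) (v.1 * fx (ray q v t) + v.2 * fy (ray q v t)).
Proof.
move=> /open_edist oD hf Dt; have [r r0 hr] := oD _ Dt.
have H := @directional_derivative f fx fy (ray q v t) v r r0 _ _.
have {}H : is_derive (0 : R) (1 : R) (fun s : R => f (ray q v (t + s * 1)))
    (1 * (v.1 * fx (ray q v t) + v.2 * fy (ray q v t))).
  rewrite mul1r.
  have -> : (fun s : R => f (ray q v (t + s * 1))) =
      fun s : R => f ((ray q v t).1 + s * v.1, (ray q v t).2 + s * v.2).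
    by apply/funext => s; congr f; congr pair => /=; ring.
  apply: H; last by have [] := hf _ Dt.
  by move=> y /hr /hf[].
apply/is_deriveP => e e0; have [d d0 hd] := (is_deriveP _ _ _).1 H e e0.
by exists d => // h /hd; rewrite !add0r !mulr1 addr0 mul1r.
Qed.

Lemma ray_growth (D : set (R * R)) f fx fy q v (a b k : R) : open D -> C1_on D f fx fy -> a <= b ->
  (forall t, a <= t <= b -> D (ray q v t)) ->
  (forall t, a <= t <= b -> k <= v.1 * fx (ray q v t) + v.2 * fy (ray q v t)) ->
  f (ray q v a) + k * (b - a) <= f (ray q v b).
Proof.
move=> oD hf; rewrite le_eqVlt => /orP[/eqP <- _ _|ab hD hk]; first by rewrite subrr mulr0 addr0.
have der t : a <= t <= b -> is_derive t (1 : R) (fun t : R => f (ray q v t))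
    (v.1 * fx (ray q v t) + v.2 * fy (ray q v t)).
  by move=> /hD; exact: ray_derivative.
have [||t] := @MVT R (fun t : R => f (ray q v t)) (fun t => v.1 * fx (ray q v t) + v.2 * fy (ray q v t)) a b ab.
- by move=> t; rewrite in_itv /= => /andP[t0 t1]; apply: der; rewrite !ltW.
- apply: continuous_in_subspaceT => t; rewrite inE /= in_itv /= => t01.
  exact: is_derive_continuous (der t t01).
rewrite in_itv /= => /andP[t0 t1] E.
have h : k * (b - a) <= f (ray q v b) - f (ray q v a).
  by rewrite E ler_wpM2r ?subr_ge0 ?(ltW ab) // hk // !ltW.
lra.
Qed.

Definition cont_on (D : set (R * R)) (f : R * R -> R) : Prop :=
  forall p, D p -> forall e : R, 0 < e -> exists2 d : R, 0 < d & forall q, D q -> edist2 p q < d -> `|f q - f p| < e.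

Lemma cont_onP D f : {within D, continuous f} <-> cont_on D f.
Proof.
rewrite subspace_continuousP; split.
- move=> h p Dp e e0; have /cvgrPdist_lt/(_ e e0) := h p Dp.
  move=> /nbhs_edist[d d0 hd]; exists d => // q Dq pq; rewrite distrC; exact: hd.
- move=> h p Dp; apply/cvgrPdist_lt => e e0; have [d d0 hd] := h p Dp e e0.
  by apply/nbhs_edist; exists d => // q pq Dq; rewrite distrC; exact: hd.
Qed.

Lemma closure_translate (V : set (R * R)) z : (forall p, V (p + z) <-> V p) ->
  forall p, closure V (p + z) <-> closure V p.
Proof.
move=> hV p; rewrite !closure_edist; split => h r r0.
- have [q Vq pq] := h r r0; exists (q - z); first by apply/hV; rewrite subrK.
  by move: pq; rewrite /edist2 opprB addrA.
- have [q Vq pq] := h r r0; exists (q + z); first by apply/hV.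
  by rewrite /edist2 opprD addrACA subrr addr0.
Qed.

Lemma periodic_fun_int (P : R) (V : set (R * R)) (f : R * R -> R) (n : int) : periodic_set P V ->
  (forall p, V p -> f (p + (P, 0)) = f p) -> forall p, V p -> f (p + (n%:~R * P, 0)) = f p.
Proof.
move=> pV pf.
(* Level sets of [f] are periodic sets, which reduces the claim to [periodic_int]. *)
have h (c : R) : periodic_set P (V `&` [set p | f p = c]).
  move=> p; split=> -[Vp e]; first by have Vp' := (pV p).1 Vp; split => //; rewrite /= -pf.
  by split; [exact/pV|rewrite /= pf].
move=> p Vp; have [] := (periodic_int n (h (f p)) p).2; last by [].
by [].
Qed.

(* A minimum of the strictly superharmonic [w - e y^2] below its boundary values would
   contradict the second derivative test. *)
Lemma max_principle (P M : R) (V : set (R * R)) (w wx wy wxx wyy : R * R -> R) : 0 < P ->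
  open V -> periodic_set P V -> (forall p, V p -> `|p.2| <= M) ->
  cont_on (closure V) w -> (forall p, closure V p -> w (p + (P, 0)) = w p) ->
  (forall p, V p -> partial1 w p (wx p) /\ partial2 w p (wy p)) ->
  (forall p, V p -> partial1 wx p (wxx p) /\ partial2 wy p (wyy p)) ->
  (forall p, V p -> wxx p + wyy p = 0) ->
  (forall p, closure V p -> ~ V p -> 0 <= w p) ->
  forall p, closure V p -> 0 <= w p.
Proof.
move=> P0 oV pV bV cw pw d1 d2 lap bd z0 cz0; rewrite leNgt; apply/negP => wz0.
have pcV : periodic_set P (closure V) by apply: closure_translate.
have bcV p : closure V p -> `|p.2| <= M.
  move=> /closure_edist cp; rewrite leNgt; apply/negP => Mp.
  have p0 : 0 < `|p.2| - M by rewrite subr_gt0.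
  have [q /bV qM pq] := cp _ p0; have [_ h] := enorm_coord (p - q).
  have := ler_normD (p.2 - q.2) q.2; rewrite subrK => h2.
  have : `|p.2 - q.2| < `|p.2| - M by apply: le_lt_trans pq.
  lra.
have M0 : 0 <= M by apply: le_trans (bcV _ cz0).
have M1 : 0 < M ^+ 2 + 1 by rewrite ltr_wpDl // sqr_ge0.
(* With this size, [e * y ^+ 2] stays below [- w z0] on the strip, so [w - e * y ^+ 2] is larger on
   the boundary than at [z0], and its minimum is interior. *)
pose e := - w z0 / (M ^+ 2 + 1); have e0 : 0 < e by rewrite divr_gt0 // oppr_gt0.
have eM : e * M ^+ 2 < - w z0.
  have -> : - w z0 = e * (M ^+ 2 + 1) by rewrite /e divfK // gt_eqF.
  by rewrite ltr_pM2l // ltrDl.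
pose v p := w p - e * p.2 ^+ 2.
have vper p (n : int) : closure V p -> v (p + (n%:~R * P, 0)) = v p.
  by move=> cp; rewrite /v (periodic_fun_int n pcV pw cp) /= addr0.
(* One period is compact, and a minimum over it is global by periodicity. *)
pose K := [set p : R * R | (0 <= p.1 <= P) && (`|p.2| <= M)] `&` closure V.
have cK : compact K by apply: compact_closedI; [exact: strip_compact|exact: closed_closure].
have toK p : closure V p -> exists n : int, K (p + (n%:~R * P, 0)).
  move=> cp; have [n hn] := period_reduce p.1 P0; exists n; split.
    by rewrite /= hn addr0 bcV.
  by apply/(periodic_int n pcV).
have cv : {within K, continuous v}.
  apply/cont_onP => p [_ cp] r r0; have r2 : 0 < r / 2 by rewrite divr_gt0.
  have [d d0 hd] := cw p cp _ r2.
  have csq : {for p.2, continuous (fun y : R => e * y ^+ 2)}.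
    by apply: (@cvgM _ _ (nbhs p.2)); [exact: cvg_cst|exact: exprn_continuous].
  have /cvgrPdist_lt/(_ _ r2)/nbhsR[d' d'0 hd'] := csq.
  exists (Num.min d d'); first by rewrite lt_min d0 d'0.
  move=> q [_ cq]; rewrite lt_min => /andP[q1 q2].
  have h1 := hd q cq q1.
  have h2 : `|e * p.2 ^+ 2 - e * q.2 ^+ 2| < r / 2.
    apply: hd'; rewrite distrC; apply: le_lt_trans q2.
    by have [_] := enorm_coord (p - q).
  rewrite /v; have -> : w q - e * q.2 ^+ 2 - (w p - e * p.2 ^+ 2) =
      (w q - w p) + (e * p.2 ^+ 2 - e * q.2 ^+ 2) by ring.
  by apply: le_lt_trans (ler_normD _ _) _; lra.
have [n0 Kn0] := toK _ cz0.
have [z Kz zmin] := compact_EVT_min (ex_intro _ _ Kn0) cK cv.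
rewrite inE in Kz; case: Kz => _ cz.
have vmin p : closure V p -> v z <= v p.
  by move=> cp; have [n Kn] := toK p cp; rewrite -(vper p n cp); apply: zmin; rewrite inE.
have Vz : V z.
  apply: contrapT => nVz; have := vmin _ cz0; have := bd z cz nVz; rewrite /v.
  have : z.2 ^+ 2 <= M ^+ 2 by rewrite -(real_normK (num_real z.2)) lerXn2r ?nnegrE // bcV.
  move=> h; have : e * z.2 ^+ 2 <= e * M ^+ 2 by rewrite ler_pM2l.
  have : 0 <= e * z0.2 ^+ 2 by rewrite mulr_ge0 ?sqr_ge0 // ltW.
  lra.
have /open_edist/(_ z Vz)[r r0 hr] := oV.
have nx (x : R) : `|x - z.1| < r -> edist2 z (x, z.2) < r.
  move=> xr; apply: le_lt_trans (enorm_le_sum _) _.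
  by rewrite /= subrr normr0 addr0 distrC.
have ny (y : R) : `|y - z.2| < r -> edist2 z (z.1, y) < r.
  move=> xr; apply: le_lt_trans (enorm_le_sum _) _.
  by rewrite /= subrr normr0 add0r distrC.
have h1 : 0 <= wxx z.
  apply: (second_derivative_test (f := fun x => w (x, z.2)) (f' := fun x => wx (x, z.2)) r0).
  - by move=> x /nx /hr /d1[].
  - by have [] := d2 z Vz.
  - move=> x /nx /hr Vx; have := vmin _ (subset_closure Vx).
    by rewrite /v /= lerD2r -surjective_pairing.
have h2 : 0 <= wyy z - 2 * e.
  apply: (second_derivative_test (f := fun y => w (z.1, y) - e * y ^+ 2) (f' := fun y => wy (z.1, y) - 2 * e * y) r0).
  - move=> y /ny /hr /d1[_]; rewrite /partial2 /= => h.
    apply: is_deriveB; apply/is_deriveP => e' e'0; exists (e' / e); first by rewrite divr_gt0.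
    move=> h' hh'; have -> : e * (y + h') ^+ 2 - e * y ^+ 2 - h' * (2 * e * y) = e * h' ^+ 2 by ring.
    rewrite normrM normrX (gtr0_norm e0) expr2 mulrA ler_wpM2r //.
    by rewrite mulrC -ler_pdivlMr // ltW.
  - have [_] := d2 z Vz; rewrite /partial2 => h.
    apply: is_deriveB; apply/is_deriveP => e' e'0; exists 1 => // h' _.
    have -> : 2 * e * (z.2 + h') - 2 * e * z.2 - h' * (2 * e) = 0 by ring.
    by rewrite normr0 mulr_ge0 // ltW.
  - by move=> y /ny /hr Vy; have := vmin _ (subset_closure Vy); rewrite /v /= -surjective_pairing.
have := lap z Vz; lra.
Qed.

End Calculus.

(** * Capacitary potentials *)

Section Potentials.
Context {R : realType}.
Variables (P sg : R).
Hypothesis P0 : 0 < P.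
Implicit Types (p q z v : R * R) (r s t u : R) (X Y : barrier (R := R)) (D : set (R * R)).

(** The derivatives are carried along as data, so that [potflip] can prescribe those of the flipped
    potential. *)
Record potfun := Potfun {
  pu : R * R -> R; pux : R * R -> R; puy : R * R -> R; puxx : R * R -> R; puyy : R * R -> R }.

Definition region X1 X2 : set (R * R) := bA X2 `&` bB X1.

Definition grad_lim D (U : potfun) p v : Prop := forall e : R, 0 < e -> exists2 d : R, 0 < d &
  forall q, D q -> edist2 p q < d -> `|pux U q - v.1| < e /\ `|puy U q - v.2| < e.

(* [k1] and [k2] are the boundary values of the length of the gradient. *)
Record potential (U : potfun) X1 X2 (k1 k2 : R * R -> R) : Prop := Potential {
  pot_cont : cont_on (closure (region X1 X2)) (pu U);
  pot_per : forall p, closure (region X1 X2) p -> pu U (p + (P, 0)) = pu U p;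
  pot_C1 : C1_on (region X1 X2) (pu U) (pux U) (puy U);
  pot_C2 : forall p, region X1 X2 p -> partial1 (pux U) p (puxx U p) /\ partial2 (puy U) p (puyy U p);
  pot_lap : forall p, region X1 X2 p -> puxx U p + puyy U p = 0;
  pot_0 : forall p, bG X1 p -> pu U p = 0;
  pot_1 : forall p, bG X2 p -> pu U p = 1;
  pot_grad1 : forall p, bG X1 p -> exists2 v, enorm v = k1 p & grad_lim (region X1 X2) U p v;
  pot_grad2 : forall p, bG X2 p -> exists2 v, enorm v = k2 p & grad_lim (region X1 X2) U p v
}.

(** With the sides exchanged, the former upper arc carries the value 0; [1 - U] is the capacitary
    potential then. *)
Definition potflip (U : potfun) : potfun :=
  Potfun (fun p => 1 - pu U p) (fun p => - pux U p) (fun p => - puy U p)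
         (fun p => - puxx U p) (fun p => - puyy U p).

Lemma is_derive_opp (f : R -> R) (a l : R) : is_derive a (1 : R) f l -> is_derive a (1 : R) (fun x => - f x) (- l).
Proof. by move=> h; exact: is_deriveN. Qed.

Lemma is_derive_1sub (f : R -> R) (a l : R) : is_derive a (1 : R) f l -> is_derive a (1 : R) (fun x => 1 - f x) (- l).
Proof.
move=> /is_deriveP h; apply/is_deriveP => e /h[d d0 hd]; exists d => // x /hd.
by rewrite -normrN; congr (`|_| <= _); ring.
Qed.

Lemma cont_at_opp (f : R * R -> R) p : cont_at f p -> cont_at (fun q => - f q) p.
Proof.
move=> h e /h[d d0 hd]; exists d => // q /hd.
by rewrite -normrN opprB opprK addrC.
Qed.

Lemma potential_flip U X1 X2 k1 k2 : potential U X1 X2 k1 k2 ->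
  potential (potflip U) (flip X2) (flip X1) k2 k1.
Proof.
case=> h1 h2 h3 h4 h5 h6 h7 h8 h9.
have er : region (flip X2) (flip X1) = region X1 X2 by rewrite /region /= setIC.
have gl p v : grad_lim (region X1 X2) U p v ->
    grad_lim (region X1 X2) (potflip U) p (- v.1, - v.2).
  move=> h e /h[d d0 hd]; exists d => // q Dq /(hd q Dq)[a b] /=.
  by rewrite -!opprD !normrN.
have en v : enorm (- v.1, - v.2) = enorm v by rewrite -[RHS]enormN.
split; rewrite ?er.
- move=> p cp e e0; have [d d0 hd] := h1 p cp e e0; exists d => // q cq /(hd q cq) /=.
  by rewrite -normrN; congr (`|_| < _); ring.
- by move=> p /h2 /= ->.
- move=> p /h3[a b c]; split; first exact: is_derive_1sub.
    exact: is_derive_1sub.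
  exact: cont_at_opp.
- by move=> p /h4[a b]; split; exact: is_derive_opp.
- by move=> p /h5 /=; lra.
- by move=> p /h7 /= ->; rewrite subrr.
- by move=> p /h6 /= ->; rewrite subr0.
- by move=> p /h9[v <- hv]; exists (- v.1, - v.2); [exact: en|exact: gl].
- by move=> p /h8[v <- hv]; exists (- v.1, - v.2); [exact: en|exact: gl].
Qed.

Lemma region_open X1 X2 : sep P sg X1 -> sep P sg X2 -> open (region X1 X2).
Proof. by move=> S1 S2; apply: openI; [exact: sep_openA S2|exact: sep_openB S1]. Qed.

Lemma region_periodic X1 X2 : sep P sg X1 -> sep P sg X2 -> periodic_set P (region X1 X2).
Proof.
move=> S1 S2 p; have a := sep_perA S2 p; have b := sep_perB S1 p.
by rewrite /region /=; tauto.
Qed.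

Lemma region_bounded X1 X2 : sep P sg X1 -> sep P sg X2 ->
  exists M, forall p, region X1 X2 p -> `|p.2| <= M.
Proof.
move=> S1 S2; have [M1 _ h1] := sep_far S1; have [M2 _ h2] := sep_far S2.
exists (Num.max M1 M2) => p [Ap Bp].
have -> : `|p.2| = `|sg * p.2| by rewrite normrM (sep_sg S1) mul1r.
rewrite ler_norml lerNl !le_max; apply/andP; split; apply/orP.
- by left; rewrite leNgt; apply/negP => /(h1 p).1 Ap'; exact: (sep_AB S1 Ap').
- by right; rewrite leNgt; apply/negP => /(h2 p).2; exact: (sep_AB S2 Ap).
Qed.

Lemma region_boundary X1 X2 : sep P sg X1 -> sep P sg X2 ->
  forall p, closure (region X1 X2) p -> ~ region X1 X2 p -> bG X1 p \/ bG X2 p.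
Proof.
move=> S1 S2 p /closure_edist cp np.
have far D : open D -> (forall q, D q -> ~ region X1 X2 q) -> D p -> False.
  move=> /open_edist oD nD Dp; have [r r0 hr] := oD p Dp.
  by have [q rq /hr Dq] := cp r r0; exact: (nD q Dq).
have [|Ap|Bp] := sep_cover S1 p; first by left.
  by case: (far _ (sep_openA S1) _ Ap) => q Aq [_ Bq]; exact: (sep_AB S1 Aq).
have [|Ap'|Bp'] := sep_cover S2 p; first by right.
  by case: np.
by case: (far _ (sep_openB S2) _ Bp') => q Bq [Aq _]; exact: (sep_AB S2 Aq).
Qed.

Lemma closure_region1 X1 X2 p : sep P sg X1 -> sep P sg X2 -> Lt X1 X2 -> bG X1 p -> closure (region X1 X2) p.
Proof.
move=> S1 S2 [h _ _ _] Gp; apply/closure_edist => r r0.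
have /open_edist/(_ p (h p Gp))[d d0 hd] := sep_openA S2.
have m0 : 0 < Num.min r d by rewrite lt_min r0 d0.
have /closure_edist/(_ _ m0)[q Bq] := sep_clB S1 Gp.
by rewrite lt_min => /andP[qr /hd Aq]; exists q.
Qed.

Lemma closure_region2 X1 X2 p : sep P sg X1 -> sep P sg X2 -> Lt X1 X2 -> bG X2 p -> closure (region X1 X2) p.
Proof.
move=> S1 S2 [_ _ h _] Gp; apply/closure_edist => r r0.
have /open_edist/(_ p (h p Gp))[d d0 hd] := sep_openB S1.
have m0 : 0 < Num.min r d by rewrite lt_min r0 d0.
have /closure_edist/(_ _ m0)[q Aq] := sep_clA S2 Gp.
by rewrite lt_min => /andP[qr /hd Bq]; exists q.
Qed.

Lemma potential_ge0 U X1 X2 k1 k2 : sep P sg X1 -> sep P sg X2 -> potential U X1 X2 k1 k2 ->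
  forall p, closure (region X1 X2) p -> 0 <= pu U p.
Proof.
move=> S1 S2 H; have [M hM] := region_bounded S1 S2.
apply: (max_principle P0 (region_open S1 S2) (region_periodic S1 S2) hM (pot_cont H) (pot_per H)).
- by move=> p /(pot_C1 H)[a b _]; split; [exact: a|exact: b].
- exact: pot_C2 H.
- exact: pot_lap H.
- move=> p cp /(region_boundary S1 S2 cp)[/(pot_0 H)->//|/(pot_1 H)->]; exact: ler01.
Qed.

Lemma ray_near q v t (d : R) : 0 < d -> exists2 e : R, 0 < e &
  forall s, `|s - t| < e -> edist2 (ray q v t) (ray q v s) < d.
Proof.
move=> d0; have n0 : 0 < enorm v + 1 by rewrite ltr_wpDl ?enorm_ge0.
exists (d / (enorm v + 1)); first by rewrite divr_gt0.
move=> s; rewrite ltr_pdivlMr // edist2_ray distrC => h.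
by apply: le_lt_trans h; rewrite ler_wpM2l // lerDl.
Qed.

(* The potential grows along the ray, which therefore cannot come back to the lower
   curve, where the potential vanishes. *)
Lemma ray_in_region U X1 X2 k1 k2 p v (c r : R) q : sep P sg X1 -> sep P sg X2 ->
  potential U X1 X2 k1 k2 -> 0 < c ->
  (forall x, edist2 p x < r -> bA X2 x) ->
  (forall x, region X1 X2 x -> edist2 p x < r -> c <= v.1 * pux U x + v.2 * puy U x) ->
  region X1 X2 q -> (forall t, 0 <= t <= 1 -> edist2 p (ray q v t) < r) ->
  forall t, 0 <= t <= 1 -> region X1 X2 (ray q v t).
Proof.
move=> S1 S2 H c0 hA hc Dq near; have oD := region_open S1 S2.
have /open_edist oD' := oD.
apply: real_induction => t t01 below; last first.
  have /andP[t0 t1] := t01.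
  have Dt : region X1 X2 (ray q v t) by apply: below; rewrite t0 lexx.
  have [d d0 hd] := oD' _ Dt; have [e e0 he] := ray_near q v t d0.
  by exists e => // s /andP[s1 s2]; apply: hd; apply: he; rewrite gtr0_norm ?subr_gt0 //; lra.
have /andP[t0 t1] := t01; move: t0; rewrite le_eqVlt => /orP[/eqP <-|t0]; first by rewrite ray0.
apply: contrapT => nD.
have cD : closure (region X1 X2) (ray q v t).
  apply/closure_edist => d d0; have [e e0 he] := ray_near q v t d0.
  pose s := Num.max 0 (t - e / 2).
  have st : s < t by rewrite gt_max t0 ltrBlDr ltrDl divr_gt0.
  have s0 : 0 <= s by rewrite le_max lexx.
  have se : t - e / 2 <= s by rewrite le_max lexx orbT.
  exists (ray q v s); first by apply: below; rewrite s0.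
  by apply: he; rewrite ltr0_norm ?subr_lt0 //; lra.
have u0 : pu U (ray q v t) = 0.
  have [/(pot_0 H)//|G2] := region_boundary S1 S2 cD nD.
  by case: (sep_GA S2 G2); apply: hA; apply: near; rewrite ltW.
(* At the exit time [t] the potential vanishes, so just before, at some [s >= t / 2], it is below
   [c * (t / 2)]. Growth from a nonnegative value gives at least [c * s]. *)
have ct : 0 < c * (t / 2) by rewrite mulr_gt0 // divr_gt0.
have [d d0 hd] := pot_cont H cD ct; have [e e0 he] := ray_near q v t d0.
pose s := Num.max (t / 2) (t - e / 2).
have st : s < t by rewrite gt_max ltrBlDr ltrDl divr_gt0 // andbT; lra.
have s0 : t / 2 <= s by rewrite le_max lexx.
have se : t - e / 2 <= s by rewrite le_max lexx orbT.
have Ds : region X1 X2 (ray q v s) by apply: below; rewrite st andbT; apply: le_trans s0; rewrite divr_ge0 // ltW.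
have := hd _ (subset_closure Ds) (he s _); rewrite u0 subr0.
have /[swap] /[apply] : `|s - t| < e by rewrite ltr0_norm ?subr_lt0 //; lra.
rewrite ltNge => /negP; apply; apply: le_trans (ler_norm _).
have in01 u : 0 <= u <= s -> region X1 X2 (ray q v u).
  by move=> /andP[u1 u2]; apply: below; rewrite u1 (le_lt_trans u2).
have s00 : 0 <= s by apply: le_trans s0; rewrite divr_ge0 // ltW.
have Gr : pu U (ray q v 0) + c * (s - 0) <= pu U (ray q v s).
  apply: (ray_growth oD (pot_C1 H) s00 in01) => u /andP[u0' us].
  have u01 : 0 <= u <= 1 by rewrite u0' (le_trans us) // ltW // (lt_le_trans st).
  by apply: hc; [apply: in01; rewrite u0' us|apply: near].
rewrite ray0 subr0 in Gr.
have q0 := potential_ge0 S1 S2 H (subset_closure Dq).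
have : c * (t / 2) <= c * s by rewrite ler_pM2l.
lra.
Qed.

Lemma dotp_approx (w v g : R * R) (e : R) : `|g.1 - v.1| < e -> `|g.2 - v.2| < e ->
  `|(w.1 * g.1 + w.2 * g.2) - dotp w v| <= 2 * e * enorm w.
Proof.
move=> h1 h2.
have -> : w.1 * g.1 + w.2 * g.2 - dotp w v = w.1 * (g.1 - v.1) + w.2 * (g.2 - v.2).
  by rewrite /dotp; ring.
apply: le_trans (ler_normD _ _) _; rewrite !normrM.
have [w1 w2] := enorm_coord w.
have a1 : `|w.1| * `|g.1 - v.1| <= enorm w * e by apply: ler_pM => //; exact: ltW.
have a2 : `|w.2| * `|g.2 - v.2| <= enorm w * e by apply: ler_pM => //; exact: ltW.
lra.
Qed.

(** All points of the upper side near [p] are joined, inside this side, to one point [m] at distance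
    [s] from [p] along the limit gradient; so they share a component. *)
Lemma potential_collared U X1 X2 k1 k2 p : sep P sg X1 -> sep P sg X2 -> Lt X1 X2 ->
  potential U X1 X2 k1 k2 -> bG X1 p -> 0 < k1 p -> collared (bB X1) p.
Proof.
move=> S1 S2 L H Gp kp; have [v vk gv] := pot_grad1 H Gp.
set c := k1 p in vk kp.
have c8 : 0 < c / 8 by rewrite divr_gt0.
have [d1 d10 hd1] := gv _ c8.
have [hA _ _ _] := L.
have /open_edist/(_ p (hA p Gp))[d2 d20 hd2] := sep_openA S2.
pose d := Num.min d1 d2; have d0 : 0 < d by rewrite lt_min d10 d20.
have dd1 : d <= d1 by rewrite ge_min lexx.
have dd2 : d <= d2 by rewrite ge_min lexx orbT.
pose s := d / 2; have s0 : 0 < s by rewrite divr_gt0.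
pose n : R * R := (c^-1 * v.1, c^-1 * v.2).
have n1 : enorm n = 1 by rewrite /n enorm_cst vk ger0_norm ?invr_ge0 ?ltW // mulVf // gt_eqF.
have nv : dotp n v = c.
  have -> : dotp n v = c^-1 * enorm v ^+ 2 by rewrite enorm2 /dotp /=; ring.
  by rewrite vk expr2 mulrA mulVf ?mul1r // gt_eqF.
pose m : R * R := p + (s * n.1, s * n.2).
exists (s / 4); first by rewrite divr_gt0.
have path q : bB X1 q -> edist2 p q < s / 4 -> forall t, 0 <= t <= 1 -> bB X1 (seg q m t).
  move=> Bq pq t t01; pose w := m - q.
  have ew : w = (s * n.1, s * n.2) + (p - q) by rewrite /w /m addrAC addrC.
  have wl : enorm w <= s + s / 4.
    rewrite ew; apply: le_trans (enormD _ _) _; rewrite enorm_cst n1 mulr1 gtr0_norm //.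
    by rewrite lerD2l ltW.
  have near t' : 0 <= t' <= 1 -> edist2 p (ray q w t') < d.
    move=> /andP[t0 t1]; apply: le_lt_trans (edist2_tri p q _) _.
    have := edist2_ray q w 0 t'; rewrite ray0 sub0r normrN ger0_norm // => ->.
    have : t' * enorm w <= enorm w by rewrite ler_piMl // enorm_ge0.
    by rewrite /s in pq wl *; lra.
  have Dq : region X1 X2 q.
    by split => //; apply: hd2; apply: lt_le_trans pq _; rewrite /s; lra.
  have dw : 3 / 4 * s * c <= dotp w v.
    have -> : dotp w v = s * dotp n v + dotp (p - q) v by rewrite ew /dotp /=; ring.
    rewrite nv; have := dotp_le (p - q) v; rewrite ler_norml => /andP[h _].
    have : enorm (p - q) * enorm v <= s / 4 * c by rewrite vk ler_wpM2r // ltW.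
    lra.
  (* The product [dotp w v] is at least [3 / 4 * s * c], and the deviation [c / 8] of each gradient
     component costs at most [5 / 16 * s * c], as [enorm w <= 5 / 4 * s]. *)
  have gd x : region X1 X2 x -> edist2 p x < d -> 7 / 16 * s * c <= w.1 * pux U x + w.2 * puy U x.
    move=> Dx px; have [g1 g2] := hd1 x Dx (lt_le_trans px dd1).
    have := dotp_approx (g := (pux U x, puy U x)) w g1 g2; rewrite ler_norml => /andP[h _].
    have : 2 * (c / 8) * enorm w <= 2 * (c / 8) * (s + s / 4) by rewrite ler_wpM2l // mulr_ge0 // ltW.
    move: h => /=; lra.
  have c0 : 0 < 7 / 16 * s * c by rewrite !mulr_gt0.
  have hA2 x : edist2 p x < d -> bA X2 x by move=> px; apply: hd2; exact: lt_le_trans px dd2.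
  by have [] := ray_in_region S1 S2 H c0 hA2 gd Dq near t01.
move=> Q hQ q q' Bq Bq' pq pq' Qq; apply: contrapT => nQ'.
have Qm : Q m by apply: (seg_lconnected (path q Bq pq) hQ).
have nQm : (~` Q) m by apply: (seg_lconnected (path q' Bq' pq') (locally_constant_onC hQ)).
exact: nQm.
Qed.

(* Start near a common point [p] of the lower curves and move along the gradient of the
   inner potential, which lies below the outer one. *)
Lemma gradient_comparison U X1 X2 k1 k2 W Y1 Y2 l1 l2 p (d0 : R) :
  sep P sg X1 -> sep P sg X2 -> Lt X1 X2 -> potential U X1 X2 k1 k2 ->
  sep P sg Y1 -> sep P sg Y2 -> Lt Y1 Y2 -> potential W Y1 Y2 l1 l2 ->
  bG X1 p -> bG Y1 p -> 0 < d0 ->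
  (forall q, region Y1 Y2 q -> edist2 p q < d0 -> region X1 X2 q /\ pu W q <= pu U q) ->
  l1 p <= k1 p.
Proof.
move=> S1 S2 L H T1 T2 M K Xp Yp d00 inner; rewrite leNgt; apply/negP => kl.
have [v vk gv] := pot_grad1 H Xp; have [v' vl gv'] := pot_grad1 K Yp.
set k := k1 p in vk kl; set c := l1 p in vl kl.
have k0 : 0 <= k by rewrite -vk enorm_ge0.
have c0 : 0 < c by apply: le_lt_trans kl.
(* Along a ray of length [s], [W] gains at least [s * (c - 2 * e)] and [U] at most
   [s * (k + 2 * e)]. The difference is [4 * e * s], more than the value of [U] at the starting
   point [q], so [W] overtakes [U]. *)
pose e := (c - k) / 8; have e0 : 0 < e by rewrite divr_gt0 // subr_gt0.
have [d1 d10 hd1] := gv _ e0; have [d2 d20 hd2] := gv' _ e0.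
have [hA _ _ _] := M.
have /open_edist/(_ p (hA p Yp))[d3 d30 hd3] := sep_openA T2.
pose d := Num.min (Num.min d0 d1) (Num.min d2 d3).
have dp : 0 < d by rewrite !lt_min d00 d10 d20 d30.
have dd0 : d <= d0 by rewrite !ge_min lexx.
have dd1 : d <= d1 by rewrite !ge_min lexx !orbT.
have dd2 : d <= d2 by rewrite !ge_min lexx !orbT.
have dd3 : d <= d3 by rewrite !ge_min lexx !orbT.
pose s := d / 2; have s0 : 0 < s by rewrite divr_gt0.
have sm0 : 0 < 4 * e * s by rewrite mulr_gt0 // mulr_gt0.
have [d4 d40 hd4] := pot_cont H (closure_region1 S1 S2 L Xp) sm0.
have m0 : 0 < Num.min (d / 2) d4 by rewrite lt_min s0 d40.
have /closure_edist/(_ _ m0)[q Dq] := closure_region1 T1 T2 M Yp.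
rewrite lt_min => /andP[pqd pq4].
have pd0 : edist2 p q < d0 by apply: lt_le_trans dd0; lra.
have [Dq' _] := inner q Dq pd0.
have : `|pu U q - pu U p| < 4 * e * s by apply: hd4 => //; exact: subset_closure.
rewrite (pot_0 H Xp) subr0 => Uq.
pose n : R * R := (c^-1 * v'.1, c^-1 * v'.2).
have n1 : enorm n = 1 by rewrite /n enorm_cst vl ger0_norm ?invr_ge0 ?ltW // mulVf // gt_eqF.
have nv : dotp n v' = c.
  have -> : dotp n v' = c^-1 * enorm v' ^+ 2 by rewrite enorm2 /dotp /=; ring.
  by rewrite vl expr2 mulrA mulVf ?mul1r // gt_eqF.
pose w : R * R := (s * n.1, s * n.2).
have ws : enorm w = s by rewrite /w enorm_cst n1 mulr1 gtr0_norm.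
have near t : 0 <= t <= 1 -> edist2 p (ray q w t) < d.
  move=> /andP[t0 t1]; apply: le_lt_trans (edist2_tri p q _) _.
  have := edist2_ray q w 0 t; rewrite ray0 sub0r normrN ger0_norm // ws => ->.
  have : t * s <= s by rewrite ler_piMl // ltW.
  by rewrite /s in pqd *; lra.
have gW x : region Y1 Y2 x -> edist2 p x < d -> s * (c - 2 * e) <= w.1 * pux W x + w.2 * puy W x.
  move=> Dx px; have [g1 g2] := hd2 x Dx (lt_le_trans px dd2).
  have := dotp_approx (g := (pux W x, puy W x)) w g1 g2; rewrite ler_norml ws => /andP[h _].
  have wv : dotp w v' = s * c by rewrite -nv /w /dotp /=; ring.
  move: h; rewrite wv /=; lra.
have gU x : region Y1 Y2 x -> edist2 p x < d -> w.1 * pux U x + w.2 * puy U x <= s * (k + 2 * e).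
  move=> Dx px; have [Dx' _] := inner x Dx (lt_le_trans px dd0).
  have [g1 g2] := hd1 x Dx' (lt_le_trans px dd1).
  have := dotp_approx (g := (pux U x, puy U x)) w g1 g2; rewrite ler_norml ws => /andP[_ h].
  have wv : dotp w v <= s * k.
    by apply: le_trans (ler_norm _) _; apply: le_trans (dotp_le _ _) _; rewrite ws vk.
  move: h => /=; lra.
have sc0 : 0 < s * (c - 2 * e) by rewrite mulr_gt0 // /e; lra.
have hA2 x : edist2 p x < d -> bA Y2 x by move=> px; apply: hd3; exact: lt_le_trans px dd3.
have Dr := ray_in_region T1 T2 K sc0 hA2 gW Dq near.
have Dr' t : 0 <= t <= 1 -> region X1 X2 (ray q w t).
  by move=> t01; have [] := inner _ (Dr t t01) (lt_le_trans (near t t01) dd0).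
have G1 : pu W (ray q w 0) + s * (c - 2 * e) * (1 - 0) <= pu W (ray q w 1).
  by apply: (ray_growth (region_open T1 T2) (pot_C1 K) ler01 Dr) => t t01; apply: gW; [exact: Dr|exact: near].
have G2 : - pu U (ray q w 0) + - (s * (k + 2 * e)) * (1 - 0) <= - pu U (ray q w 1).
  apply: (@ray_growth _ _ (fun x => - pu U x) (fun x => - pux U x) (fun x => - puy U x)
    _ _ _ _ _ (region_open S1 S2) _ ler01 Dr').
    by move=> x /(pot_C1 H)[a b cc]; split; [exact: is_derive_opp|exact: is_derive_opp|exact: cont_at_opp].
  by move=> t t01; rewrite !mulrN -opprD lerN2; apply: gU; [exact: Dr|exact: near].
rewrite !ray0 subr0 !mulr1 in G1 G2.
have one01 : 0 <= (1 : R) <= 1 by rewrite ler01 lexx.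
have [_ WU] := inner _ (Dr 1 one01) (lt_le_trans (near 1 one01) dd0).
have W0 := potential_ge0 T1 T2 K (subset_closure Dq).
have := ler_norm (pu U q); rewrite /e in Uq G1 G2 *; lra.
Qed.

Lemma sep_flip (sg' : R) X : sep P sg' X -> sep P (- sg') (flip X).
Proof. exact: separates_sym. Qed.

Lemma Lt_flip X Y : Lt X Y -> Lt (flip Y) (flip X).
Proof. by case=> a b c d; split. Qed.

Lemma Le_flip X Y : Le X Y -> Le (flip Y) (flip X).
Proof. by case. Qed.

Lemma cont_onB D (f g : R * R -> R) : cont_on D f -> cont_on D g -> cont_on D (fun p => f p - g p).
Proof.
move=> hf hg p Dp e e0; have e2 : 0 < e / 2 by rewrite divr_gt0.
have [d1 d10 h1] := hf p Dp _ e2; have [d2 d20 h2] := hg p Dp _ e2.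
exists (Num.min d1 d2); first by rewrite lt_min d10 d20.
move=> q Dq; rewrite lt_min => /andP[/(h1 q Dq) a /(h2 q Dq) b].
have -> : f q - g q - (f p - g p) = (f q - f p) - (g q - g p) by ring.
by apply: le_lt_trans (ler_normB _ _) _; lra.
Qed.

Lemma cont_onS D D' (f : R * R -> R) : D `<=` D' -> cont_on D' f -> cont_on D f.
Proof.
move=> s h p /s D'p e e0; have [d d0 hd] := h p D'p e e0.
by exists d => // q /s; exact: hd.
Qed.

End Potentials.

(** * Contacts between two pairs of arcs *)

Section Touching.
Context {R : realType}.
Variables (P : R).
Hypothesis P0 : 0 < P.
Implicit Types (p q z v : R * R) (r s t u : R) (X Y : barrier (R := R)) (D : set (R * R)).

Lemma potential_le1 sg U X1 X2 k1 k2 : sep P sg X1 -> sep P sg X2 -> potential P U X1 X2 k1 k2 ->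
  forall p, closure (region X1 X2) p -> pu U p <= 1.
Proof.
move=> S1 S2 H p cp.
have := potential_ge0 P0 (sep_flip S2) (sep_flip S1) (potential_flip H) (p := p).
rewrite /region /= setIC subr_ge0; exact.
Qed.

(** Both potentials live between [Y1] and [X2]. On [Y1] the inner potential [W] is 0 and [U] is
    nonnegative; on [X2] the potential [U] is 1 and [W] is at most 1. *)
Lemma potential_mono sg U X1 X2 k1 k2 W Y1 Y2 l1 l2 :
  sep P sg X1 -> sep P sg X2 -> potential P U X1 X2 k1 k2 ->
  sep P sg Y1 -> sep P sg Y2 -> potential P W Y1 Y2 l1 l2 ->
  Le X1 Y1 -> Le X2 Y2 ->
  forall p, region Y1 X2 p -> pu W p <= pu U p.
Proof.
move=> S1 S2 H T1 T2 K [_ b1] [a2 _] p Dp.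
have sX : region Y1 X2 `<=` region X1 X2 by move=> q [Aq /b1].
have sY : region Y1 X2 `<=` region Y1 Y2 by move=> q [/a2].
have cX := closureS sX; have cY := closureS sY.
have [M hM] := region_bounded T1 S2.
rewrite -subr_ge0.
apply: (max_principle (w := fun p => pu U p - pu W p) (wx := fun p => pux U p - pux W p)
  (wy := fun p => puy U p - puy W p) (wxx := fun p => puxx U p - puxx W p)
  (wyy := fun p => puyy U p - puyy W p) P0 (region_open T1 S2) (region_periodic T1 S2) hM).
- by apply: cont_onB; [exact: cont_onS cX (pot_cont H)|exact: cont_onS cY (pot_cont K)].
- by move=> q cq; rewrite (pot_per H (cX _ cq)) (pot_per K (cY _ cq)).
- move=> q Dq; have [h1 h2 _] := pot_C1 H (sX _ Dq); have [g1 g2 _] := pot_C1 K (sY _ Dq).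
  by split; exact: is_deriveB.
- move=> q Dq; have [h1 h2] := pot_C2 H (sX _ Dq); have [g1 g2] := pot_C2 K (sY _ Dq).
  by split; exact: is_deriveB.
- by move=> q Dq; have := pot_lap H (sX _ Dq); have := pot_lap K (sY _ Dq); lra.
- move=> q cq /(region_boundary T1 S2 cq)[Yq|Xq]; rewrite subr_ge0.
    by rewrite (pot_0 K Yq); exact: (potential_ge0 P0 S1 S2 H (cX _ cq)).
  by rewrite (pot_1 H Xq); exact: (potential_le1 T1 T2 K (cY _ cq)).
- exact: subset_closure.
Qed.

(** A small ball around the contact point lies below [X2], so within it the region of [W] is
    contained in that of [U] and the potentials compare throughout. *)
Lemma touching_slopes sg U X1 X2 k1 k2 W Y1 Y2 l1 l2 p :
  sep P sg X1 -> sep P sg X2 -> Lt X1 X2 -> potential P U X1 X2 k1 k2 ->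
  sep P sg Y1 -> sep P sg Y2 -> Lt Y1 Y2 -> potential P W Y1 Y2 l1 l2 ->
  Le X1 Y1 -> Le X2 Y2 -> bG X1 p -> bG Y1 p -> l1 p <= k1 p.
Proof.
move=> S1 S2 L H T1 T2 M K e1 e2 Xp Yp.
have [hA _ _ _] := L.
have /open_edist/(_ p (hA p Xp))[d d0 hd] := sep_openA S2.
apply: (gradient_comparison P0 S1 S2 L H T1 T2 M K Xp Yp d0) => q [Aq Bq] /hd A2q.
have [_ b1] := e1; split; first by split => //; exact: b1.
exact: (potential_mono S1 S2 H T1 T2 K e1 e2).
Qed.

Definition solves U (X : barrier * barrier) (k1 k2 : R * R -> R) := [/\ Lt X.1 X.2 & potential P U X.1 X.2 k1 k2].

(* The barriers move up while the slope on the lower curve stays too small, and the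
   one on the upper curve too large, for a contact with [Y]. *)
Lemma family_stays_below sg (a b : R) (F : R -> barrier * barrier) (Y : barrier * barrier)
    (k1 k2 : R -> R * R -> R) (l1 l2 : R * R -> R) (W : potfun) (U : R -> potfun) :
  a < b ->
  (forall t, a <= t <= b -> sep P sg (F t).1 /\ sep P sg (F t).2) -> sep P sg Y.1 /\ sep P sg Y.2 ->
  (forall s t, a <= s -> s < t -> t <= b -> Lt (F s).1 (F t).1 /\ Lt (F s).2 (F t).2) ->
  (forall t (e : R), a <= t <= b -> 0 < e -> exists2 d : R, 0 < d & forall s, a <= s <= b -> `|s - t| < d ->
     close_to e (F s).1 (F t).1 /\ close_to e (F s).2 (F t).2) ->
  solves W Y l1 l2 -> (forall p, 0 < l1 p) ->
  (forall t, a <= t <= b -> solves (U t) (F t) (k1 t) (k2 t)) -> (forall t p, 0 < k2 t p) ->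
  (forall t p, a <= t < b -> k1 t p < l1 p /\ l2 p < k2 t p) ->
  Lt (F a).1 Y.1 /\ Lt (F a).2 Y.2 ->
  Le (F b).1 Y.1 /\ Le (F b).2 Y.2.
Proof.
move=> ab hS [T1 T2] mono close [M K] l1p hU k2p slopes start.
apply: (monotone_family_stays_below P0 ab hS (conj T1 T2) mono close _ _ _ start).
- apply: (collared_lconnected (sep_flip T1)) => p Yp.
  by apply: (potential_collared P0 T1 T2 M K).
- move=> t tab; have [S1 S2] := hS t tab; have [L H] := hU t tab.
  apply: (collared_lconnected S2) => p Xp.
  exact: (potential_collared P0 (sep_flip S2) (sep_flip S1) (Lt_flip L) (potential_flip H)).
- move=> t tab e1 e2; have tab' : a <= t <= b by case/andP: tab => -> /ltW.
  have [S1 S2] := hS t tab'; have [L H] := hU t tab'.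
  split=> p Xp Yp; have [s1 s2] := slopes t p tab.
    have := touching_slopes S1 S2 L H T1 T2 M K e1 e2 Xp Yp.
    by rewrite leNgt s1.
  (* After the flip [Y] is below the family, so the two pairs exchange roles and the outcome is
     [k2 t p <= l2 p]. *)
  have := touching_slopes (sep_flip T2) (sep_flip T1) (Lt_flip M) (potential_flip K)
    (sep_flip S2) (sep_flip S1) (Lt_flip L) (potential_flip H) (Le_flip e2) (Le_flip e1) Yp Xp.
  by rewrite leNgt s2.
Qed.

End Touching.

(** * Uniqueness *)

Section Assembly.
Context {R : realType}.
Implicit Types (p q z v : R * R) (r s t u : R) (G H : set (R * R)).

Definition bar G : barrier := Barrier G (D1 G) (D2 G).

Lemma arcX_sep (P : R) G : 0 < P -> arcX P G -> sep P 1 (bar G).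
Proof. exact: arcX_separates. Qed.

(** An arc is adherent to both of its sides, so either closure inclusion puts the arc itself on a
    side of the other one; the second alternative is the first after a flip. *)
Lemma arc_lt_Lt (P : R) G H : 0 < P -> arcX P G -> arcX P H -> arc_lt G H -> Lt (bar G) (bar H).
Proof.
move=> P0 /(arcX_sep P0) S /(arcX_sep P0) T [h|h].
  by apply: (Lt_of_lower S T) => p Gp; apply: h; exact: (sep_clA S Gp).
have L : Lt (flip (bar H)) (flip (bar G)).
  by apply: (Lt_of_lower (sep_flip T) (sep_flip S)) => p Hp; apply: h; exact: (sep_clB T Hp).
exact: Lt_flip L.
Qed.

Lemma hausdorff_close (A B : set (R * R)) (x e : R) : (hausdorff_dist A B <= x%:E)%E -> x < e ->
  (forall p, A p -> exists2 q, B q & edist2 p q < e) /\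
  (forall p, B p -> exists2 q, A q & edist2 p q < e).
Proof.
move=> h xe.
have half C D : (ereal_sup [set ereal_inf [set (edist2 p q)%:E | q in D] | p in C] <= x%:E)%E ->
    forall p, C p -> exists2 q, D q & edist2 p q < e.
  move=> hs p Cp.
  have : (ereal_inf [set (edist2 p q)%:E | q in D] < e%:E)%E.
    apply: (@le_lt_trans _ _ x%:E); last by rewrite lte_fin.
    by apply: le_trans hs; apply: ereal_sup_ubound; exists p.
  by move=> /ereal_inf_lt[_ [q Dq <-]]; rewrite lte_fin => pq; exists q.
by move: h; rewrite /hausdorff_dist ge_max => /andP[/half h1 /half h2].
Qed.

Lemma classical_potential (P : R) a (lam : R * R) Gam : 0 < P -> classical_solution P a lam Gam ->
  exists U, potential P U (bar Gam.1) (bar Gam.2) (fun p => lam.1 * a p) (fun p => lam.2 * a p).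
Proof.
move=> P0 [[X1 X2 lt12] [U [[cU pU [[_ [dU [C1 C2]]] lU] U0 U1] bU g1 g2]]].
have S1 := arcX_sep P0 X1; have S2 := arcX_sep P0 X2.
have L := arc_lt_Lt P0 X1 X2 lt12.
have er : region (bar Gam.1) (bar Gam.2) = Omega Gam by [].
have oO : open (Omega Gam) by rewrite -er; exact: region_open S1 S2.
have fr p : closure (Omega Gam) p -> ~ Omega Gam p -> frontier (Omega Gam) p.
  by move=> h n; split => // /interior_subset.
have gl p : frontier (Omega Gam) p ->
    grad_lim (Omega Gam) (Potfun U (dx U) (dy U) (dx (dx U)) (dy (dy U))) p (bgrad (Omega Gam) U p).
  move=> /bU[cx cy] e e0.
  move/cvgrPdist_lt/(_ e e0)/nbhs_edist : cx => [d1 d10 hd1].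
  move/cvgrPdist_lt/(_ e e0)/nbhs_edist : cy => [d2 d20 hd2].
  exists (Num.min d1 d2); first by rewrite lt_min d10 d20.
  move=> q Oq; rewrite lt_min => /andP[/hd1/(_ Oq) a1 /hd2/(_ Oq) a2].
  by split => /=; [rewrite (distrC (dx U q)); exact: a1|rewrite (distrC (dy U q)); exact: a2].
have [c1 [h1 _]] := C1; have [_ [h2 _]] := C2.
exists (Potfun U (dx U) (dy U) (dx (dx U)) (dy (dy U))).
split.
- by move/cont_onP : cU.
- exact: pU.
- move=> p Op; have [d1 d2] := dU p Op; split; [exact: (derivable_partial1 d1)|exact: (derivable_partial2 d2)|].
  move=> e e0; have /cvgrPdist_lt/(_ e e0)/nbhs_edist[d d0 hd] := c1 p Op.
  exists d; first exact: d0.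
  by move=> q /hd h; rewrite /= (distrC (dx U q)).
- move=> p Op; split; [apply: derivable_partial1; exact: (h1 p Op).1|apply: derivable_partial2; exact: (h2 p Op).2].
- exact: lU.
- exact: U0.
- exact: U1.
- move=> p Gp; exists (bgrad (Omega Gam) U p); first exact: g1.
  apply: gl; apply: fr; first exact: (closure_region1 S1 S2 L Gp).
  by move=> [_ h]; exact: (sep_GB S1 Gp h).
- move=> p Gp; exists (bgrad (Omega Gam) U p); first exact: g2.
  apply: gl; apply: fr; first exact: (closure_region2 S1 S2 L Gp).
  by move=> [h _]; exact: (sep_GA S2 Gp h).
Qed.

Lemma pair_lt_Lt (P : R) (X Y : curve_pair (R := R)) : 0 < P -> pairX P X -> pairX P Y -> pair_lt X Y ->
  Lt (bar X.1) (bar Y.1) /\ Lt (bar X.2) (bar Y.2).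
Proof.
move=> P0 [a1 a2 _] [b1 b2 _] [c1 c2].
by split; [exact: (arc_lt_Lt P0 a1 b1 c1)|exact: (arc_lt_Lt P0 a2 b2 c2)].
Qed.

Lemma lipschitz_family_close (I : set R) (F : R -> curve_pair (R := R)) t (e : R) :
  locally_lipschitz_family I F -> I t -> 0 < e ->
  exists2 d : R, 0 < d & forall s, I s -> `|s - t| < d ->
    close_to e (bar (F s).1) (bar (F t).1) /\ close_to e (bar (F s).2) (bar (F t).2).
Proof.
move=> hF It e0; have [L [d [d0 hd]]] := hF t It.
(* The Lipschitz constant [L] comes without a sign and may be 0. *)
have L0 : 0 < `|L| + 1 by rewrite ltr_wpDl.
exists (Num.min d (e / (`|L| + 1))); first by rewrite lt_min d0 divr_gt0.
move=> s Is; rewrite lt_min => /andP[sd]; rewrite ltr_pdivlMr // => se.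
have [|h1 h2] := hd s t Is It sd; first by rewrite subrr normr0.
have xe : L * `|s - t| < e.
  apply: le_lt_trans se; rewrite mulrC ler_wpM2l //.
  by apply: le_trans (ler_norm L) _; rewrite lerDl.
by split; [exact: hausdorff_close h1 xe|exact: hausdorff_close h2 xe].
Qed.

Lemma close_to_flip (e : R) (W V : barrier) : close_to e W V -> close_to e (flip W) (flip V).
Proof. by []. Qed.

Lemma bar_pair_eq (P : R) (X Y : curve_pair (R := R)) : 0 < P -> pairX P X -> pairX P Y ->
  Le (bar X.1) (bar Y.1) -> Le (bar X.2) (bar Y.2) ->
  Le (bar Y.1) (bar X.1) -> Le (bar Y.2) (bar X.2) -> X = Y.
Proof.
move=> P0 [a1 a2 _] [b1 b2 _] h1 h2 h3 h4.
rewrite (surjective_pairing X) (surjective_pairing Y).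
by congr pair; [exact: (Le_antisym (arcX_sep P0 a1) (arcX_sep P0 b1) h1 h3)
  |exact: (Le_antisym (arcX_sep P0 a2) (arcX_sep P0 b2) h2 h4)].
Qed.

(** * Comparison of a solution with the family *)

Section Family.
Variables (P : R) (a : R * R -> R) (lam : R -> R * R) (I : set R) (Gam : R -> curve_pair (R := R)).
Hypothesis P0 : 0 < P.
Hypothesis apos : forall p, 0 < a p.
Hypothesis lampos : forall t, 0 < (lam t).1 /\ 0 < (lam t).2.
Hypothesis lam1 : forall s t, s < t -> (lam s).1 < (lam t).1.
Hypothesis lam2 : forall s t, s < t -> (lam t).2 < (lam s).2.
Hypothesis Iitv : is_interval I.
Hypothesis lip : locally_lipschitz_family I Gam.
Hypothesis ord : positively_ordered I Gam.
Hypothesis sol : forall t, I t -> classical_solution P a (lam t) (Gam t).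

Lemma family_potentials : exists U : R -> potfun, forall t, I t ->
  potential P (U t) (bar (Gam t).1) (bar (Gam t).2) (fun p => (lam t).1 * a p) (fun p => (lam t).2 * a p).
Proof.
have /choice[U hU] : forall t, exists U, I t -> potential P U (bar (Gam t).1) (bar (Gam t).2)
    (fun p => (lam t).1 * a p) (fun p => (lam t).2 * a p); last by exists U.
move=> t; have [It|nIt] := pselect (I t).
  by have [U hU] := classical_potential P0 (sol It); exists U.
(* An arbitrary value at times outside [I]. *)
by exists (Potfun (cst 0) (cst 0) (cst 0) (cst 0) (cst 0)).
Qed.

Lemma solution_above (t0 tm : R) (Y : curve_pair (R := R)) : I t0 -> I tm -> tm < t0 ->
  classical_solution P a (lam t0) Y -> pair_lt (Gam tm) Y ->
  Le (bar (Gam t0).1) (bar Y.1) /\ Le (bar (Gam t0).2) (bar Y.2).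
Proof.
move=> It0 Itm tm0 Ysol mY.
have sub t : tm <= t <= t0 -> I t by exact: Iitv.
have pX t : I t -> pairX P (Gam t) by move=> /sol[].
have pY : pairX P Y by case: Ysol.
have [U hU] := family_potentials; have [W hW] := classical_potential P0 Ysol.
have sepX (X : curve_pair (R := R)) : pairX P X -> sep P 1 (bar X.1) /\ sep P 1 (bar X.2).
  by move=> [x1 x2 _]; split; exact: arcX_sep.
have ltX (X : curve_pair (R := R)) : pairX P X -> Lt (bar X.1) (bar X.2).
  by move=> [x1 x2 x12]; exact: (arc_lt_Lt P0 x1 x2 x12).
apply: (@family_stays_below _ P P0 1 tm t0 (fun t => (bar (Gam t).1, bar (Gam t).2)) (bar Y.1, bar Y.2)
  (fun t p => (lam t).1 * a p) (fun t p => (lam t).2 * a p)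
  (fun p => (lam t0).1 * a p) (fun p => (lam t0).2 * a p) W U) => //.
- by move=> t /sub /pX; exact: sepX.
- exact: sepX.
- move=> s t ms st tt; apply: (pair_lt_Lt P0); [apply: pX|apply: pX|apply: ord => //];
    by apply: sub; rewrite ?ms ?tt ?(le_trans ms (ltW st)) ?(le_trans (ltW st) tt).
- move=> t e /sub It e0; have [d d0 hd] := lipschitz_family_close lip It e0.
  by exists d => // s /sub Is; exact: hd.
- by split => //; exact: ltX.
- by move=> p; rewrite mulr_gt0 //; case: (lampos t0).
- by move=> t /sub It; split; [apply: ltX; exact: pX|exact: hU].
- by move=> t p; rewrite mulr_gt0 //; case: (lampos t).
- by move=> t p /andP[_ tt]; rewrite !ltr_pM2r // lam1 // lam2.
- by apply: (pair_lt_Lt P0) => //; exact: pX.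
Qed.

(* [solution_above] upside down, with time running backwards. *)
Lemma solution_below (t0 tp : R) (Y : curve_pair (R := R)) : I t0 -> I tp -> t0 < tp ->
  classical_solution P a (lam t0) Y -> pair_lt Y (Gam tp) ->
  Le (bar Y.1) (bar (Gam t0).1) /\ Le (bar Y.2) (bar (Gam t0).2).
Proof.
move=> It0 Itp tp0 Ysol Yp.
have sub t : - tp <= t <= - t0 -> I (- t).
  by move=> /andP[h1 h2]; apply: (Iitv It0 Itp); rewrite lerNr h2 lerNl h1.
have pX t : I t -> pairX P (Gam t) by move=> /sol[].
have pY : pairX P Y by case: Ysol.
have [U hU] := family_potentials; have [W hW] := classical_potential P0 Ysol.
have sepX (X : curve_pair (R := R)) : pairX P X -> sep P (- 1) (flip (bar X.2)) /\ sep P (- 1) (flip (bar X.1)).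
  by move=> [x1 x2 _]; split; apply: sep_flip; exact: arcX_sep.
have ltX (X : curve_pair (R := R)) : pairX P X -> Lt (flip (bar X.2)) (flip (bar X.1)).
  by move=> [x1 x2 x12]; apply: Lt_flip; exact: (arc_lt_Lt P0 x1 x2 x12).
(* The flip puts [lam] of the upper arc in first place. Since [(lam t).2] decreases and [(lam t).1]
   increases, reversing time restores the monotonicity of slopes that the comparison expects. *)
have [|||||||||||h1 h2] := @family_stays_below _ P P0 (- 1) (- tp) (- t0)
  (fun t => (flip (bar (Gam (- t)).2), flip (bar (Gam (- t)).1))) (flip (bar Y.2), flip (bar Y.1))
  (fun t p => (lam (- t)).2 * a p) (fun t p => (lam (- t)).1 * a p)
  (fun p => (lam t0).2 * a p) (fun p => (lam t0).1 * a p) (potflip W) (fun t => potflip (U (- t))).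
- by rewrite ltrN2.
- by move=> t /sub /pX; exact: sepX.
- exact: sepX.
- move=> s t ms st tt /=.
  have Is : I (- s) by apply: sub; rewrite ms (le_trans (ltW st) tt).
  have It : I (- t) by apply: sub; rewrite tt (le_trans ms (ltW st)).
  have ts : - t < - s by rewrite ltrN2.
  have [l1 l2] := pair_lt_Lt P0 (pX _ It) (pX _ Is) (ord It Is ts).
  by split; exact: Lt_flip.
- move=> t e /sub It e0; have [d d0 hd] := lipschitz_family_close lip It e0.
  exists d => // s /sub Is st; have [|c1 c2] := hd (- s) Is; first by rewrite -opprD normrN.
  by split; exact: close_to_flip.
- by split; [exact: ltX|exact: potential_flip].
- by move=> p; rewrite mulr_gt0 //; case: (lampos t0).
- by move=> t /sub It; split; [apply: ltX; exact: pX|apply: potential_flip; exact: hU].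
- by move=> t p; rewrite mulr_gt0 //; case: (lampos (- t)).
- by move=> t p /andP[_ tt]; rewrite !ltr_pM2r // lam1 ?lam2 // ltrNr.
- rewrite /= opprK; have [l1 l2] := pair_lt_Lt P0 pY (pX _ Itp) Yp.
  by split; exact: Lt_flip.
- by rewrite /= opprK in h1 h2; split; [exact: Le_flip h2|exact: Le_flip h1].
Qed.

End Family.

End Assembly.

Unset Implicit Arguments.

Theorem corollary4p16 (R : realType) (P : R) (hP : 0 < P)
  (G Gm Gp : set (R * R)) (hG : strip_like_domain P G Gm Gp)
  (Alo Ahi A1 A2 : R) (hAlo : 0 < Alo) (hAhi : Alo <= Ahi)
  (hA1 : 0 < A1) (hA2 : 0 < A2)
  (rho : R) (hrho : 0 < rho /\ rho <= 1)
  (a : R * R -> R) (haA : classA Alo Ahi A1 A2 a) (haC : Ck_alpha 3 rho a)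
  (haP : periodic_fun P a) (hasub : log_subharmonic G a)
  (lamhat : R * R) (hlamhat : 0 < lamhat.1 /\ 0 < lamhat.2)
  (Gamhat : set (R * R) * set (R * R))
  (hGX : pairX_in P Gm Gp Gamhat) (hGC : pair_regular 3 rho Gamhat)
  (hGsol : classical_solution P a lamhat Gamhat)
  (rho0 r0 : R) (hrho0 : 0 < rho0 /\ rho0 < pi) (hr0 : 0 < r0)
  (hGR : classR P Gm Gp a lamhat rho0 Gamhat)
  (hGS : classS P Gm Gp a lamhat r0 Gamhat)
  (t0 : R) (lam : R -> R * R)
  (hlam_pos : forall t, 0 < (lam t).1 /\ 0 < (lam t).2)
  (hlam_smooth : smooth (fun t => (lam t).1) /\ smooth (fun t => (lam t).2))
  (hlam_t0 : lam t0 = lamhat)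
  (hlam1 : forall s t, s < t -> (lam s).1 < (lam t).1)
  (hlam1m : (lam t).1 @[t --> -oo] --> (0 : R))
  (hlam1p : (lam t).1 @[t --> +oo] --> +oo)
  (hlam2 : forall s t, s < t -> (lam t).2 < (lam s).2)
  (hlam2m : (lam t).2 @[t --> -oo] --> +oo)
  (hlam2p : (lam t).2 @[t --> +oo] --> (0 : R))
  (I : set R) (hIopen : open I) (hIitv : is_interval I) (hIt0 : I t0)
  (Gam : R -> set (R * R) * set (R * R))
  (hGamX : forall t, I t ->
     pairX_in P Gm Gp (Gam t) /\ pair_regular 3 rho (Gam t))
  (hGamlip : locally_lipschitz_family I Gam)
  (hGamord : positively_ordered I Gam)
  (hGamt0 : Gam t0 = Gamhat)
  (hGamsol : forall t, I t -> classical_solution P a (lam t) (Gam t)) :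
  unique (fun Gamtil : set (R * R) * set (R * R) =>
    [/\ pairX_in P Gm Gp Gamtil,
        classical_solution P a lamhat Gamtil &
        exists tm tp : R, [/\ I tm, I tp, tm < t0 /\ t0 < tp,
          pair_lt (Gam tm) Gamtil & pair_lt Gamtil (Gam tp)]])
    Gamhat.
Proof.
have apos : forall p, 0 < a p by case: haA.
have sol0 : classical_solution P a (lam t0) Gamhat by rewrite hlam_t0.
have pX : pairX P Gamhat by case: hGsol.
split.
- split => //.
  (* The solution [Gamhat] must itself be squeezed between two members; since [I] is open, it
     contains times on both sides of [t0]. *)
  have /nbhsR[r rpos hr] : nbhs t0 I by apply: open_nbhs_nbhs.
  have r2 : 0 < r / 2 by rewrite divr_gt0.
  have Im : I (t0 - r / 2).
    by apply: hr; rewrite addrAC subrr add0r normrN gtr0_norm //; lra.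
  have Ip : I (t0 + r / 2).
    by apply: hr; rewrite addrAC subrr add0r gtr0_norm //; lra.
  exists (t0 - r / 2), (t0 + r / 2); split => //.
  + by split; lra.
  + by rewrite -hGamt0; apply: hGamord => //; lra.
  + by rewrite -hGamt0; apply: hGamord => //; lra.
- move=> Y [_ Ysol [tm [tp [Im Ip [tm0 tp0] mY Yp]]]].
  have pY : pairX P Y by case: Ysol.
  rewrite -hlam_t0 in Ysol.
  have [h1 h2] := solution_above hP apos hlam_pos hlam1 hlam2 hIitv hGamlip hGamord hGamsol hIt0 Im tm0 Ysol mY.
  have [h3 h4] := solution_below hP apos hlam_pos hlam1 hlam2 hIitv hGamlip hGamord hGamsol hIt0 Ip tp0 Ysol Yp.
  rewrite hGamt0 in h1 h2 h3 h4.
  exact: (bar_pair_eq hP pX pY h1 h2 h3 h4).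
Qed.
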